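(* Let $0<q<1$, let $a,b,c,d$ be nonzero complex numbers with $\max(|a|,|b|,|c|,|q/d|)<1$, and let $\nu\in\mathbb{C}$. With $u_\nu(x;a,b,c;d)$ and $x(z)=\tfrac12(q^z+q^{-z})$ as defined in the context, put $$u(z)=u_\nu(x(z);a,b,c;d),\qquad v(z)=u_\nu(x(z);a,b,d;c)$$ (so $v$ is obtained from $u$ by interchanging $c$ and $d$), and let $$W(u(z),v(z))=u(z)\,\frac{v(z)-v(z-1)}{x(z)-x(z-1)}-v(z)\,\frac{u(z)-u(z-1)}{x(z)-x(z-1)} .$$ Then, for all $z$ and parameters for which both sides are defined, $$W(u(z),v(z))=\frac{2q\,(c/d,\,qd/c,\,q^{-\nu},\,abcdq^{\nu-1},\,abq^\nu,\,q^{1-\nu}/(cd);q)_\infty}{(1-q)\,c\,(ab,\,ab,\,ac,\,ad,\,bc,\,bd;q)_\infty}\cdot\frac{(aq^z,\,aq^{1-z},\,bq^z,\,bq^{1-z};q)_\infty}{(q^z/c,\,q^{1-z}/c,\,q^z/d,\,q^{1-z}/d;q)_\infty}.$$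
   Context: Notation: $(a;q)_n=\prod_{k=1}^n(1-aq^{k-1})$, $(a;q)_\infty=\prod_{k\ge1}(1-aq^{k-1})$, $(a_1,\dots,a_r;q)_n=\prod_{j=1}^r(a_j;q)_n$ for $n=0,1,2,\dots$ or $n=\infty$, and $${}_4\varphi_3\!\left(\begin{matrix}a_1,a_2,a_3,a_4\\ b_1,b_2,b_3\end{matrix};q,t\right)=\sum_{n=0}^\infty\frac{(a_1,a_2,a_3,a_4;q)_n}{(q,b_1,b_2,b_3;q)_n}t^n .$$ For complex $\nu$ and $x=x(z)=\tfrac12(q^z+q^{-z})$, define $$u_\nu(x;a,b,c;d)=\frac{(bcq^\nu,\,q^{1-\nu}/(ad);q)_\infty}{(bc,\,q/(ad);q)_\infty}\;{}_4\varphi_3\!\left(\begin{matrix}q^{-\nu},abcdq^{\nu-1},aq^z,aq^{-z}\\ ab,ac,ad\end{matrix};q,q\right)$$ $$+\frac{(q^{-\nu},\,abcdq^{\nu-1},\,qb/d,\,qc/d;q)_\infty}{(ab,\,ac,\,bc,\,ad/q;q)_\infty}\,\frac{(aq^z,\,aq^{-z};q)_\infty}{(q^{1+z}/d,\,q^{1-z}/d;q)_\infty}\;{}_4\varphi_3\!\left(\begin{matrix}q^{1-\nu}/(ad),\,bcq^\nu,\,q^{1+z}/d,\,q^{1-z}/d\\ qb/d,\,qc/d,\,q^2/(ad)\end{matrix};q,q\right).$$ When $ad$ is an integer power of $q$ the singularity of the sum is removable and the value is taken by continuity in the parameters. When $|bcq^\nu|<1$ this function equals the very-well-poised ${}_8\varphi_7$-function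 $$\frac{(qa/d,bcq^\nu,q^{1-\nu+z}/d,q^{1-\nu-z}/d;q)_\infty}{(q^{1-\nu}a/d,bc,q^{1+z}/d,q^{1-z}/d;q)_\infty}\sum_{n\ge0}\frac{1-Aq^{2n}}{1-A}\,\frac{(A,q^{-\nu},q^{1-\nu}/(bd),q^{1-\nu}/(cd),aq^z,aq^{-z};q)_n}{(q,aq/d,ab,ac,q^{1-\nu-z}/d,q^{1-\nu+z}/d;q)_n}(bcq^\nu)^n,\quad A=\frac{aq^{-\nu}}{d}.$$ *)

(* Defs.v *)
From Stdlib Require Import Reals List.
From Coquelicot Require Import Coquelicot.
Import ListNotations.
Open Scope C_scope.

(* The limit of [f] along the filter [F]; unspecified if there is none. *)
Definition Climit {T : Type} (F : (T -> Prop) -> Prop) (f : T -> C) : C :=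
  iota (T := C_CompleteNormedModule) (fun l : C => filterlim f F (locally l)).

Definition Csum (f : nat -> C) : C :=
  iota (T := C_CompleteNormedModule) (fun l : C => is_series f l).

(* q^z = exp (z log q), with the real logarithm of q > 0. *)
Definition qpow (q : R) (z : C) : C :=
  let w := z * RtoC (ln q) in
  (exp (Re w) * cos (Im w), exp (Re w) * sin (Im w))%R.

Fixpoint qpoch (q : R) (a : C) (n : nat) : C :=
  match n with
  | O => 1
  | S m => qpoch q a m * (1 - a * RtoC q ^ m)
  end.

Definition qpoch_inf (q : R) (a : C) : C := Climit eventually (qpoch q a).

Definition Cprod (l : list C) : C := fold_right Cmult 1 l.

(* (a_1,...,a_r; q)_n and (a_1,...,a_r; q)_oo *)
Definition qpochs (q : R) (l : list C) (n : nat) : C :=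
  Cprod (map (fun a => qpoch q a n) l).

Definition qpochs_inf (q : R) (l : list C) : C := Cprod (map (qpoch_inf q) l).

Definition phi43 (q : R) (a1 a2 a3 a4 b1 b2 b3 t : C) : C :=
  Csum (fun n : nat =>
    qpochs q [a1; a2; a3; a4] n / qpochs q [RtoC q; b1; b2; b3] n * t ^ n).

Definition xz (q : R) (z : C) : C := (qpow q z + qpow q (- z)) / 2.

(* The explicit sum of two 4phi3 series, as a function of z (it depends on z
   only through x(z)). *)
Definition u_formula (q : R) (nu a b c d z : C) : C :=
  qpochs_inf q [b * c * qpow q nu; qpow q (1 - nu) / (a * d)]
  / qpochs_inf q [b * c; q / (a * d)]
  * phi43 q (qpow q (- nu)) (a * b * c * d * qpow q (nu - 1))
      (a * qpow q z) (a * qpow q (- z))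
      (a * b) (a * c) (a * d) q
  + qpochs_inf q [qpow q (- nu); a * b * c * d * qpow q (nu - 1);
                  q * b / d; q * c / d]
    / qpochs_inf q [a * b; a * c; b * c; a * d / q]
    * (qpochs_inf q [a * qpow q z; a * qpow q (- z)]
       / qpochs_inf q [qpow q (1 + z) / d; qpow q (1 - z) / d])
    * phi43 q (qpow q (1 - nu) / (a * d)) (b * c * qpow q nu)
        (qpow q (1 + z) / d) (qpow q (1 - z) / d)
        (q * b / d) (q * c / d) (RtoC q ^ 2 / (a * d)) q.

(* No denominator occurring in [u_formula] vanishes. As 0 < q < 1, an infinite
   product (w;q)_oo is zero iff one of its factors is. *)
Definition u_regular (q : R) (a b c d z : C) : Prop :=
  a <> 0 /\ d <> 0 /\
  List.Forall (fun w : C => forall k : nat, 1 - w * RtoC q ^ k <> 0)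
    [b * c; q / (a * d); a * b; a * c; a * d; a * d / q;
     qpow q (1 + z) / d; qpow q (1 - z) / d;
     q * b / d; q * c / d; RtoC q ^ 2 / (a * d)].

(* [w] is the value of u_nu(x(z);a,b,c;d): given by the formula at regular
   parameters, and otherwise (in particular when a d is an integer power of q)
   its limit as regular parameters (a',b',c',d') tend jointly to (a,b,c,d). *)
Definition is_u (q : R) (nu a b c d z w : C) : Prop :=
  (u_regular q a b c d z /\ w = u_formula q nu a b c d z) \/
  (~ u_regular q a b c d z /\
   filterlim
     (fun p : C * C * C * C =>
        let '(a', b', c', d') := p in u_formula q nu a' b' c' d' z)
     (within (fun p : C * C * C * C =>
                let '(a', b', c', d') := p in u_regular q a' b' c' d' z)
        (locally (a, b, c, d)))
     (locally w)).

Definition u_fun (q : R) (nu a b c d z : C) : C :=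
  iota (T := C_CompleteNormedModule) (is_u q nu a b c d z).

Definition W (q : R) (f g : C -> C) (z : C) : C :=
  f z * ((g z - g (z - 1)) / (xz q z - xz q (z - 1)))
  - g z * ((f z - f (z - 1)) / (xz q z - xz q (z - 1))).

(* Main.v *)
Require Import Defs.
From Stdlib Require Import Reals List Lra Lia FunctionalExtensionality Classical.
From Coquelicot Require Import Coquelicot.
Import ListNotations.
Open Scope C_scope.

(** Write [X = q^z] and [N = q^nu].

    As functions of [z], both [u] and [v] solve the Askey-Wilson q-difference equation
    ([difference_equation]), whose coefficients are symmetric in [c] and [d]. Their Casoratian
    [u(z-1) v(z) - u(z) v(z-1)] therefore satisfies a first-order equation relating its values at
    [X] and [q X] ([casoratian_shift]), and the right-hand side of the theorem, multiplied by
    [x(z) - x(z-1)], satisfies the same one. So the quotient of the two sides is invariant under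
    [X -> q X]. It is holomorphic near the annulus [q <= |X| <= 1], since [|a| < 1] and [|b| < 1]
    keep the zeros of [(a X, a q / X, b X, b q / X; q)_oo] away from it, and hence it is constant
    ([annulus_rigidity], [casoratian_global]).

    The constant is determined at [X = d] ([casoratian_closed_form]). At the pole [X = d/q] of
    [u] only one term of its series contributes, and at [X = d] the series of [v] become 3phi2
    series, which the nonterminating q-Saalschuetz formula sums ([q_saalschuetz]).

    The complex analysis is elementary. All functions that occur are, on annuli, uniform limits
    of Laurent polynomials, and the coefficients of a Laurent polynomial are bounded by averages
    over roots of unity ([cauchy_estimate]). Invariance under [X -> q X] forces all of them but
    the constant one to be small ([almost_periodic_const]).

    If [ad] is a power [q^m] with [m >= 1], the two terms in the definition of [u] are singular.
    Cleared of denominators, their sum is the function [PhiU], which is regular there and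
    vanishes ([Phi_vanish]). It can be divided by the simple zero in the variable
    [e = q/(ad)], by the same Cauchy estimates with [a], [b], [c] as parameters
    ([removable_limit]). Hence the value of [u] at singular parameters is the limit of the
    explicit formula ([u_fun_limit]), and the theorem follows from its regular case
    ([wronskian_regular]) along the family [(a, b, c/t, d t)] with [t -> 1]. *)

(** * Limits of complex-valued functions *)

(** Convergence in terms of the modulus; it agrees with [filterlim] by [clim_filterlim]. *)
Definition clim {T : Type} (F : (T -> Prop) -> Prop) (f : T -> C) (l : C) : Prop :=
  forall eps : R, (0 < eps)%R -> F (fun t => (Cmod (f t - l) < eps)%R).

Lemma clim_filterlim {T : Type} (F : (T -> Prop) -> Prop) {HF : Filter F}
  (f : T -> C) (l : C) :
  clim F f l <-> filterlim f F (locally l).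
Proof.
  split.
  - intros H. apply (filterlim_locally_ball_norm (U := C_NormedModule) f l).
    intros eps. exact (H eps (cond_pos eps)).
  - intros H eps Heps.
    exact (proj1 (filterlim_locally_ball_norm (U := C_NormedModule) f l) H
             (mkposreal eps Heps)).
Qed.

Lemma clim_unique {T : Type} (F : (T -> Prop) -> Prop) {HF : ProperFilter F}
  (f : T -> C) (l l' : C) : clim F f l -> clim F f l' -> l = l'.
Proof.
  intros H1 H2.
  apply (filterlim_locally_unique (V := C_NormedModule) (F := F) f);
    apply (clim_filterlim F); assumption.
Qed.

Lemma Cmod_minus_sym (x y : C) : Cmod (x - y) = Cmod (y - x).
Proof. rewrite <- (Cmod_opp (x - y)). f_equal. ring. Qed.

Lemma Cmod_tri3 (x y z : C) : (Cmod (x - z) <= Cmod (x - y) + Cmod (y - z))%R.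
Proof. replace (x - z) with ((x - y) + (y - z)) by ring. apply Cmod_triangle. Qed.

Lemma Cmod_le_plus (x y : C) : (Cmod x <= Cmod y + Cmod (x - y))%R.
Proof. replace x with (y + (x - y)) at 1 by ring. apply Cmod_triangle. Qed.

Lemma Cmod_mult_le (x y : C) (A B : R) :
  (Cmod x <= A)%R -> (Cmod y <= B)%R -> (Cmod (x * y) <= A * B)%R.
Proof.
  intros Hx Hy. rewrite Cmod_mult. apply Rmult_le_compat; auto using Cmod_ge_0.
Qed.

Lemma Cminus_eq_0 (x y : C) : x - y = 0 -> x = y.
Proof. intros H. replace x with ((x - y) + y) by ring. rewrite H. ring. Qed.

Lemma Cmult_neq0_l (u v : C) : u * v <> 0 -> u <> 0.
Proof. intros H E. apply H. rewrite E. ring. Qed.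

Lemma Cmult_neq0_r (u v : C) : u * v <> 0 -> v <> 0.
Proof. intros H E. apply H. rewrite E. ring. Qed.

Lemma Cmod_lt_neq (x y : C) : (Cmod x < Cmod y)%R -> y - x <> 0.
Proof. intros H E. apply Cminus_eq_0 in E. rewrite E in H. lra. Qed.

Section Clim.
Context {T : Type} (F : (T -> Prop) -> Prop) {HF : Filter F}.

Lemma clim_const (c : C) : clim F (fun _ => c) c.
Proof.
  intros eps Heps. apply filter_forall. intros _.
  replace (c - c) with (RtoC 0) by ring. rewrite Cmod_0. exact Heps.
Qed.

Lemma clim_ext_loc (f g : T -> C) (l : C) :
  F (fun t => f t = g t) -> clim F f l -> clim F g l.
Proof.
  intros He H eps Heps. generalize (filter_and _ _ He (H eps Heps)).
  apply filter_imp. intros t [-> Ht]. exact Ht.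
Qed.

Lemma clim_ext (f g : T -> C) (l : C) :
  (forall t, f t = g t) -> clim F f l -> clim F g l.
Proof. intros He. apply clim_ext_loc, filter_forall, He. Qed.

Lemma clim_plus (f g : T -> C) (l m : C) :
  clim F f l -> clim F g m -> clim F (fun t => f t + g t) (l + m).
Proof.
  intros Hf Hg eps Heps.
  assert (He : (0 < eps / 2)%R) by lra.
  generalize (filter_and _ _ (Hf _ He) (Hg _ He)). apply filter_imp.
  intros t [H1 H2].
  replace (f t + g t - (l + m)) with ((f t - l) + (g t - m)) by ring.
  eapply Rle_lt_trans; [apply Cmod_triangle | lra].
Qed.

Lemma clim_bounded (f : T -> C) (l : C) :
  clim F f l -> F (fun t => (Cmod (f t) <= Cmod l + 1)%R).
Proof.
  intros H. generalize (H 1%R Rlt_0_1). apply filter_imp. intros t Ht.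
  generalize (Cmod_le_plus (f t) l). lra.
Qed.

Lemma clim_mult (f g : T -> C) (l m : C) :
  clim F f l -> clim F g m -> clim F (fun t => f t * g t) (l * m).
Proof.
  intros Hf Hg eps Heps.
  assert (Hl := Cmod_ge_0 l). assert (Hm := Cmod_ge_0 m).
  set (A := (Cmod l + Cmod m + 1)%R).
  assert (HA : (0 < A)%R) by (unfold A; lra).
  assert (He : (0 < eps / (2 * A))%R) by (apply Rdiv_lt_0_compat; lra).
  generalize (filter_and _ _ (filter_and _ _ (Hf _ He) (Hg _ He)) (clim_bounded _ _ Hf)).
  apply filter_imp. intros t [[H1 H2] H3].
  replace (f t * g t - l * m) with (f t * (g t - m) + (f t - l) * m) by ring.
  eapply Rle_lt_trans; [apply Cmod_triangle |]. rewrite !Cmod_mult.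
  assert (Cmod (f t) * Cmod (g t - m) <= A * Cmod (g t - m))%R.
  { apply Rmult_le_compat_r; [apply Cmod_ge_0 | unfold A; lra]. }
  assert (Cmod (f t - l) * Cmod m <= Cmod (f t - l) * A)%R.
  { apply Rmult_le_compat_l; [apply Cmod_ge_0 | unfold A; lra]. }
  assert (A * Cmod (g t - m) < A * (eps / (2 * A)))%R by (apply Rmult_lt_compat_l; lra).
  assert (Cmod (f t - l) * A < eps / (2 * A) * A)%R by (apply Rmult_lt_compat_r; lra).
  replace eps with (A * (eps / (2 * A)) + eps / (2 * A) * A)%R by (field; lra). lra.
Qed.

Lemma clim_opp (f : T -> C) (l : C) : clim F f l -> clim F (fun t => - f t) (- l).
Proof.
  intros H eps Heps. generalize (H eps Heps). apply filter_imp. intros t Ht.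
  replace (- f t - - l) with (- (f t - l)) by ring. rewrite Cmod_opp. exact Ht.
Qed.

Lemma clim_minus (f g : T -> C) (l m : C) :
  clim F f l -> clim F g m -> clim F (fun t => f t - g t) (l - m).
Proof. intros Hf Hg. apply clim_plus; [exact Hf | apply clim_opp, Hg]. Qed.

Lemma clim_neq (f : T -> C) (l : C) :
  clim F f l -> l <> 0 -> F (fun t => (Cmod l / 2 < Cmod (f t))%R).
Proof.
  intros H Hl. assert (Hp := Cmod_gt_0 l). destruct Hp as [Hp _]. specialize (Hp Hl).
  assert (He : (0 < Cmod l / 2)%R) by lra.
  generalize (H _ He). apply filter_imp. intros t Ht.
  generalize (Cmod_le_plus l (f t)). rewrite Cmod_minus_sym. lra.
Qed.

Lemma clim_nonzero (f : T -> C) (l : C) :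
  clim F f l -> l <> 0 -> F (fun t => f t <> 0).
Proof.
  intros H Hl. generalize (clim_neq f l H Hl). apply filter_imp. intros t Ht E.
  rewrite E, Cmod_0 in Ht. generalize (Cmod_ge_0 l). lra.
Qed.

Lemma clim_inv (f : T -> C) (l : C) :
  clim F f l -> l <> 0 -> clim F (fun t => / f t) (/ l).
Proof.
  intros H Hl eps Heps. assert (Hp := proj1 (Cmod_gt_0 l) Hl).
  assert (He : (0 < eps * (Cmod l * Cmod l / 2))%R).
  { apply Rmult_lt_0_compat; [exact Heps |].
    assert (0 < Cmod l * Cmod l)%R by (apply Rmult_lt_0_compat; exact Hp). lra. }
  generalize (filter_and _ _ (H _ He) (clim_neq f l H Hl)). apply filter_imp.
  intros t [H1 H2].
  assert (Hf : f t <> 0) by (intros E; rewrite E, Cmod_0 in H2; lra).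
  assert (Hfp := proj1 (Cmod_gt_0 _) Hf).
  replace (/ f t - / l) with ((l - f t) * / (f t * l)) by (field; auto).
  rewrite Cmod_mult, Cmod_inv, Cmod_mult, Cmod_minus_sym by (apply Cmult_neq_0; assumption).
  assert (Hd : (0 < Cmod (f t) * Cmod l)%R) by (apply Rmult_lt_0_compat; assumption).
  apply (Rmult_lt_reg_r (Cmod (f t) * Cmod l)); [exact Hd |].
  rewrite Rmult_assoc, Rinv_l by lra. rewrite Rmult_1_r.
  eapply Rlt_le_trans; [exact H1 |].
  apply Rmult_le_compat_l; [lra |].
  replace (Cmod l * Cmod l / 2)%R with (Cmod l / 2 * Cmod l)%R by field.
  apply Rmult_le_compat_r; lra.
Qed.

Lemma clim_div (f g : T -> C) (l m : C) :
  clim F f l -> clim F g m -> m <> 0 -> clim F (fun t => f t / g t) (l / m).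
Proof. intros Hf Hg Hm. apply clim_mult; [exact Hf | apply clim_inv; assumption]. Qed.

End Clim.

Lemma clim_map {S T : Type} (G : (S -> Prop) -> Prop) (F : (T -> Prop) -> Prop)
  (h : S -> T) (f : T -> C) (l : C) :
  filterlim h G F -> clim F f l -> clim G (fun s => f (h s)) l.
Proof. intros Hh H eps Heps. exact (Hh _ (H eps Heps)). Qed.

Lemma clim_cauchy {T : Type} (F : (T -> Prop) -> Prop) {HF : ProperFilter F} (f : T -> C) :
  (forall eps : R, (0 < eps)%R -> exists P : T -> Prop,
     F P /\ forall s t, P s -> P t -> (Cmod (f s - f t) < eps)%R) ->
  exists l, clim F f l.
Proof.
  intros H.
  destruct (proj1 (filterlim_locally_cauchy (U := C_CompleteNormedModule) (F := F) f))
    as [l Hl].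
  - intros eps. destruct (H eps (cond_pos eps)) as [P [HP Hc]].
    exists P. split; [exact HP |]. intros s t Hs Ht.
    apply (norm_compat1 (V := C_NormedModule)). apply (Hc t s Ht Hs).
  - exists l. apply (clim_filterlim F). exact Hl.
Qed.

(** * Sequences and series with geometrically small increments *)

Fixpoint psum (f : nat -> C) (n : nat) : C :=
  match n with O => 0 | S m => psum f m + f m end.

Lemma psum_ext (f g : nat -> C) (n : nat) :
  (forall k, (k < n)%nat -> f k = g k) -> psum f n = psum g n.
Proof.
  induction n as [|n IH]; intros H; simpl; [reflexivity |].
  rewrite IH, H; auto.
Qed.

Lemma psum_plus (f g : nat -> C) (n : nat) :
  psum (fun k => f k + g k) n = psum f n + psum g n.
Proof. induction n as [|n IH]; simpl; [ring | rewrite IH; ring]. Qed.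

Lemma psum_scal (c : C) (f : nat -> C) (n : nat) :
  psum (fun k => c * f k) n = c * psum f n.
Proof. induction n as [|n IH]; simpl; [ring | rewrite IH; ring]. Qed.

Lemma psum_head (f : nat -> C) (n : nat) :
  psum f (S n) = f O + psum (fun k => f (S k)) n.
Proof.
  induction n as [|n IH]; [simpl; ring |].
  change (psum f (S (S n))) with (psum f (S n) + f (S n)). rewrite IH. simpl. ring.
Qed.

Lemma psum_split (f : nat -> C) (m n : nat) :
  psum f (m + n) = psum f m + psum (fun k => f (m + k)%nat) n.
Proof.
  induction n as [|n IH]; simpl; [rewrite Nat.add_0_r; ring |].
  rewrite <- plus_n_Sm. simpl. rewrite IH. ring.
Qed.

Lemma psum_zero (f : nat -> C) (n : nat) :
  (forall k, (k < n)%nat -> f k = 0) -> psum f n = 0.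
Proof.
  induction n as [|n IH]; intros H; simpl; [reflexivity |].
  rewrite IH, H; auto. ring.
Qed.

Lemma psum_Cmod (f : nat -> C) (A : R) (n : nat) :
  (forall k, (k < n)%nat -> (Cmod (f k) <= A)%R) -> (Cmod (psum f n) <= INR n * A)%R.
Proof.
  induction n as [|n IH]; intros H; [simpl; rewrite Cmod_0; lra |].
  rewrite S_INR. simpl psum.
  eapply Rle_trans; [apply Cmod_triangle |].
  generalize (IH (fun k Hk => H k (Nat.lt_lt_succ_r _ _ Hk))) (H n (Nat.lt_succ_diag_r n)). lra.
Qed.

Lemma psum_sum_n (f : nat -> C) (n : nat) :
  sum_n (G := C_AbelianMonoid) f n = psum f (S n).
Proof.
  induction n as [|n IH].
  - rewrite sum_O. simpl. ring.
  - rewrite sum_Sn, IH. reflexivity.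
Qed.

Lemma eventually_S (P : nat -> Prop) : eventually (fun n => P (S n)) -> eventually P.
Proof.
  intros [N H]. exists (S N). intros n Hn. destruct n as [|n]; [lia |].
  apply H. lia.
Qed.

Lemma is_series_psum (f : nat -> C) (l : C) :
  is_series (V := C_NormedModule) f l <-> clim eventually (psum f) l.
Proof.
  unfold is_series. split; intros H.
  - apply (clim_filterlim eventually) in H. intros eps Heps. apply eventually_S.
    generalize (H eps Heps). apply filter_imp. intros n. rewrite psum_sum_n. auto.
  - apply (clim_filterlim eventually). intros eps Heps.
    destruct (H eps Heps) as [N HN]. exists N. intros n Hn.
    rewrite psum_sum_n. apply HN. lia.
Qed.

Lemma Csum_unique (f : nat -> C) (l : C) : clim eventually (psum f) l -> Csum f = l.
Proof.
  intros H. unfold Csum. apply (iota_unique (V := C_CompleteNormedModule)).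
  - intros y Hy. apply (clim_unique eventually (psum f)); [| exact H].
    apply is_series_psum. exact Hy.
  - apply is_series_psum. exact H.
Qed.

Lemma Climit_unique {T : Type} (F : (T -> Prop) -> Prop) {HF : ProperFilter F}
  (f : T -> C) (l : C) : clim F f l -> Climit F f = l.
Proof.
  intros H. unfold Climit. apply (iota_unique (V := C_CompleteNormedModule)).
  - intros y Hy. apply (clim_unique F f); [| exact H].
    apply (clim_filterlim F). exact Hy.
  - apply (clim_filterlim F). exact H.
Qed.

Lemma clim_seq_shift (f : nat -> C) (l : C) (m : nat) :
  clim eventually f l -> clim eventually (fun n => f (m + n)%nat) l.
Proof.
  intros H eps Heps. destruct (H eps Heps) as [N HN]. exists N. intros n Hn.
  apply HN. lia.
Qed.

Lemma clim_Cmod_le (f : nat -> C) (l : C) (A : R) :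
  clim eventually f l -> eventually (fun n => (Cmod (f n) <= A)%R) -> (Cmod l <= A)%R.
Proof.
  intros H HA. apply le_epsilon. intros eps Heps.
  destruct (filter_ex _ (filter_and _ _ (H eps Heps) HA)) as [n [H1 H2]].
  generalize (Cmod_le_plus l (f n)). rewrite Cmod_minus_sym. lra.
Qed.

Lemma clim_pow_0 (x : C) : (Cmod x < 1)%R -> clim eventually (fun n => x ^ n) 0.
Proof.
  intros Hx eps Heps.
  assert (Hx' : (Rabs (Cmod x) < 1)%R) by (rewrite Rabs_pos_eq; [exact Hx | apply Cmod_ge_0]).
  destruct (pow_lt_1_zero (Cmod x) Hx' eps Heps) as [N HN]. exists N. intros n Hn.
  replace (x ^ n - 0) with (x ^ n) by ring. rewrite Cmod_pow.
  eapply Rle_lt_trans; [apply Rle_abs | apply HN; lia].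
Qed.

(** * Uniformly closed algebras of bounded functions *)

(** Functions with a limit along a filter, and uniform limits of Laurent polynomials, with or
    without parameters, are all closed under the operations that build q-series. This record
    collects what is used, so that one proof shows that a q-series stays in each class. *)
Record calg {T : Type} (D : T -> Prop) (K : (T -> C) -> Prop) : Prop := {
  calg_const : forall c : C, K (fun _ => c);
  calg_plus : forall f g, K f -> K g -> K (fun t => f t + g t);
  calg_mult : forall f g, K f -> K g -> K (fun t => f t * g t);
  calg_bounded : forall f, K f -> exists M, forall t, D t -> (Cmod (f t) <= M)%R;
  calg_unif : forall f,
    (forall eps, (0 < eps)%R ->
       exists g, K g /\ forall t, D t -> (Cmod (f t - g t) <= eps)%R) -> K f }.

Arguments calg_const {T D K}.
Arguments calg_plus {T D K}.
Arguments calg_mult {T D K}.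
Arguments calg_bounded {T D K}.
Arguments calg_unif {T D K}.

Lemma psum_geom (x : C) (n : nat) : (1 - x) * psum (fun k => x ^ k) n = 1 - x ^ n.
Proof.
  induction n as [|n IH]; simpl; [ring |].
  rewrite Cmult_plus_distr_l, IH. ring.
Qed.

Section Calg.
Context {T : Type} {D : T -> Prop} {K : (T -> C) -> Prop} (HK : calg D K).

Lemma calg_ext (f g : T -> C) : (forall t, D t -> f t = g t) -> K f -> K g.
Proof.
  intros H Hf. apply (calg_unif HK). intros eps Heps. exists f. split; [exact Hf |].
  intros t Ht. rewrite <- (H t Ht). replace (f t - f t) with (RtoC 0) by ring.
  rewrite Cmod_0. lra.
Qed.

Lemma calg_opp (f : T -> C) : K f -> K (fun t => - f t).
Proof.
  intros Hf. apply (calg_ext (fun t => (-1) * f t)); [intros; ring |].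
  apply (calg_mult HK); [apply (calg_const HK) | exact Hf].
Qed.

Lemma calg_minus (f g : T -> C) : K f -> K g -> K (fun t => f t - g t).
Proof. intros Hf Hg. apply (calg_plus HK); [exact Hf | apply calg_opp, Hg]. Qed.

Lemma calg_bounded_pos (f : T -> C) :
  K f -> exists M, (0 < M)%R /\ forall t, D t -> (Cmod (f t) <= M)%R.
Proof.
  intros Hf. destruct (calg_bounded HK f Hf) as [M HM].
  exists (Rmax M 1). split; [generalize (Rmax_r M 1); lra |].
  intros t Ht. eapply Rle_trans; [apply HM, Ht | apply Rmax_l].
Qed.

Lemma calg_psum (f : nat -> T -> C) (n : nat) :
  (forall k, K (f k)) -> K (fun t => psum (fun k => f k t) n).
Proof.
  intros H. induction n as [|n IH]; simpl; [apply (calg_const HK) |].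
  apply (calg_plus HK); [exact IH | apply H].
Qed.

Lemma calg_pow (f : T -> C) (n : nat) : K f -> K (fun t => f t ^ n).
Proof.
  intros Hf. induction n as [|n IH]; simpl; [apply (calg_const HK) |].
  apply (calg_mult HK); assumption.
Qed.

(** Neumann series. *)
Lemma calg_inv (f : T -> C) (th : R) :
  (0 <= th < 1)%R -> K f -> (forall t, D t -> (Cmod (f t) <= th)%R) ->
  K (fun t => / (1 - f t)).
Proof.
  intros [Ht0 Ht1] Hf Hb. apply (calg_unif HK). intros eps Heps.
  assert (Habs : (Rabs th < 1)%R) by (rewrite Rabs_pos_eq; lra).
  destruct (pow_lt_1_zero th Habs (eps * (1 - th))) as [N HN];
    [apply Rmult_lt_0_compat; lra |].
  exists (fun t => psum (fun k => f t ^ k) N). split.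
  - apply (calg_psum (fun k t => f t ^ k)). intros k. apply calg_pow, Hf.
  - intros t Ht. specialize (Hb t Ht).
    assert (Hge : (1 - th <= Cmod (1 - f t))%R).
    { generalize (Cmod_le_plus 1 (f t)). rewrite Cmod_1. lra. }
    assert (Hne : 1 - f t <> 0) by (apply Cmod_gt_0; lra).
    replace (/ (1 - f t) - psum (fun k => f t ^ k) N)
      with (f t ^ N * / (1 - f t)).
    2:{ assert (G := psum_geom (f t) N).
        apply (f_equal (fun w => w * / (1 - f t))) in G.
        replace ((1 - f t) * psum (fun k => f t ^ k) N * / (1 - f t))
          with (psum (fun k => f t ^ k) N) in G by (field; exact Hne).
        rewrite G. field. exact Hne. }
    rewrite Cmod_mult, Cmod_inv, Cmod_pow by exact Hne.
    apply (Rmult_le_reg_r (Cmod (1 - f t))); [lra |].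
    rewrite Rmult_assoc, Rinv_l, Rmult_1_r by lra.
    apply Rle_trans with (eps * (1 - th))%R.
    + apply Rle_trans with (th ^ N)%R.
      * apply pow_incr. split; [apply Cmod_ge_0 | exact Hb].
      * left. eapply Rle_lt_trans; [apply Rle_abs | apply HN; lia].
    + apply Rmult_le_compat_l; lra.
Qed.

End Calg.

(** * Continuity: functions with a limit along a filter *)

Section ClimAlgebra.
Context {T : Type} (F : (T -> Prop) -> Prop) {HF : Filter F} (D : T -> Prop) (HD : F D).

Definition optD (o : option T) : Prop := match o with None => True | Some t => D t end.

(** The value at [None] stands for the limit at the base point, so that uniform approximation
    on [optD] controls the functions and their limits at the same time. *)
Definition climK (f : option T -> C) : Prop :=
  (exists M, forall o, optD o -> (Cmod (f o) <= M)%R) /\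
  clim F (fun t => f (Some t)) (f None).

Lemma climK_calg : calg optD climK.
Proof.
  split.
  - intros c. split; [exists (Cmod c); intros; lra | apply (clim_const F)].
  - intros f g [[M HM] Hf] [[M' HM'] Hg]. split; [| apply (clim_plus F); assumption].
    exists (M + M')%R. intros o Ho. eapply Rle_trans; [apply Cmod_triangle |].
    generalize (HM o Ho) (HM' o Ho). lra.
  - intros f g [[M HM] Hf] [[M' HM'] Hg]. split; [| apply (clim_mult F); assumption].
    exists (M * M')%R. intros o Ho. apply Cmod_mult_le; auto.
  - intros f [H _]. exact H.
  - intros f H. split.
    + destruct (H 1%R Rlt_0_1) as [g [[[M HM] _] Hg]]. exists (M + 1)%R. intros o Ho.
      generalize (Cmod_le_plus (f o) (g o)) (HM o Ho) (Hg o Ho). lra.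
    + intros eps Heps. assert (He : (0 < eps / 4)%R) by lra.
      destruct (H _ He) as [g [[_ Hl] Hg]].
      generalize (filter_and _ _ HD (Hl _ He)). apply filter_imp. intros t [Ht Hlt].
      eapply Rle_lt_trans; [apply (Cmod_tri3 _ (g (Some t))) |].
      assert (H1 := Cmod_tri3 (g (Some t)) (g None) (f None)).
      rewrite (Cmod_minus_sym (g None)) in H1.
      generalize (Hg (Some t) Ht) (Hg None I). lra.
Qed.

Definition optf (f : T -> C) (l : C) (o : option T) : C :=
  match o with None => l | Some t => f t end.

Lemma climK_optf (f : T -> C) (l : C) (M : R) :
  clim F f l -> (Cmod l <= M)%R -> (forall t, D t -> (Cmod (f t) <= M)%R) -> climK (optf f l).
Proof.
  intros Hf Hl HM. split; [| exact Hf].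
  exists M. intros [t|] Ho; simpl; [apply HM, Ho | exact Hl].
Qed.

End ClimAlgebra.

(** * Cauchy estimates for polynomials *)

Definition cis (th : R) : C := (cos th, sin th).

Lemma Cmod_cis (th : R) : Cmod (cis th) = 1%R.
Proof.
  unfold Cmod, cis. simpl fst. simpl snd. rewrite <- sqrt_1. f_equal.
  generalize (sin2_cos2 th). unfold Rsqr. intros H. simpl. lra.
Qed.

Lemma cis_pow (th : R) (n : nat) : cis th ^ n = cis (INR n * th).
Proof.
  induction n as [|n IH].
  - simpl. unfold cis. rewrite Rmult_0_l, cos_0, sin_0. reflexivity.
  - rewrite Cpow_S, IH, S_INR. unfold cis.
    replace ((INR n + 1) * th)%R with (th + INR n * th)%R by ring.
    rewrite cos_plus, sin_plus. unfold Cmult. simpl. f_equal; ring.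
Qed.

Lemma cis_neq1 (th : R) : (0 < th < 2 * PI)%R -> cis th <> 1.
Proof.
  intros [H0 H1] E. injection E as Ec _.
  replace th with (2 * (th / 2))%R in Ec by field.
  rewrite cos_2a_sin in Ec.
  assert (Hs : (0 < sin (th / 2))%R) by (apply sin_gt_0; lra).
  assert (0 < sin (th / 2) * sin (th / 2))%R by (apply Rmult_lt_0_compat; exact Hs).
  lra.
Qed.

Definition omega (n : nat) : C := cis (2 * PI / INR n).

Lemma omega_pow_n (n : nat) : (0 < n)%nat -> omega n ^ n = 1.
Proof.
  intros Hn. unfold omega. rewrite cis_pow.
  replace (INR n * (2 * PI / INR n))%R with (2 * PI)%R.
  - unfold cis. rewrite cos_2PI, sin_2PI. reflexivity.
  - field. apply not_0_INR. lia.
Qed.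

Lemma omega_pow_neq1 (n m : nat) : (0 < m < n)%nat -> omega n ^ m <> 1.
Proof.
  intros Hm. unfold omega. rewrite cis_pow. apply cis_neq1.
  assert (Hp := PI_RGT_0).
  assert (H0 : (0 < INR m)%R) by (apply lt_0_INR; lia).
  assert (H1 : (INR m < INR n)%R) by (apply lt_INR; lia).
  split.
  - apply Rmult_lt_0_compat; [exact H0 |]. apply Rdiv_lt_0_compat; lra.
  - apply (Rmult_lt_reg_r (INR n)); [lra |].
    replace (INR m * (2 * PI / INR n) * INR n)%R with (INR m * (2 * PI))%R by (field; lra).
    rewrite (Rmult_comm (2 * PI)). apply Rmult_lt_compat_r; lra.
Qed.

Lemma psum_const1 (n : nat) : psum (fun _ => RtoC 1) n = RtoC (INR n).
Proof.
  induction n as [|n IH]; [reflexivity |].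
  change (psum (fun _ => RtoC 1) n + RtoC 1 = RtoC (INR (S n))).
  rewrite IH, S_INR, RtoC_plus. reflexivity.
Qed.

(** The exponent [l + (n - k)] replaces [l - k], which may be negative; both give the same
    power of an [n]-th root of unity. *)
Lemma omega_orth (n k l : nat) : (k < n)%nat -> (l < n)%nat ->
  psum (fun j => (omega n ^ j) ^ (l + (n - k))) n = if Nat.eqb l k then RtoC (INR n) else 0.
Proof.
  intros Hk Hl.
  assert (Hw : forall j, (omega n ^ j) ^ (l + (n - k)) = (omega n ^ (l + (n - k))) ^ j).
  { intros j. rewrite <- !Cpow_mult_r. f_equal. lia. }
  rewrite (psum_ext _ (fun j => (omega n ^ (l + (n - k))) ^ j)) by (intros; apply Hw).
  set (w := omega n ^ (l + (n - k))).
  assert (Hwn : w ^ n = 1).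
  { unfold w. rewrite <- Cpow_mult_r, Nat.mul_comm, Cpow_mult_r, omega_pow_n by lia.
    apply Cpow_1_l. }
  destruct (Nat.eqb_spec l k) as [-> | Hlk].
  - assert (Hw1 : w = 1) by (unfold w; replace (k + (n - k))%nat with n by lia;
      apply omega_pow_n; lia).
    rewrite (psum_ext _ (fun _ => RtoC 1)); [apply psum_const1 |].
    intros j _. rewrite Hw1. apply Cpow_1_l.
  - assert (Hw1 : w <> 1).
    { unfold w. destruct (Nat.lt_ge_cases k l) as [Hlt | Hge].
      - replace (l + (n - k))%nat with (n + (l - k))%nat by lia.
        rewrite Cpow_add_r, omega_pow_n, Cmult_1_l by lia. apply omega_pow_neq1. lia.
      - apply omega_pow_neq1. lia. }
    assert (G := psum_geom w n). rewrite Hwn in G.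
    assert (H1 : 1 - w <> 0) by (intros E; apply Hw1; symmetry; apply Cminus_eq_0, E).
    replace (psum (fun k0 => w ^ k0) n) with (/ (1 - w) * ((1 - w) * psum (fun k0 => w ^ k0) n))
      by (field; exact H1).
    rewrite G. ring.
Qed.

Lemma psum_swap (f : nat -> nat -> C) (m n : nat) :
  psum (fun j => psum (fun l => f j l) n) m = psum (fun l => psum (fun j => f j l) m) n.
Proof.
  induction m as [|m IH]; simpl.
  - symmetry. apply psum_zero. reflexivity.
  - rewrite IH, <- psum_plus. apply psum_ext. reflexivity.
Qed.

Lemma psum_single (f : nat -> C) (n k : nat) :
  (k < n)%nat -> (forall l, (l < n)%nat -> l <> k -> f l = 0) -> psum f n = f k.
Proof.
  induction n as [|n IH]; intros Hk H; [lia |]. simpl.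
  destruct (Nat.eq_dec k n) as [-> | Hne].
  - rewrite psum_zero; [ring |]. intros l Hl. apply H; lia.
  - rewrite IH, (H n); [ring | lia | lia | lia | intros; apply H; lia].
Qed.

(** The coefficient is recovered by averaging over the [n]-th roots of unity. *)
Lemma cauchy_estimate (c : nat -> C) (n : nat) (rho B : R) :
  (0 < rho)%R ->
  (forall X, Cmod X = rho -> Cmod (psum (fun k => c k * X ^ k)%C n) <= B)%R ->
  forall k, (k < n)%nat -> (Cmod (c k) * rho ^ k <= B)%R.
Proof.
  intros Hr HB k Hk.
  assert (HnR : (0 < INR n)%R) by (apply lt_0_INR; lia).
  set (X := fun j => RtoC rho * omega n ^ j).
  assert (E : psum (fun j => (omega n ^ j) ^ (n - k) * psum (fun l => c l * X j ^ l) n) n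
              = RtoC (INR n) * (c k * RtoC rho ^ k)).
  { rewrite (psum_ext _ (fun j => psum (fun l => c l * RtoC rho ^ l
                           * (omega n ^ j) ^ (l + (n - k))) n)).
    2:{ intros j _. rewrite <- psum_scal. apply psum_ext. intros l _. unfold X.
        rewrite Cpow_mult_l, Cpow_add_r. ring. }
    rewrite psum_swap.
    rewrite (psum_ext _ (fun l => c l * RtoC rho ^ l *
               (if Nat.eqb l k then RtoC (INR n) else 0))).
    2:{ intros l Hl. rewrite psum_scal, omega_orth by assumption. reflexivity. }
    rewrite (psum_single _ n k Hk).
    - rewrite Nat.eqb_refl. ring.
    - intros l _ Hne. apply Nat.eqb_neq in Hne. rewrite Hne. ring. }
  assert (HE : (Cmod (RtoC (INR n) * (c k * RtoC rho ^ k)) <= INR n * B)%R).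
  { rewrite <- E. apply psum_Cmod. intros j _.
    rewrite Cmod_mult, !Cmod_pow. unfold omega at 1. rewrite Cmod_cis, !pow1, Rmult_1_l.
    apply HB. unfold X. rewrite Cmod_mult, Cmod_R, Cmod_pow. unfold omega.
    rewrite Cmod_cis, pow1, Rabs_pos_eq; lra. }
  rewrite !Cmod_mult, Cmod_pow, !Cmod_R, !Rabs_pos_eq in HE by lra.
  apply (Rmult_le_reg_l (INR n)); assumption.
Qed.

(** * Laurent polynomials with coefficients in an algebra *)

Section Laurent.
Context {P : Type} {DP : P -> Prop} {Kc : (P -> C) -> Prop} (HKc : calg DP Kc).

(** Laurent polynomials in [snd t] whose coefficients are functions of the parameter [fst t]. *)
Inductive LP : (P * C -> C) -> Prop :=
| LP_coef (c : P -> C) : Kc c -> LP (fun t => c (fst t))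
| LP_X : LP (fun t => snd t)
| LP_inv : LP (fun t => / snd t)
| LP_plus f g : LP f -> LP g -> LP (fun t => f t + g t)
| LP_mult f g : LP f -> LP g -> LP (fun t => f t * g t).

Lemma LP_const (c : C) : LP (fun _ => c).
Proof. apply (LP_coef (fun _ => c)), (calg_const HKc). Qed.

Lemma LP_minus f g : LP f -> LP g -> LP (fun t => f t - g t).
Proof.
  intros Hf Hg.
  assert (E : (fun t => f t - g t) = (fun t => f t + (-1) * g t))
    by (apply functional_extensionality; intros; ring).
  rewrite E. apply LP_plus; [exact Hf | apply LP_mult; [apply LP_const | exact Hg]].
Qed.

(** Polynomials in Horner form, for which closure under products is a plain induction. *)
Inductive isP : (P -> C -> C) -> Prop :=
| isP_0 (f : P -> C -> C) : (forall p X, f p X = 0) -> isP f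
| isP_S (c : P -> C) (f g : P -> C -> C) : Kc c -> isP f -> (forall p X, g p X = c p + X * f p X) -> isP g.

Lemma isP_ext (f g : P -> C -> C) : (forall p X, f p X = g p X) -> isP f -> isP g.
Proof.
  intros E Hf. destruct Hf as [f Hf | c f h Hc Hf Hh].
  - apply isP_0. intros. rewrite <- E. apply Hf.
  - apply (isP_S c f); auto. intros. rewrite <- E. apply Hh.
Qed.

Lemma isP_plus (f g : P -> C -> C) : isP f -> isP g -> isP (fun p X => f p X + g p X).
Proof.
  intros Hf. revert g. induction Hf as [f Hf | c f h Hc Hf IH Hh]; intros g Hg.
  - apply (isP_ext g); [| exact Hg]. intros. rewrite Hf. ring.
  - destruct Hg as [g Hg | d g k Hd Hg Hk].
    + apply (isP_S c f); auto. intros. rewrite Hh, Hg. ring.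
    + apply (isP_S (fun p => c p + d p) (fun p X => f p X + g p X)).
      * apply (calg_plus HKc); assumption.
      * apply IH, Hg.
      * intros. rewrite Hh, Hk. ring.
Qed.

Lemma isP_coef (c : P -> C) : Kc c -> isP (fun p _ => c p).
Proof.
  intros Hc. apply (isP_S c (fun _ _ => 0)); [exact Hc | apply isP_0; reflexivity |].
  intros. ring.
Qed.

Lemma isP_mulX (f : P -> C -> C) : isP f -> isP (fun p X => X * f p X).
Proof.
  intros Hf. apply (isP_S (fun _ => 0) f); [apply (calg_const HKc) | exact Hf |].
  intros. ring.
Qed.

Lemma isP_scal (c : P -> C) (f : P -> C -> C) : Kc c -> isP f -> isP (fun p X => c p * f p X).
Proof.
  intros Hc Hf. induction Hf as [f Hf | d f h Hd Hf IH Hh].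
  - apply isP_0. intros. rewrite Hf. ring.
  - apply (isP_S (fun p => c p * d p) (fun p X => c p * f p X)); [| exact IH |].
    + apply (calg_mult HKc); assumption.
    + intros. rewrite Hh. ring.
Qed.

Lemma isP_mult (f g : P -> C -> C) : isP f -> isP g -> isP (fun p X => f p X * g p X).
Proof.
  intros Hf Hg. induction Hf as [f Hf | c f h Hc Hf IH Hh].
  - apply isP_0. intros. rewrite Hf. ring.
  - apply (isP_ext (fun p X => c p * g p X + X * (f p X * g p X))).
    + intros. rewrite Hh. ring.
    + apply isP_plus; [apply isP_scal; assumption | apply (isP_mulX _ IH)].
Qed.

Lemma isP_mulXn (f : P -> C -> C) (n : nat) : isP f -> isP (fun p X => X ^ n * f p X).
Proof.
  intros Hf. induction n as [|n IH].
  - apply (isP_ext f); [| exact Hf]. intros. simpl. ring.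
  - apply (isP_ext (fun p X => X * (X ^ n * f p X))); [| apply (isP_mulX _ IH)].
    intros. rewrite Cpow_S. ring.
Qed.

Lemma isP_psum (f : P -> C -> C) : isP f -> exists n (c : nat -> P -> C),
  forall p X, f p X = psum (fun k => c k p * X ^ k) n.
Proof.
  intros Hf. induction Hf as [f Hf | d f h Hd Hf [n [c Hc]] Hh].
  - exists O, (fun _ _ => 0). intros. rewrite Hf. reflexivity.
  - exists (S n), (fun k => match k with O => d | S k => c k end).
    intros. rewrite Hh, Hc, psum_head. simpl Cpow.
    rewrite <- psum_scal.
    rewrite (psum_ext (fun k => X * (c k p * X ^ k)) (fun k => c k p * (X * X ^ k)))
      by (intros; ring).
    ring.
Qed.

(** The strict bound [M < n] makes the coefficient [c M] of [X^0] a term of the sum. *)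
Lemma LP_normal (f : P * C -> C) : LP f -> exists M n (c : nat -> P -> C),
  (M < n)%nat /\
  forall (p : P) (X : C), X <> 0 -> f (p, X) * X ^ M = psum (fun k => c k p * X ^ k) n.
Proof.
  intros Hf.
  assert (H : exists M g, isP g /\ forall (p : P) (X : C), X <> 0 -> f (p, X) * X ^ M = g p X).
  { induction Hf as [c Hc | | | f g Hf [M [f' [Pf Ef]]] Hg [N [g' [Pg Eg]]]
                     | f g Hf [M [f' [Pf Ef]]] Hg [N [g' [Pg Eg]]]].
    - exists O, (fun p _ => c p). split; [apply isP_coef, Hc |]. intros. simpl. ring.
    - exists O, (fun p X => X * 1). split; [apply (isP_mulX (fun _ _ => 1)), (isP_coef (fun _ => 1)),
        (calg_const HKc) |]. intros. simpl. ring.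
    - exists 1%nat, (fun p X => 1). split; [apply (isP_coef (fun _ => 1)), (calg_const HKc) |].
      intros p X HX. simpl. field. exact HX.
    - exists (M + N)%nat, (fun p X => X ^ N * f' p X + X ^ M * g' p X). split.
      + apply isP_plus; apply isP_mulXn; assumption.
      + intros p X HX. rewrite <- (Ef p X HX), <- (Eg p X HX), Cpow_add_r. ring.
    - exists (M + N)%nat, (fun p X => f' p X * g' p X). split.
      + apply isP_mult; assumption.
      + intros p X HX. rewrite <- (Ef p X HX), <- (Eg p X HX), Cpow_add_r. ring. }
  destruct H as [M [g [Pg Eg]]]. destruct (isP_psum g Pg) as [n [c Hc]].
  exists M, (n + S M)%nat, (fun k p => if Nat.ltb k n then c k p else 0).
  split; [lia |]. intros p X HX. rewrite (Eg p X HX), Hc, psum_split.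
  rewrite (psum_zero (fun k => (if Nat.ltb (n + k) n then _ else _) * _)).
  - rewrite Cplus_0_r. apply psum_ext. intros k Hk. apply Nat.ltb_lt in Hk. rewrite Hk. ring.
  - intros k _. replace (Nat.ltb (n + k) n) with false; [ring |].
    symmetry. apply Nat.ltb_ge. lia.
Qed.

Lemma LP_bounded (D : C -> Prop) (r1 r2 : R) (f : P * C -> C) :
  (0 < r1)%R -> (forall X, D X -> r1 <= Cmod X <= r2)%R -> LP f ->
  exists M, forall t, DP (fst t) -> D (snd t) -> (Cmod (f t) <= M)%R.
Proof.
  intros Hr HD Hf.
  induction Hf as [c Hc | | | f g Hf [M HM] Hg [N HN] | f g Hf [M HM] Hg [N HN]].
  - destruct (calg_bounded HKc c Hc) as [M HM]. exists M. auto.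
  - exists r2. intros t _ Ht. apply HD, Ht.
  - exists (/ r1)%R. intros t _ Ht. destruct (HD _ Ht) as [H1 _].
    rewrite Cmod_inv by (apply Cmod_gt_0; lra).
    apply Rinv_le_contravar; lra.
  - exists (M + N)%R. intros t H1 H2. eapply Rle_trans; [apply Cmod_triangle |].
    generalize (HM t H1 H2) (HN t H1 H2). lra.
  - exists (M * N)%R. intros t H1 H2. apply Cmod_mult_le; auto.
Qed.

(** The closure of [LP] under uniform convergence for parameters in [DP] and [X] in [D]. On an
    annulus it plays the role of the functions that are holomorphic in [X]. *)
Definition clLP (D : C -> Prop) (f : P * C -> C) : Prop :=
  forall eps, (0 < eps)%R -> exists g, LP g /\
    forall t, DP (fst t) /\ D (snd t) -> (Cmod (f t - g t) <= eps)%R.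

Lemma LP_clLP D f : LP f -> clLP D f.
Proof.
  intros Hf eps Heps. exists f. split; [exact Hf |]. intros t _.
  replace (f t - f t) with (RtoC 0) by ring. rewrite Cmod_0. lra.
Qed.

Lemma clLP_calg (D : C -> Prop) (r1 r2 : R) :
  (0 < r1)%R -> (forall X, D X -> r1 <= Cmod X <= r2)%R ->
  calg (fun t => DP (fst t) /\ D (snd t)) (clLP D).
Proof.
  intros Hr HD.
  assert (Hbd : forall f, clLP D f ->
    exists M, (0 < M)%R /\ forall t, DP (fst t) /\ D (snd t) -> (Cmod (f t) <= M)%R).
  { intros f Hf. destruct (Hf 1%R Rlt_0_1) as [g [Hg H]].
    destruct (LP_bounded D r1 r2 g Hr HD Hg) as [M HM].
    exists (Rmax 1 (M + 1)). split; [generalize (Rmax_l 1 (M + 1)); lra |].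
    intros t Ht. generalize (Rmax_r 1 (M + 1)) (HM t (proj1 Ht) (proj2 Ht)) (H t Ht)
      (Cmod_le_plus (f t) (g t)). lra. }
  split.
  - intros c. apply LP_clLP, LP_const.
  - intros f g Hf Hg eps Heps. assert (He : (0 < eps / 2)%R) by lra.
    destruct (Hf _ He) as [f' [Lf Ef]]. destruct (Hg _ He) as [g' [Lg Eg]].
    exists (fun t => f' t + g' t). split; [apply LP_plus; assumption |].
    intros t Ht. replace (f t + g t - (f' t + g' t)) with ((f t - f' t) + (g t - g' t)) by ring.
    eapply Rle_trans; [apply Cmod_triangle |]. generalize (Ef t Ht) (Eg t Ht). lra.
  - intros f g Hf Hg eps Heps.
    destruct (Hbd f Hf) as [A [HA BA]]. destruct (Hbd g Hg) as [B [HB BB]].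
    set (e := Rmin 1 (eps / (A + B + 1))).
    assert (He0 : (0 < e)%R) by (apply Rmin_pos; [lra | apply Rdiv_lt_0_compat; lra]).
    assert (He1 : (e <= 1)%R) by apply Rmin_l.
    assert (He2 : (e * (A + B + 1) <= eps)%R).
    { apply Rle_trans with (eps / (A + B + 1) * (A + B + 1))%R.
      - apply Rmult_le_compat_r; [lra | apply Rmin_r].
      - apply Req_le. field. lra. }
    destruct (Hf _ He0) as [f' [Lf Ef]]. destruct (Hg _ He0) as [g' [Lg Eg]].
    exists (fun t => f' t * g' t). split; [apply LP_mult; assumption |].
    intros t Ht.
    replace (f t * g t - f' t * g' t)
      with (f t * (g t - g' t) + ((f t - f' t) * g t - (f t - f' t) * (g t - g' t))) by ring.
    eapply Rle_trans; [apply Cmod_triangle |].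
    eapply Rle_trans; [apply Rplus_le_compat_l, Cmod_triangle |].
    rewrite Cmod_opp.
    assert (H1 := Cmod_mult_le _ _ _ _ (BA t Ht) (Eg t Ht)).
    assert (H2 := Cmod_mult_le _ _ _ _ (Ef t Ht) (BB t Ht)).
    assert (H3 := Cmod_mult_le _ _ _ _ (Ef t Ht) (Eg t Ht)).
    assert (H4 : (e * e <= e * 1)%R) by (apply Rmult_le_compat_l; lra). lra.
  - intros f Hf. destruct (Hbd f Hf) as [M [_ HM]]. exists M. exact HM.
  - intros f H eps Heps. assert (He : (0 < eps / 2)%R) by lra.
    destruct (H _ He) as [g [Hg Eg]]. destruct (Hg _ He) as [h [Lh cas_shape]].
    exists h. split; [exact Lh |]. intros t Ht.
    generalize (Cmod_tri3 (f t) (g t) (h t)) (Eg t Ht) (cas_shape t Ht). lra.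
Qed.

End Laurent.

Lemma Cmod_small_eq0 (x : C) (A : R) :
  (forall eps, (0 < eps)%R -> (Cmod x <= A * eps)%R) -> x = 0.
Proof.
  intros H. apply Cmod_eq_0. apply Rle_antisym; [| apply Cmod_ge_0].
  apply le_epsilon. intros eps Heps.
  assert (HA : (0 <= A)%R).
  { generalize (H 1%R Rlt_0_1) (Cmod_ge_0 x). lra. }
  assert (He : (0 < eps / (A + 1))%R) by (apply Rdiv_lt_0_compat; lra).
  generalize (H _ He). intros H1.
  assert ((A + 1) * (eps / (A + 1)) = eps)%R by (field; lra). lra.
Qed.

Lemma psum_geom_up (f : nat -> C) (A r : R) (n : nat) :
  (0 < r < 1)%R -> (0 <= A)%R ->
  (forall k, (k < n)%nat -> (Cmod (f k) <= A * r ^ k)%R) ->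
  (Cmod (psum f n) <= A / (1 - r))%R.
Proof.
  intros Hr HA H. apply Rle_trans with (A * (1 - r ^ n) / (1 - r))%R.
  - induction n as [|n IH].
    + simpl. rewrite Cmod_0. apply Req_le. field. lra.
    + simpl psum. eapply Rle_trans; [apply Cmod_triangle |].
      generalize (IH (fun k Hk => H k (Nat.lt_lt_succ_r _ _ Hk))) (H n (Nat.lt_succ_diag_r n)).
      intros H1 H2.
      replace (A * (1 - r ^ S n) / (1 - r))%R with (A * (1 - r ^ n) / (1 - r) + A * r ^ n)%R
        by (simpl; field; lra). lra.
  - unfold Rdiv. apply Rmult_le_compat_r; [left; apply Rinv_0_lt_compat; lra |].
    assert (0 <= A * r ^ n)%R by (apply Rmult_le_pos; [exact HA | apply pow_le; lra]). lra.
Qed.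

Lemma psum_geom_down (f : nat -> C) (A r : R) (n : nat) :
  (0 < r < 1)%R -> (0 <= A)%R ->
  (forall k, (k < n)%nat -> (Cmod (f k) <= A * r ^ (n - k))%R) ->
  (Cmod (psum f n) <= A / (1 - r))%R.
Proof.
  intros Hr HA H.
  assert (Hle : (Cmod (psum f n) <= A * (1 - r ^ S n) / (1 - r) - A)%R).
  { revert f H. induction n as [|n IH]; intros f H.
    + simpl. rewrite Cmod_0. apply Req_le. field. lra.
    + rewrite psum_head. eapply Rle_trans; [apply Cmod_triangle |].
      generalize (IH (fun k => f (S k)) (fun k Hk => H (S k) (proj1 (Nat.succ_lt_mono _ _) Hk)))
        (H O (Nat.lt_0_succ n)).
      rewrite Nat.sub_0_r. intros H1 H2.
      replace (A * (1 - r ^ S (S n)) / (1 - r))%R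
        with (A * (1 - r ^ S n) / (1 - r) + A * r ^ S n)%R
        by (simpl; field; lra). lra. }
  eapply Rle_trans; [exact Hle |].
  apply Rle_trans with (A * (1 - r ^ S n) / (1 - r))%R; [lra |].
  unfold Rdiv. apply Rmult_le_compat_r; [left; apply Rinv_0_lt_compat; lra |].
  assert (0 <= A * r ^ S n)%R by (apply Rmult_le_pos; [exact HA | apply pow_le; lra]). lra.
Qed.

(** The shape of the bound that Cauchy estimates on two circles give for the terms of a
    Laurent polynomial [X^(-M) sum c_k X^k] between the circles. *)
Lemma psum_geom_two_sided (f : nat -> C) (A r : R) (M n : nat) :
  (0 < r < 1)%R -> (0 <= A)%R -> (M <= n)%nat ->
  (forall k, (k < M)%nat -> (Cmod (f k) <= A * r ^ (M - k))%R) ->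
  (forall k, (M + k < n)%nat -> (Cmod (f (M + k)%nat) <= A * r ^ k)%R) ->
  (Cmod (psum f n) <= 2 * A / (1 - r))%R.
Proof.
  intros Hr HA HMn H1 H2. replace n with (M + (n - M))%nat by lia. rewrite psum_split.
  eapply Rle_trans; [apply Cmod_triangle |].
  replace (2 * A / (1 - r))%R with (A / (1 - r) + A / (1 - r))%R by (field; lra).
  apply Rplus_le_compat.
  - apply psum_geom_down; assumption.
  - apply psum_geom_up; try assumption. intros k Hk. apply H2. lia.
Qed.

(** * Division of Laurent polynomials *)

Section Division.
Context {P : Type} {DP : P -> Prop} {Kc : (P -> C) -> Prop} (HKc : calg DP Kc).

(** Division by [X - phi X], by induction on the construction of [f]: products obey the
    Leibniz rule, and [1/X - 1/phi X = - (X - phi X) / (X phi X)]. It is used with [phi X] equal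
    to [q/X], and to a constant. The functions [g1] and [g2] exhibit [phi] and [1/phi] as
    Laurent polynomials. *)
Lemma LP_subst_div (phi : C -> C) (g1 g2 : P * C -> C) :
  LP (Kc := Kc) g1 -> LP (Kc := Kc) g2 ->
  (forall X : C, X <> 0 -> phi X <> 0) ->
  (forall (p : P) (X : C), X <> 0 -> g1 (p, X) = phi X) ->
  (forall (p : P) (X : C), X <> 0 -> g2 (p, X) = / phi X) ->
  forall f, LP (Kc := Kc) f -> exists f' Q, LP (Kc := Kc) f' /\ LP (Kc := Kc) Q /\
    forall (p : P) (X : C), X <> 0 ->
      f' (p, X) = f (p, phi X) /\ f (p, X) - f (p, phi X) = (X - phi X) * Q (p, X).
Proof.
  intros L1 L2 Hphi E1 E2 f Hf.
  induction Hf as [c Hc | | | f g Hf [f' [Qf [Lf [LQf Ef]]]] Hg [g' [Qg [Lg [LQg Eg]]]]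
                   | f g Hf [f' [Qf [Lf [LQf Ef]]]] Hg [g' [Qg [Lg [LQg Eg]]]]].
  - exists (fun t => c (fst t)), (fun _ => 0).
    split; [apply LP_coef, Hc |]. split; [apply (LP_const HKc) |].
    intros. simpl. split; ring.
  - exists g1, (fun _ => 1). split; [exact L1 |]. split; [apply (LP_const HKc) |].
    intros p X HX. simpl. split; [apply E1, HX | ring].
  - exists g2, (fun t => (-1) * (/ snd t * g2 t)). split; [exact L2 |]. split.
    { apply LP_mult; [apply (LP_const HKc) |]. apply LP_mult; [apply LP_inv | exact L2]. }
    intros p X HX. simpl. split; [apply E2, HX |]. rewrite (E2 p X HX).
    specialize (Hphi X HX). field. auto.
  - exists (fun t => f' t + g' t), (fun t => Qf t + Qg t).
    split; [apply LP_plus; assumption |]. split; [apply LP_plus; assumption |].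
    intros p X HX. destruct (Ef p X HX) as [A1 B1]. destruct (Eg p X HX) as [A2 B2].
    split; [rewrite A1, A2; reflexivity |].
    replace (f (p, X) + g (p, X) - (f (p, phi X) + g (p, phi X)))
      with ((f (p, X) - f (p, phi X)) + (g (p, X) - g (p, phi X))) by ring.
    rewrite B1, B2. ring.
  - exists (fun t => f' t * g' t), (fun t => Qf t * g t + f' t * Qg t).
    split; [apply LP_mult; assumption |].
    split; [apply LP_plus; apply LP_mult; assumption |].
    intros p X HX. destruct (Ef p X HX) as [A1 B1]. destruct (Eg p X HX) as [A2 B2].
    split; [rewrite A1, A2; reflexivity |].
    replace (f (p, X) * g (p, X) - f (p, phi X) * g (p, phi X))
      with ((f (p, X) - f (p, phi X)) * g (p, X) + f (p, phi X) * (g (p, X) - g (p, phi X)))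
      by ring.
    rewrite B1, B2, A1. ring.
Qed.

(** Cauchy estimates on the circles of radius [r1] and [r2] make the terms of [g] decay like
    powers of [s] away from the constant term. *)
Lemma LP_interior_bound (r1 r2 s B : R) (g : P * C -> C) (p : P) :
  (0 < r1)%R -> (0 < r2)%R -> (0 < s < 1)%R -> LP (Kc := Kc) g ->
  (forall X, Cmod X = r1 \/ Cmod X = r2 -> (Cmod (g (p, X)) <= B)%R) ->
  forall X, (r1 <= s * Cmod X)%R -> (Cmod X <= s * r2)%R ->
    (Cmod (g (p, X)) <= 2 * B / (1 - s))%R.
Proof.
  intros Hr1 Hr2 Hs Hg HB X HX1 HX2.
  assert (HX : X <> 0).
  { intros E. rewrite E, Cmod_0 in HX1. lra. }
  assert (HXp := proj1 (Cmod_gt_0 X) HX).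
  destruct (LP_normal HKc g Hg) as [M [n [c [HMn Hc]]]].
  assert (Hest : forall rho, (0 < rho)%R ->
    (forall Y, Cmod Y = rho -> (Cmod (g (p, Y)) <= B)%R) ->
    forall k, (k < n)%nat -> (Cmod (c k p) * rho ^ k <= rho ^ M * B)%R).
  { intros rho Hrho Hb. apply (cauchy_estimate (fun k => c k p) n rho); [exact Hrho |].
    intros Y HY.
    assert (HY0 : Y <> 0) by (apply Cmod_gt_0; lra).
    rewrite <- (Hc p Y HY0), Cmod_mult, Cmod_pow, HY, Rmult_comm.
    apply Rmult_le_compat_l; [apply pow_le; lra | apply Hb, HY]. }
  assert (E1 := Hest r1 Hr1 (fun Y HY => HB Y (or_introl HY))).
  assert (E2 := Hest r2 Hr2 (fun Y HY => HB Y (or_intror HY))).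
  assert (HB0 : (0 <= B)%R).
  { eapply Rle_trans; [apply Cmod_ge_0 | apply (HB (RtoC r1))].
    left. rewrite Cmod_R, Rabs_pos_eq; lra. }
  apply (Rmult_le_reg_r (Cmod X ^ M)); [apply pow_lt, HXp |].
  rewrite <- Cmod_pow, <- Cmod_mult, (Hc p X HX), Cmod_pow.
  replace (2 * B / (1 - s) * Cmod X ^ M)%R with (2 * (B * Cmod X ^ M) / (1 - s))%R
    by (field; lra).
  apply (psum_geom_two_sided _ _ s M n); [exact Hs | | lia | |].
  - apply Rmult_le_pos; [exact HB0 | apply pow_le; lra].
  - intros k Hk. rewrite Cmod_mult, Cmod_pow.
    specialize (E1 k ltac:(lia)).
    assert (Hc1 : (Cmod (c k p) <= r1 ^ (M - k) * B)%R).
    { apply (Rmult_le_reg_r (r1 ^ k)); [apply pow_lt, Hr1 |].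
      eapply Rle_trans; [exact E1 |]. replace M with (M - k + k)%nat at 1 by lia.
      rewrite pow_add. apply Req_le. ring. }
    apply Rle_trans with ((s * Cmod X) ^ (M - k) * B * Cmod X ^ k)%R.
    + apply Rmult_le_compat_r; [apply pow_le; lra |].
      eapply Rle_trans; [exact Hc1 |]. apply Rmult_le_compat_r; [exact HB0 |].
      apply pow_incr. lra.
    + apply Req_le. rewrite Rpow_mult_distr.
      replace (Cmod X ^ M)%R with (Cmod X ^ (M - k) * Cmod X ^ k)%R
        by (rewrite <- pow_add; f_equal; lia). ring.
  - intros k Hk. rewrite Cmod_mult, Cmod_pow.
    specialize (E2 (M + k)%nat Hk).
    assert (Hc2 : (Cmod (c (M + k)%nat p) * r2 ^ k <= B)%R).
    { apply (Rmult_le_reg_l (r2 ^ M)); [apply pow_lt, Hr2 |].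
      eapply Rle_trans; [| exact E2]. rewrite pow_add. apply Req_le. ring. }
    rewrite pow_add.
    apply Rle_trans with (Cmod (c (M + k)%nat p) * r2 ^ k * s ^ k * Cmod X ^ M)%R.
    + replace (Cmod (c (M + k)%nat p) * r2 ^ k * s ^ k * Cmod X ^ M)%R
        with (Cmod (c (M + k)%nat p) * (Cmod X ^ M * (s * r2) ^ k))%R
        by (rewrite Rpow_mult_distr; ring).
      apply Rmult_le_compat_l; [apply Cmod_ge_0 |].
      apply Rmult_le_compat_l; [apply pow_le; lra |]. apply pow_incr. lra.
    + replace (B * Cmod X ^ M * s ^ k)%R with (B * s ^ k * Cmod X ^ M)%R by ring.
      apply Rmult_le_compat_r; [apply pow_le; lra |].
      apply Rmult_le_compat_r; [apply pow_le; lra | exact Hc2].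
Qed.

End Division.

(** * Removable singularities *)

Section Removable.
Context {T : Type} (F : (T -> Prop) -> Prop) {HF : ProperFilter F} (D : T -> Prop) (HD : F D).

Lemma LP_clim (g : option T * C -> C) (e : T -> C) (e0 : C) :
  LP (Kc := climK F D) g -> clim F e e0 -> e0 <> 0 ->
  clim F (fun t => g (Some t, e t)) (g (None, e0)).
Proof.
  intros Hg He He0. induction Hg as [c [_ Hc] | | | f g Hf IHf Hg IHg | f g Hf IHf Hg IHg]; simpl.
  - exact Hc.
  - exact He.
  - apply (clim_inv F); assumption.
  - apply (clim_plus F); assumption.
  - apply (clim_mult F); assumption.
Qed.

(** If [f] vanishes at [X = e0] for all parameters, the quotients [Q] of its approximants by
    [X - e0] form a Cauchy sequence: on two circles around the origin their differences are
    controlled by those of the approximants, hence also in between, near [e0]. *)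
Lemma removable_limit (r1 r2 : R) (f : option T * C -> C) (e : T -> C) (e0 : C) :
  (0 < r1)%R -> (r1 < Cmod e0 < r2)%R ->
  clLP (DP := optD D) (Kc := climK F D) (fun X => r1 <= Cmod X <= r2)%R f ->
  (forall o, optD D o -> f (o, e0) = 0) ->
  clim F e e0 -> F (fun t => e t <> e0) ->
  exists l, clim F (fun t => f (Some t, e t) / (e t - e0)) l.
Proof.
  intros Hr1 [He1 He2] Hf Hz He Hne.
  assert (HKc := climK_calg F D HD).
  assert (He0 : e0 <> 0) by (apply Cmod_gt_0; lra).
  set (m := Rmin (Cmod e0 - r1) (r2 - Cmod e0)).
  assert (Hm : (0 < m)%R) by (apply Rmin_pos; lra).
  assert (Hm1 : (m <= Cmod e0 - r1)%R) by apply Rmin_l.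
  assert (Hm2 : (m <= r2 - Cmod e0)%R) by apply Rmin_r.
  (* s is chosen so that a neighbourhood of e0 lies in r1/s <= |X| <= s r2 *)
  set (s := Rmax (r1 / (Cmod e0 - m / 2)) ((Cmod e0 + m / 2) / r2)).
  assert (Hs : (0 < s < 1)%R).
  { split.
    - eapply Rlt_le_trans; [| apply Rmax_l]. apply Rdiv_lt_0_compat; lra.
    - apply Rmax_lub_lt.
      + apply (Rmult_lt_reg_r (Cmod e0 - m / 2)); [lra |].
        unfold Rdiv at 1. rewrite Rmult_assoc, Rinv_l by lra. lra.
      + apply (Rmult_lt_reg_r r2); [lra |].
        unfold Rdiv at 1. rewrite Rmult_assoc, Rinv_l by lra. lra. }
  assert (Hs1 : (r1 <= s * (Cmod e0 - m / 2))%R).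
  { apply Rle_trans with (r1 / (Cmod e0 - m / 2) * (Cmod e0 - m / 2))%R.
    - apply Req_le. field. lra.
    - apply Rmult_le_compat_r; [lra | apply Rmax_l]. }
  assert (Hs2 : (Cmod e0 + m / 2 <= s * r2)%R).
  { apply Rle_trans with ((Cmod e0 + m / 2) / r2 * r2)%R.
    - apply Req_le. field. lra.
    - apply Rmult_le_compat_r; [lra | apply Rmax_r]. }
  set (N := fun X => (Cmod (X - e0) < m / 2)%R).
  assert (HN : forall X, N X -> (Cmod e0 - m / 2 <= Cmod X <= Cmod e0 + m / 2)%R).
  { intros X HX. unfold N in HX. generalize (Cmod_le_plus X e0) (Cmod_le_plus e0 X).
    rewrite (Cmod_minus_sym e0 X). lra. }
  (* approximants together with their difference quotients at e0 *)
  set (App := fun (eps : R) (Q : option T * C -> C) => LP (Kc := climK F D) Q /\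
    exists g : option T * C -> C,
      (forall (o : option T) (X : C), optD D o -> (r1 <= Cmod X <= r2)%R -> (Cmod (f (o, X) - g (o, X)) <= eps)%R) /\
      (forall (o : option T) (X : C), X <> 0 -> g (o, X) - g (o, e0) = (X - e0) * Q (o, X))).
  assert (Hex : forall eps, (0 < eps)%R -> exists Q, App eps Q).
  { intros eps Heps. destruct (Hf eps Heps) as [g [Lg Eg]].
    destruct (LP_subst_div HKc (fun _ => e0) (fun _ => e0) (fun _ => / e0)
      (LP_const HKc e0) (LP_const HKc (/ e0)) (fun _ _ => He0)
      (fun _ _ _ => eq_refl) (fun _ _ _ => eq_refl) g Lg) as [g' [Q [_ [LQ EQ]]]].
    exists Q. split; [exact LQ |]. exists g. split.
    - intros o X Ho HX. apply (Eg (o, X)). simpl. auto.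
    - intros o X HX. apply EQ, HX. }
  set (C0 := (4 / m / (1 - s))%R).
  assert (HC0 : (0 < C0)%R).
  { unfold C0. apply Rdiv_lt_0_compat; [apply Rdiv_lt_0_compat |]; lra. }
  assert (Hclose : forall eps Q eps' Q', App eps Q -> App eps' Q' ->
    forall (o : option T) (X : C), optD D o -> N X -> (Cmod (Q (o, X) - Q' (o, X)) <= C0 * (eps + eps'))%R).
  { intros eps Q eps' Q' [LQ [g [Eg EQ]]] [LQ' [g' [Eg' EQ']]] o X Ho HX.
    replace (C0 * (eps + eps'))%R with (2 * (2 * (eps + eps') / m) / (1 - s))%R
      by (unfold C0; field; lra).
    apply (LP_interior_bound HKc r1 r2 s _ (fun t => Q t - Q' t) o); try lra.
    - apply (LP_minus HKc); assumption.
    - intros Y HY.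
      assert (HYr : (r1 <= Cmod Y <= r2)%R) by (destruct HY; lra).
      assert (HY0 : Y <> 0) by (apply Cmod_gt_0; lra).
      assert (Hd : (m <= Cmod (Y - e0))%R).
      { generalize (Cmod_le_plus Y e0) (Cmod_le_plus e0 Y). rewrite (Cmod_minus_sym e0 Y).
        destruct HY; lra. }
      apply (Rmult_le_reg_l m); [exact Hm |].
      apply Rle_trans with (Cmod ((Y - e0) * (Q (o, Y) - Q' (o, Y)))).
      { rewrite Cmod_mult. apply Rmult_le_compat_r; [apply Cmod_ge_0 | exact Hd]. }
      replace ((Y - e0) * (Q (o, Y) - Q' (o, Y)))
        with (((f (o, Y) - g' (o, Y)) - (f (o, Y) - g (o, Y)))
              - ((f (o, e0) - g' (o, e0)) - (f (o, e0) - g (o, e0)))).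
      2:{ replace ((Y - e0) * (Q (o, Y) - Q' (o, Y)))
            with ((Y - e0) * Q (o, Y) - (Y - e0) * Q' (o, Y)) by ring.
          rewrite <- EQ, <- EQ' by exact HY0. ring. }
      assert (Her : (r1 <= Cmod e0 <= r2)%R) by lra.
      generalize (Eg o Y Ho HYr) (Eg' o Y Ho HYr) (Eg o e0 Ho Her) (Eg' o e0 Ho Her).
      assert (Htri : forall x y : C, (Cmod (x - y) <= Cmod x + Cmod y)%R).
      { intros x y. eapply Rle_trans; [apply Cmod_triangle |]. rewrite Cmod_opp. lra. }
      generalize (Htri (f (o, Y) - g' (o, Y) - (f (o, Y) - g (o, Y)))
                       (f (o, e0) - g' (o, e0) - (f (o, e0) - g (o, e0)))).
      generalize (Htri (f (o, Y) - g' (o, Y)) (f (o, Y) - g (o, Y))).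
      generalize (Htri (f (o, e0) - g' (o, e0)) (f (o, e0) - g (o, e0))).
      replace (m * (2 * (eps + eps') / m))%R with (2 * (eps + eps'))%R by (field; lra). lra.
    - apply Rle_trans with (s * (Cmod e0 - m / 2))%R; [exact Hs1 |].
      apply Rmult_le_compat_l; [lra | apply HN, HX].
    - eapply Rle_trans; [apply HN, HX | exact Hs2]. }
  assert (Hquot : forall eps Q, App eps Q -> forall t, D t -> e t <> e0 -> N (e t) ->
    (Cmod (f (Some t, e t) / (e t - e0) - Q (Some t, e t)) <= C0 * eps)%R).
  { intros eps Q HQ t Ht Het HNt.
    assert (Hd : e t - e0 <> 0) by (intros E; apply Het, Cminus_eq_0, E).
    assert (Hdp := proj1 (Cmod_gt_0 _) Hd).
    apply le_epsilon. intros eta Heta.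
    set (A := (C0 + 2 / Cmod (e t - e0))%R).
    assert (HA : (0 < A)%R).
    { unfold A. assert (0 < 2 / Cmod (e t - e0))%R by (apply Rdiv_lt_0_compat; lra). lra. }
    assert (Hee : (0 < eta / A)%R) by (apply Rdiv_lt_0_compat; assumption).
    destruct (Hex _ Hee) as [Q' HQ'].
    assert (H1 := Hclose _ _ _ _ HQ HQ' (Some t) (e t) Ht HNt).
    rewrite Cmod_minus_sym in H1.
    eapply Rle_trans; [apply (Cmod_tri3 _ (Q' (Some t, e t))) |].
    assert (H2 : (Cmod (f (Some t, e t) / (e t - e0) - Q' (Some t, e t))
                  <= 2 / Cmod (e t - e0) * (eta / A))%R).
    { destruct HQ' as [_ [g [Eg EQ]]].
      assert (Her : (r1 <= Cmod (e t) <= r2)%R) by (generalize (HN _ HNt); lra).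
      assert (Het0 : e t <> 0) by (apply Cmod_gt_0; lra).
      replace (f (Some t, e t) / (e t - e0) - Q' (Some t, e t))
        with (((f (Some t, e t) - g (Some t, e t)) - (f (Some t, e0) - g (Some t, e0)))
              / (e t - e0)).
      2:{ rewrite (Hz (Some t) Ht).
          replace (f (Some t, e t) - g (Some t, e t) - (0 - g (Some t, e0)))
            with (f (Some t, e t) - (g (Some t, e t) - g (Some t, e0))) by ring.
          rewrite (EQ (Some t) (e t) Het0). field. exact Hd. }
      unfold Cdiv. rewrite Cmod_mult, Cmod_inv by exact Hd.
      unfold Rdiv. rewrite (Rmult_comm 2), Rmult_assoc, (Rmult_comm (/ Cmod (e t - e0))).
      apply Rmult_le_compat_r; [left; apply Rinv_0_lt_compat, Hdp |].
      eapply Rle_trans; [apply Cmod_triangle |]. rewrite Cmod_opp.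
      assert (Her0 : (r1 <= Cmod e0 <= r2)%R) by lra.
      generalize (Eg (Some t) (e t) Ht Her) (Eg (Some t) e0 Ht Her0). unfold Rdiv. lra. }
    assert (H3 : (A * (eta / A) = eta)%R) by (field; lra).
    unfold A in H3 at 1. lra. }
  apply (clim_cauchy F). intros eps Heps.
  set (e1 := (eps / (4 * (C0 + 1)))%R).
  assert (He1' : (0 < e1)%R) by (apply Rdiv_lt_0_compat; lra).
  destruct (Hex e1 He1') as [Q HQ].
  assert (HQl := LP_clim Q e e0 (proj1 HQ) He He0).
  assert (HNF : F (fun t => N (e t))) by (apply He; lra).
  exists (fun t => D t /\ e t <> e0 /\ N (e t) /\
            (Cmod (Q (Some t, e t) - Q (None, e0)) < e1)%R).
  split; [repeat apply filter_and; auto |].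
  assert (Hq4 : (4 * (C0 + 1) * e1 = eps)%R) by (unfold e1; field; lra).
  intros s' t' [D1 [N1 [M1 B1]]] [D2 [N2 [M2 B2]]].
  eapply Rle_lt_trans; [apply (Cmod_tri3 _ (Q (Some s', e s'))) |].
  assert (G1 := Hquot _ _ HQ s' D1 N1 M1). assert (G2 := Hquot _ _ HQ t' D2 N2 M2).
  assert (G3 := Cmod_tri3 (Q (Some s', e s')) (Q (Some t', e t')) (f (Some t', e t') / (e t' - e0))).
  assert (G4 := Cmod_tri3 (Q (Some s', e s')) (Q (None, e0)) (Q (Some t', e t'))).
  rewrite (Cmod_minus_sym (Q (None, e0))) in G4.
  rewrite (Cmod_minus_sym (Q (Some t', e t')) (f _ / _)) in G3.
  assert (0 < C0 * e1)%R by (apply Rmult_lt_0_compat; assumption).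
  lra.
Qed.

End Removable.

(** * A Liouville theorem on an annulus *)

Lemma unit_calg : calg (fun _ : unit => True) (fun _ : unit -> C => True).
Proof.
  split; auto. intros f _. exists (Cmod (f tt)). intros [] _. lra.
Qed.

Notation LP1 := (LP (P := unit) (Kc := fun _ => True)).

(** The case without parameters of [clLP]. *)
Definition laurent_on (D : C -> Prop) (G : C -> C) : Prop :=
  clLP (DP := fun _ : unit => True) (Kc := fun _ => True) D (fun t => G (snd t)).

Lemma laurent_calg (D : C -> Prop) (r1 r2 : R) :
  (0 < r1)%R -> (forall X, D X -> r1 <= Cmod X <= r2)%R -> calg D (laurent_on D).
Proof.
  intros Hr HD. assert (HK := clLP_calg unit_calg D r1 r2 Hr HD).
  split; unfold laurent_on.
  - intros c. apply (calg_const HK).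
  - intros f g Hf Hg. apply (calg_plus HK _ _ Hf Hg).
  - intros f g Hf Hg. apply (calg_mult HK _ _ Hf Hg).
  - intros f Hf. destruct (calg_bounded HK _ Hf) as [M HM]. exists M.
    intros t Ht. apply (HM (tt, t)). simpl. auto.
  - intros f H. apply (calg_unif HK). intros eps Heps. destruct (H eps Heps) as [g [Hg E]].
    exists (fun t => g (snd t)). split; [exact Hg |]. intros t [_ Ht]. apply E, Ht.
Qed.

Lemma laurent_X (D : C -> Prop) : laurent_on D (fun X => X).
Proof. apply LP_clLP. apply LP_X. Qed.

Lemma laurent_inv (D : C -> Prop) : laurent_on D (fun X => / X).
Proof. apply LP_clLP. apply LP_inv. Qed.

(** * Powers of q and geometric convergence *)

Section FixedBase.
Context (q : R) (hq0 : (0 < q)%R) (hq1 : (q < 1)%R).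

Notation qinf := (qpoch_inf q).

Lemma qn_pos (n : nat) : (0 < q ^ n)%R.
Proof. apply pow_lt, hq0. Qed.

Lemma qn_le1 (n : nat) : (q ^ n <= 1)%R.
Proof. rewrite <- (pow1 n). apply pow_incr. lra. Qed.

Lemma qn_S_le_q (n : nat) : (q ^ S n <= q)%R.
Proof.
  assert (q * q ^ n <= q * 1)%R
    by (apply Rmult_le_compat_l; [lra | apply qn_le1]).
  simpl. lra.
Qed.

Lemma Cmod_qn (n : nat) : Cmod (RtoC q ^ n) = (q ^ n)%R.
Proof. rewrite Cmod_pow, Cmod_R, Rabs_pos_eq; lra. Qed.

Lemma Cq_neq0 : RtoC q <> 0.
Proof. intros E. apply RtoC_inj in E. lra. Qed.

Let hq : RtoC q <> 0 := Cq_neq0.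

Lemma qn_small (eps : R) : (0 < eps)%R -> exists N, forall n, (N <= n)%nat -> (q ^ n < eps)%R.
Proof.
  intros Heps. assert (Hx' : (Rabs q < 1)%R) by (rewrite Rabs_pos_eq; lra).
  destruct (pow_lt_1_zero q Hx' eps Heps) as [N HN]. exists N. intros n Hn.
  eapply Rle_lt_trans; [apply Rle_abs | apply HN; lia].
Qed.

Lemma geom_step_dist (u : nat -> C) (A : R) :
  (forall n, Cmod (u (S n) - u n) <= A * q ^ n)%R ->
  forall n m, (Cmod (u (n + m)%nat - u n) <= A * q ^ n / (1 - q))%R.
Proof.
  intros H n m.
  assert (HA : (0 <= A)%R).
  { generalize (H O) (Cmod_ge_0 (u 1%nat - u O)). simpl. lra. }
  apply Rle_trans with (A * (q ^ n - q ^ (n + m)) / (1 - q))%R.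
  - induction m as [|m IH].
    + rewrite Nat.add_0_r. replace (u n - u n) with (RtoC 0) by ring. rewrite Cmod_0.
      apply Req_le. field. lra.
    + rewrite <- plus_n_Sm.
      eapply Rle_trans; [apply (Cmod_tri3 _ (u (n + m)%nat)) |].
      generalize (H (n + m)%nat) IH. intros H1 H2.
      replace (A * (q ^ n - q ^ S (n + m)) / (1 - q))%R
        with (A * q ^ (n + m) + A * (q ^ n - q ^ (n + m)) / (1 - q))%R
        by (simpl; field; lra).
      lra.
  - unfold Rdiv. apply Rmult_le_compat_r; [left; apply Rinv_0_lt_compat; lra |].
    apply Rmult_le_compat_l; [exact HA |]. generalize (qn_pos (n + m)). lra.
Qed.

Lemma geom_step_clim (u : nat -> C) (A : R) :
  (forall n, Cmod (u (S n) - u n) <= A * q ^ n)%R ->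
  exists l, clim eventually u l /\ forall n, (Cmod (l - u n) <= A * q ^ n / (1 - q))%R.
Proof.
  intros H. assert (Hd := geom_step_dist u A H).
  assert (HA : (0 <= A)%R).
  { generalize (H O) (Cmod_ge_0 (u 1%nat - u O)). simpl. lra. }
  destruct (clim_cauchy eventually u) as [l Hl].
  - intros eps Heps.
    destruct (qn_small (eps * (1 - q) / (2 * (A + 1)))) as [N HN].
    { apply Rdiv_lt_0_compat; [apply Rmult_lt_0_compat |]; lra. }
    exists (fun n => (N <= n)%nat). split; [exists N; auto |].
    intros s t Hs Ht.
    eapply Rle_lt_trans; [apply (Cmod_tri3 _ (u N)) |].
    rewrite (Cmod_minus_sym (u N)).
    generalize (Hd N (s - N)%nat) (Hd N (t - N)%nat).
    replace (N + (s - N))%nat with s by lia. replace (N + (t - N))%nat with t by lia.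
    specialize (HN N (le_n N)).
    assert (A * q ^ N / (1 - q) < eps / 2)%R.
    { apply (Rmult_lt_reg_r (1 - q)); [lra |]. unfold Rdiv at 1.
      rewrite Rmult_assoc, Rinv_l, Rmult_1_r by lra.
      apply Rle_lt_trans with ((A + 1) * q ^ N - q ^ N)%R; [apply Req_le; ring |].
      assert ((A + 1) * q ^ N < (A + 1) * (eps * (1 - q) / (2 * (A + 1))))%R
        by (apply Rmult_lt_compat_l; lra).
      replace ((A + 1) * (eps * (1 - q) / (2 * (A + 1))))%R
        with (eps / 2 * (1 - q))%R in * by (field; lra).
      generalize (qn_pos N). lra. }
    lra.
  - exists l. split; [exact Hl |]. intros n.
    apply (clim_Cmod_le (fun m => u (n + m)%nat - u n)).
    + apply (clim_minus eventually).
      * apply clim_seq_shift. exact Hl.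
      * apply (clim_const eventually).
    + exists O. intros m _. apply Hd.
Qed.

Definition qpsum (f : nat -> C) : nat -> C := psum (fun n => RtoC q ^ n * f n).

Definition qser (f : nat -> C) : C := Csum (fun n => RtoC q ^ n * f n).

Lemma qser_clim_rate (f : nat -> C) (A : R) :
  (forall n, Cmod (f n) <= A)%R ->
  clim eventually (qpsum f) (qser f) /\
  forall n, (Cmod (qser f - qpsum f n) <= A * q ^ n / (1 - q))%R.
Proof.
  intros H.
  destruct (geom_step_clim (qpsum f) A) as [l [H1 H2]].
  - intros n.
    replace (qpsum f (S n) - qpsum f n) with (RtoC q ^ n * f n)
      by (unfold qpsum; simpl; ring).
    rewrite Cmod_mult, Cmod_qn, Rmult_comm.
    apply Rmult_le_compat_r; [left; apply qn_pos | apply H].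
  - unfold qser. rewrite (Csum_unique _ l H1). split; assumption.
Qed.

(** * q-shifted factorials *)

(** A bound for [(x; q)_n] with [|x| <= r], from [1 + y <= exp y]. *)
Definition Mq (r : R) : R := exp (r / (1 - q)).

Lemma Mq_pos (r : R) : (0 < Mq r)%R.
Proof. apply exp_pos. Qed.

Lemma qpoch_bound (r : R) (x : C) (n : nat) :
  (Cmod x <= r)%R -> (Cmod (qpoch q x n) <= Mq r)%R.
Proof.
  intros Hx. assert (Hr : (0 <= r)%R) by (generalize (Cmod_ge_0 x); lra).
  apply Rle_trans with (exp (r * (1 - q ^ n) / (1 - q))).
  - induction n as [|n IH]; simpl.
    + rewrite Cmod_1. replace (r * (1 - 1) / (1 - q))%R with 0%R by (field; lra).
      rewrite exp_0. lra.
    + rewrite Cmod_mult.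
      replace (r * (1 - q * q ^ n) / (1 - q))%R
        with (r * (1 - q ^ n) / (1 - q) + r * q ^ n)%R by (field; lra).
      rewrite exp_plus.
      apply Rmult_le_compat; try apply Cmod_ge_0; [exact IH |].
      eapply Rle_trans; [apply Cmod_triangle |].
      rewrite Cmod_1, Cmod_opp, Cmod_mult, Cmod_qn.
      eapply Rle_trans; [| apply exp_ineq1_le].
      apply Rplus_le_compat_l. apply Rmult_le_compat_r; [left; apply qn_pos | exact Hx].
  - unfold Mq.
    assert (r * (1 - q ^ n) / (1 - q) <= r / (1 - q))%R.
    { unfold Rdiv. apply Rmult_le_compat_r; [left; apply Rinv_0_lt_compat; lra |].
      assert (0 <= r * q ^ n)%R
        by (apply Rmult_le_pos; [exact Hr | left; apply qn_pos]). lra. }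
    destruct H as [H | H]; [left; apply exp_increasing, H | right; f_equal; exact H].
Qed.

Lemma qpoch_clim_rate (r : R) (x : C) :
  (Cmod x <= r)%R ->
  clim eventually (qpoch q x) (qpoch_inf q x) /\
  forall n, (Cmod (qpoch_inf q x - qpoch q x n) <= Mq r * r * q ^ n / (1 - q))%R.
Proof.
  intros Hx.
  destruct (geom_step_clim (qpoch q x) (Mq r * r)) as [l [H1 H2]].
  - intros n. simpl.
    replace (qpoch q x n * (1 - x * RtoC q ^ n) - qpoch q x n)
      with (- (qpoch q x n * x * RtoC q ^ n)) by ring.
    rewrite Cmod_opp, !Cmod_mult, Cmod_qn.
    apply Rmult_le_compat_r; [left; apply qn_pos |].
    apply Rmult_le_compat; try apply Cmod_ge_0; [apply qpoch_bound, Hx | exact Hx].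
  - unfold qpoch_inf. rewrite (Climit_unique eventually _ l H1). split; assumption.
Qed.

Lemma qpoch_clim (x : C) : clim eventually (qpoch q x) (qpoch_inf q x).
Proof. apply (qpoch_clim_rate (Cmod x) x), Rle_refl. Qed.

Lemma qpoch_inf_bound (r : R) (x : C) :
  (Cmod x <= r)%R -> (Cmod (qpoch_inf q x) <= Mq r)%R.
Proof.
  intros Hx. apply (clim_Cmod_le _ _ _ (qpoch_clim x)).
  exists O. intros n _. apply qpoch_bound, Hx.
Qed.

Lemma qpoch_S_l (x : C) (n : nat) :
  qpoch q x (S n) = (1 - x) * qpoch q (x * RtoC q) n.
Proof.
  induction n as [|n IH]; [simpl; ring |].
  change (qpoch q x (S (S n))) with (qpoch q x (S n) * (1 - x * RtoC q ^ S n)).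
  rewrite IH. simpl qpoch. rewrite Cpow_S. ring.
Qed.

Lemma qpoch_add (x : C) (m n : nat) :
  qpoch q x (m + n) = qpoch q x m * qpoch q (x * RtoC q ^ m) n.
Proof.
  induction n as [|n IH]; simpl; [rewrite Nat.add_0_r; ring |].
  rewrite <- plus_n_Sm. simpl. rewrite IH, Cpow_add_r. ring.
Qed.

Lemma qpoch_inf_split (x : C) (m : nat) :
  qpoch_inf q x = qpoch q x m * qpoch_inf q (x * RtoC q ^ m).
Proof.
  apply (clim_unique eventually (fun n => qpoch q x (m + n))).
  - apply clim_seq_shift, qpoch_clim.
  - apply (clim_ext eventually (fun n => qpoch q x m * qpoch q (x * RtoC q ^ m) n)).
    + intros n. symmetry. apply qpoch_add.
    + apply (clim_mult eventually); [apply (clim_const eventually) | apply qpoch_clim].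
Qed.

Lemma qpoch_inf_S (x : C) : qpoch_inf q x = (1 - x) * qpoch_inf q (x * RtoC q).
Proof. rewrite (qpoch_inf_split x 1). simpl. f_equal; [ring | f_equal; ring]. Qed.

Lemma qpoch_inf_0 : qpoch_inf q 0 = 1.
Proof.
  apply (clim_unique eventually (qpoch q 0)); [apply qpoch_clim |].
  apply (clim_ext eventually (fun _ => RtoC 1)); [| apply (clim_const eventually)].
  induction t as [|n IH]; simpl; [reflexivity | rewrite <- IH; ring].
Qed.

Lemma qpoch_inf_eq0 (x : C) (k : nat) : 1 - x * RtoC q ^ k = 0 -> qpoch_inf q x = 0.
Proof. intros H. rewrite (qpoch_inf_split x (S k)). simpl. rewrite H. ring. Qed.

Lemma qpoch_inf_factor (x : C) (k : nat) : qpoch_inf q x <> 0 -> 1 - x * RtoC q ^ k <> 0.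
Proof. intros H E. apply H, (qpoch_inf_eq0 x k), E. Qed.

Lemma qpoch_neq0 (x : C) (n : nat) :
  (forall k, 1 - x * RtoC q ^ k <> 0) -> qpoch q x n <> 0.
Proof.
  intros H. induction n as [|n IH]; simpl; [apply C1_nz |].
  apply Cmult_neq_0; [exact IH | apply H].
Qed.

(** This brings [1 / (x; q)_oo] within the reach of the Neumann series, and shows that the
    product vanishes only if one of its factors does. *)
Lemma qpoch_inf_tail (r : R) :
  (0 <= r)%R -> exists m, forall x, (Cmod x <= r)%R ->
    (Cmod (1 - qpoch_inf q (x * RtoC q ^ m)) <= 1 / 2)%R.
Proof.
  intros Hr. set (B := (Mq r * r / (1 - q))%R).
  assert (HB : (0 <= B)%R).
  { unfold B, Rdiv. apply Rmult_le_pos; [apply Rmult_le_pos; [left; apply Mq_pos | exact Hr] |].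
    left. apply Rinv_0_lt_compat. lra. }
  destruct (qn_small (1 / (2 * (B + 1)))) as [m Hm].
  { apply Rdiv_lt_0_compat; lra. }
  exists m. intros x Hx. specialize (Hm m (le_n m)).
  assert (Hqm := qn_pos m).
  assert (Hx' : (Cmod (x * RtoC q ^ m) <= r * q ^ m)%R).
  { rewrite Cmod_mult, Cmod_qn. apply Rmult_le_compat_r; lra. }
  destruct (qpoch_clim_rate _ _ Hx') as [_ H]. specialize (H O). simpl qpoch in H.
  rewrite Cmod_minus_sym. eapply Rle_trans; [exact H |]. simpl pow. rewrite Rmult_1_r.
  assert (HM : (Mq (r * q ^ m) <= Mq r)%R).
  { assert (Hle : (r * q ^ m / (1 - q) <= r / (1 - q))%R).
    { unfold Rdiv. apply Rmult_le_compat_r; [left; apply Rinv_0_lt_compat; lra |].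
      rewrite <- (Rmult_1_r r) at 2. apply Rmult_le_compat_l; [exact Hr | apply qn_le1]. }
    unfold Mq. destruct Hle as [Hl | Hl]; [left; apply exp_increasing, Hl | right; f_equal; exact Hl]. }
  apply Rle_trans with (B * q ^ m)%R.
  - unfold B.
    replace (Mq r * r / (1 - q) * q ^ m)%R with (Mq r * (r * q ^ m) / (1 - q))%R by (field; lra).
    unfold Rdiv. apply Rmult_le_compat_r; [left; apply Rinv_0_lt_compat; lra |].
    apply Rmult_le_compat_r; [apply Rmult_le_pos; lra | exact HM].
  - assert ((B + 1) * q ^ m <= (B + 1) * (1 / (2 * (B + 1))))%R by (apply Rmult_le_compat_l; lra).
    replace ((B + 1) * (1 / (2 * (B + 1))))%R with (1/2)%R in * by (field; lra). lra.
Qed.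

Lemma qpoch_inf_neq0 (x : C) :
  (forall k, 1 - x * RtoC q ^ k <> 0) -> qpoch_inf q x <> 0.
Proof.
  intros H. destruct (qpoch_inf_tail (Cmod x) (Cmod_ge_0 x)) as [m Hm].
  rewrite (qpoch_inf_split x m). apply Cmult_neq_0; [apply qpoch_neq0, H |].
  intros E. specialize (Hm x (Rle_refl _)). rewrite E in Hm.
  replace (1 - 0) with (RtoC 1) in Hm by ring. rewrite Cmod_1 in Hm. lra.
Qed.

Lemma factor_neq0_small (x : C) (k : nat) : (Cmod x < 1)%R -> 1 - x * RtoC q ^ k <> 0.
Proof.
  intros Hx E. apply Cminus_eq_0 in E.
  assert (H : Cmod (x * RtoC q ^ k) = 1%R) by (rewrite <- E; apply Cmod_1).
  rewrite Cmod_mult, Cmod_qn in H.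
  assert (Cmod x * q ^ k <= Cmod x * 1)%R
    by (apply Rmult_le_compat_l; [apply Cmod_ge_0 | apply qn_le1]).
  lra.
Qed.

Lemma qpoch_inf_small_neq0 (x : C) : (Cmod x < 1)%R -> qpoch_inf q x <> 0.
Proof. intros Hx. apply qpoch_inf_neq0. intros k. apply factor_neq0_small, Hx. Qed.

Section CalgQ.
Context {T : Type} {D : T -> Prop} {K : (T -> C) -> Prop} (HK : calg D K).

Lemma calg_qpoch (x : T -> C) (n : nat) : K x -> K (fun t => qpoch q (x t) n).
Proof.
  intros Hx. induction n as [|n IH]; simpl; [apply (calg_const HK) |].
  apply (calg_mult HK); [exact IH |].
  apply (calg_minus HK); [apply (calg_const HK) |].
  apply (calg_mult HK); [exact Hx | apply (calg_const HK)].
Qed.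

Lemma calg_rate (f : T -> C) (g : nat -> T -> C) (B : R) :
  (forall n, K (g n)) ->
  (forall n t, D t -> (Cmod (f t - g n t) <= B * q ^ n / (1 - q))%R) -> K f.
Proof.
  intros Hg H. apply (calg_unif HK). intros eps Heps.
  set (B' := (Rabs B / (1 - q) + 1)%R).
  assert (HB : (1 <= B')%R).
  { unfold B', Rdiv. assert (0 <= Rabs B * / (1 - q))%R; [| lra].
    apply Rmult_le_pos; [apply Rabs_pos | left; apply Rinv_0_lt_compat; lra]. }
  destruct (qn_small (eps / B')) as [N HN].
  { apply Rdiv_lt_0_compat; lra. }
  exists (g N). split; [apply Hg |]. intros t Ht.
  eapply Rle_trans; [apply H, Ht |]. specialize (HN N (le_n N)).
  assert (Hq := qn_pos N).
  apply Rle_trans with (B' * q ^ N)%R.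
  - replace (B * q ^ N / (1 - q))%R with (B / (1 - q) * q ^ N)%R by (field; lra).
    apply Rmult_le_compat_r; [lra |]. unfold B', Rdiv.
    assert (B * / (1 - q) <= Rabs B * / (1 - q))%R; [| lra].
    apply Rmult_le_compat_r; [left; apply Rinv_0_lt_compat; lra | apply Rle_abs].
  - apply Rlt_le. apply Rlt_le_trans with (B' * (eps / B'))%R.
    + apply Rmult_lt_compat_l; lra.
    + apply Req_le. field. lra.
Qed.

Lemma calg_qpoch_inf (x : T -> C) : K x -> K (fun t => qpoch_inf q (x t)).
Proof.
  intros Hx. destruct (calg_bounded HK x Hx) as [r Hr].
  apply (calg_rate _ (fun n t => qpoch q (x t) n) (Mq r * r)).
  - intros n. apply calg_qpoch, Hx.
  - intros n t Ht. apply (qpoch_clim_rate r), Hr, Ht.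
Qed.

Lemma calg_qser (f : nat -> T -> C) (A : R) :
  (forall n, K (f n)) -> (forall n t, D t -> (Cmod (f n t) <= A)%R) ->
  K (fun t => qser (fun n => f n t)).
Proof.
  intros Hf HA.
  apply (calg_rate _ (fun n t => qpsum (fun k => f k t) n) A).
  - intros n. unfold qpsum. apply (calg_psum HK (fun k t => RtoC q ^ k * f k t)).
    intros k. apply (calg_mult HK); [apply (calg_const HK) | apply Hf].
  - intros n t Ht. apply (qser_clim_rate (fun k => f k t) A).
    intros k. apply HA, Ht.
Qed.

Lemma calg_qpoch_inv (x : T -> C) (th : R) (n : nat) :
  (0 <= th < 1)%R -> K x -> (forall t, D t -> (Cmod (x t) <= th)%R) ->
  K (fun t => / qpoch q (x t) n).
Proof.
  intros Hth Hx Hb. induction n as [|n IH]; simpl.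
  - apply (calg_ext HK (fun _ => 1)); [intros; field; apply C1_nz | apply (calg_const HK)].
  - assert (Hx' : forall t, D t -> (Cmod (x t * RtoC q ^ n) <= th)%R).
    { intros t Ht. rewrite Cmod_mult, Cmod_qn.
      rewrite <- (Rmult_1_r th). apply Rmult_le_compat;
        [apply Cmod_ge_0 | left; apply qn_pos | apply Hb, Ht | apply qn_le1]. }
    apply (calg_ext HK (fun t => / qpoch q (x t) n * / (1 - x t * RtoC q ^ n))).
    + intros t Ht. field. split.
      * apply factor_neq0_small. generalize (Hb t Ht). lra.
      * apply qpoch_neq0. intros k. apply factor_neq0_small.
        generalize (Hb t Ht). lra.
    + apply (calg_mult HK); [exact IH |].
      apply (calg_inv HK (fun t => x t * RtoC q ^ n) th Hth); [| exact Hx'].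
      apply (calg_mult HK); [exact Hx | apply (calg_const HK)].
Qed.

(** The reciprocal is a product of finitely many Neumann series and that of a tail close
    to [1]. *)
Lemma calg_qpoch_inf_inv (x : T -> C) (th : R) :
  (0 <= th < 1)%R -> K x -> (forall t, D t -> (Cmod (x t) <= th)%R) ->
  K (fun t => / qpoch_inf q (x t)).
Proof.
  intros Hth Hx Hb. destruct (qpoch_inf_tail th (proj1 Hth)) as [m Hm].
  set (y := fun t => 1 - qpoch_inf q (x t * RtoC q ^ m)).
  assert (Hy : K y).
  { apply (calg_minus HK); [apply (calg_const HK) |].
    apply (calg_qpoch_inf (fun t => x t * RtoC q ^ m)).
    apply (calg_mult HK); [exact Hx | apply (calg_const HK)]. }
  apply (calg_ext HK (fun t => / qpoch q (x t) m * / (1 - y t))).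
  - intros t Ht. rewrite (qpoch_inf_split (x t) m). unfold y.
    replace (1 - (1 - qpoch_inf q (x t * RtoC q ^ m)))
      with (qpoch_inf q (x t * RtoC q ^ m)) by ring.
    assert (Hlt : (Cmod (x t) < 1)%R) by (generalize (Hb t Ht); lra).
    assert (Hn : forall k, 1 - x t * RtoC q ^ k <> 0)
      by (intros k; apply factor_neq0_small, Hlt).
    field. split.
    + intros E. apply (qpoch_inf_neq0 (x t) Hn).
      rewrite (qpoch_inf_split (x t) m), E. ring.
    + apply qpoch_neq0, Hn.
  - apply (calg_mult HK); [apply (calg_qpoch_inv x th); assumption |].
    apply (calg_inv HK y (1 / 2)); [lra | exact Hy |].
    intros t Ht. apply Hm, Hb, Ht.
Qed.

End CalgQ.

(** * The regularized balanced series *)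

Definition sg_term (s1 s2 s3 s4 b1 b2 b3 : C) (n : nat) : C :=
  qpoch q s1 n * qpoch q s2 n * qpoch q s3 n * qpoch q s4 n
  * qpoch_inf q (RtoC q * RtoC q ^ n) * qpoch_inf q (b1 * RtoC q ^ n)
  * qpoch_inf q (b2 * RtoC q ^ n) * qpoch_inf q (b3 * RtoC q ^ n).

(** The 4phi3 series with argument [q], multiplied by [(q, b1, b2, b3; q)_oo]: in this form it
    has no denominators. *)
Definition Sg (s1 s2 s3 s4 b1 b2 b3 : C) : C :=
  qser (sg_term s1 s2 s3 s4 b1 b2 b3).

(** The combination of two balanced series that makes up [u], cleared of denominators. The
    second one is the first one with [s_i -> e s_i], [b_i -> e b_i], [e -> 1/e]. *)
Definition Phi (s1 s2 s3 s4 b1 b2 e : C) : C :=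
  qpoch_inf q (e * s1) * qpoch_inf q (e * s2)
    * qpoch_inf q (e * s3) * qpoch_inf q (e * s4)
    * Sg s1 s2 s3 s4 b1 b2 (q / e)
  - e * (qpoch_inf q s1 * qpoch_inf q s2 * qpoch_inf q s3 * qpoch_inf q s4)
    * Sg (e * s1) (e * s2) (e * s3) (e * s4) (e * b1) (e * b2) (q * e).

Lemma Cmod_shift_le (b : C) (r : R) (n : nat) :
  (Cmod b <= r)%R -> (Cmod (b * RtoC q ^ n) <= r)%R.
Proof.
  intros Hb. rewrite Cmod_mult, Cmod_qn.
  assert (Cmod b * q ^ n <= Cmod b * 1)%R
    by (apply Rmult_le_compat_l; [apply Cmod_ge_0 | apply qn_le1]).
  lra.
Qed.

Lemma sg_term_bound (r : R) (s1 s2 s3 s4 b1 b2 b3 : C) (n : nat) :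
  (1 <= r)%R ->
  (Cmod s1 <= r)%R -> (Cmod s2 <= r)%R -> (Cmod s3 <= r)%R -> (Cmod s4 <= r)%R ->
  (Cmod b1 <= r)%R -> (Cmod b2 <= r)%R -> (Cmod b3 <= r)%R ->
  (Cmod (sg_term s1 s2 s3 s4 b1 b2 b3 n)
   <= Mq r * Mq r * Mq r * Mq r * Mq r * Mq r * Mq r * Mq r)%R.
Proof.
  intros Hr H1 H2 H3 H4 H5 H6 H7. unfold sg_term.
  repeat apply Cmod_mult_le; try (apply qpoch_bound; assumption);
    apply qpoch_inf_bound; apply Cmod_shift_le; try assumption.
  rewrite Cmod_R, Rabs_pos_eq; lra.
Qed.

Lemma Sg_clim (s1 s2 s3 s4 b1 b2 b3 : C) :
  clim eventually (qpsum (sg_term s1 s2 s3 s4 b1 b2 b3)) (Sg s1 s2 s3 s4 b1 b2 b3).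
Proof.
  set (r := (1 + Cmod s1 + Cmod s2 + Cmod s3 + Cmod s4 + Cmod b1 + Cmod b2 + Cmod b3)%R).
  assert (G1 := Cmod_ge_0 s1). assert (G2 := Cmod_ge_0 s2). assert (G3 := Cmod_ge_0 s3).
  assert (G4 := Cmod_ge_0 s4). assert (G5 := Cmod_ge_0 b1). assert (G6 := Cmod_ge_0 b2).
  assert (G7 := Cmod_ge_0 b3).
  apply (qser_clim_rate _
    (Mq r * Mq r * Mq r * Mq r * Mq r * Mq r * Mq r * Mq r)).
  intros n. apply sg_term_bound; unfold r; lra.
Qed.

Section Membership.
Context {T : Type} {D : T -> Prop} {K : (T -> C) -> Prop} (HK : calg D K).

Lemma calg_Sg (s1 s2 s3 s4 b1 b2 b3 : T -> C) :
  K s1 -> K s2 -> K s3 -> K s4 -> K b1 -> K b2 -> K b3 ->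
  K (fun t => Sg (s1 t) (s2 t) (s3 t) (s4 t) (b1 t) (b2 t) (b3 t)).
Proof.
  intros H1 H2 H3 H4 H5 H6 H7.
  destruct (calg_bounded_pos HK _ H1) as [r1 [P1 B1]].
  destruct (calg_bounded_pos HK _ H2) as [r2 [P2 B2]].
  destruct (calg_bounded_pos HK _ H3) as [r3 [P3 B3]].
  destruct (calg_bounded_pos HK _ H4) as [r4 [P4 B4]].
  destruct (calg_bounded_pos HK _ H5) as [r5 [P5 B5]].
  destruct (calg_bounded_pos HK _ H6) as [r6 [P6 B6]].
  destruct (calg_bounded_pos HK _ H7) as [r7 [P7 B7]].
  set (r := (1 + r1 + r2 + r3 + r4 + r5 + r6 + r7)%R).
  assert (Hs : forall (b : T -> C) n, K b -> K (fun t => qpoch_inf q (b t * RtoC q ^ n))).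
  { intros b n Hb. apply (calg_qpoch_inf HK (fun t => b t * RtoC q ^ n)).
    apply (calg_mult HK); [exact Hb | apply (calg_const HK)]. }
  apply (calg_qser HK
    (fun n t => sg_term (s1 t) (s2 t) (s3 t) (s4 t) (b1 t) (b2 t) (b3 t) n)
    (Mq r * Mq r * Mq r * Mq r * Mq r * Mq r * Mq r * Mq r)).
  - intros n. unfold sg_term.
    repeat apply (calg_mult HK); try (apply (calg_qpoch HK); assumption);
      try (apply Hs; assumption).
    apply (calg_const HK).
  - intros n t Ht.
    specialize (B1 t Ht). specialize (B2 t Ht). specialize (B3 t Ht).
    specialize (B4 t Ht). specialize (B5 t Ht). specialize (B6 t Ht). specialize (B7 t Ht).
    apply sg_term_bound; unfold r; lra.
Qed.

Lemma calg_Phi (s1 s2 s3 s4 b1 b2 e : T -> C) :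
  K s1 -> K s2 -> K s3 -> K s4 -> K b1 -> K b2 -> K e -> K (fun t => / e t) ->
  K (fun t => Phi (s1 t) (s2 t) (s3 t) (s4 t) (b1 t) (b2 t) (e t)).
Proof.
  intros H1 H2 H3 H4 H5 H6 H7 H8. unfold Phi.
  assert (Hm : forall f g : T -> C, K f -> K g -> K (fun t => f t * g t))
    by apply (calg_mult HK).
  assert (Hp : forall f : T -> C, K f -> K (fun t => qpoch_inf q (f t)))
    by apply (calg_qpoch_inf HK).
  assert (Hc := calg_const HK).
  apply (calg_minus HK); [apply Hm | apply Hm].
  - repeat apply Hm; apply (Hp (fun t => _ * _)); auto.
  - apply (calg_Sg s1 s2 s3 s4 b1 b2 (fun t => q / e t)); auto. apply Hm; auto.
  - repeat apply Hm; auto.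
  - apply (calg_Sg (fun t => e t * s1 t) (fun t => e t * s2 t) (fun t => e t * s3 t)
      (fun t => e t * s4 t) (fun t => e t * b1 t) (fun t => e t * b2 t)
      (fun t => q * e t)); auto.
Qed.

End Membership.

Section ClimSeries.
Context {T : Type} (F : (T -> Prop) -> Prop) {HF : Filter F}.

Lemma clim_qpoch_inf (f : T -> C) (l : C) :
  clim F f l -> clim F (fun t => qpoch_inf q (f t)) (qpoch_inf q l).
Proof.
  intros Hf.
  set (D := fun t => (Cmod (f t) <= Cmod l + 1)%R).
  assert (HD : F D) by apply (clim_bounded F f l Hf).
  destruct (calg_qpoch_inf (climK_calg F D HD) (optf f l)) as [_ H]; [| exact H].
  apply (climK_optf F D f l (Cmod l + 1)); [exact Hf | lra | auto].
Qed.

Lemma clim_Sg (f1 f2 f3 f4 f5 f6 f7 : T -> C) (l1 l2 l3 l4 l5 l6 l7 : C) :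
  clim F f1 l1 -> clim F f2 l2 -> clim F f3 l3 -> clim F f4 l4 ->
  clim F f5 l5 -> clim F f6 l6 -> clim F f7 l7 ->
  clim F (fun t => Sg (f1 t) (f2 t) (f3 t) (f4 t) (f5 t) (f6 t) (f7 t))
    (Sg l1 l2 l3 l4 l5 l6 l7).
Proof.
  intros H1 H2 H3 H4 H5 H6 H7.
  assert (B1 := clim_bounded F f1 l1 H1). assert (B2 := clim_bounded F f2 l2 H2).
  assert (B3 := clim_bounded F f3 l3 H3). assert (B4 := clim_bounded F f4 l4 H4).
  assert (B5 := clim_bounded F f5 l5 H5). assert (B6 := clim_bounded F f6 l6 H6).
  assert (B7 := clim_bounded F f7 l7 H7).
  assert (HD := filter_and _ _ B1 (filter_and _ _ B2 (filter_and _ _ B3 (filter_and _ _ B4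
    (filter_and _ _ B5 (filter_and _ _ B6 B7)))))). simpl in HD.
  match type of HD with F ?D0 => set (D := D0) in HD end.
  destruct (calg_Sg (climK_calg F D HD) (optf f1 l1) (optf f2 l2) (optf f3 l3)
    (optf f4 l4) (optf f5 l5) (optf f6 l6) (optf f7 l7)) as [_ H]; [| | | | | | | exact H];
    (eapply (climK_optf F D); [eassumption | | intros t Ht; unfold D in Ht; apply Ht]; lra).
Qed.

Lemma clim_Phi (f1 f2 f3 f4 f5 f6 f7 : T -> C) (l1 l2 l3 l4 l5 l6 l7 : C) :
  clim F f1 l1 -> clim F f2 l2 -> clim F f3 l3 -> clim F f4 l4 ->
  clim F f5 l5 -> clim F f6 l6 -> clim F f7 l7 -> l7 <> 0 ->
  clim F (fun t => Phi (f1 t) (f2 t) (f3 t) (f4 t) (f5 t) (f6 t) (f7 t))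
    (Phi l1 l2 l3 l4 l5 l6 l7).
Proof.
  intros H1 H2 H3 H4 H5 H6 H7 Hl.
  assert (Hm := clim_mult F). assert (Hc := clim_const F).
  unfold Phi. apply (clim_minus F).
  - apply Hm; [repeat apply Hm; apply clim_qpoch_inf, Hm; assumption |].
    apply clim_Sg; try assumption. apply (clim_div F); auto.
  - apply Hm; [apply Hm; [assumption | repeat apply Hm; apply clim_qpoch_inf; assumption] |].
    apply clim_Sg; apply Hm; auto.
Qed.

End ClimSeries.

(** * Rigidity of q-periodic functions *)

Lemma Cmod_qdiv (X : C) : X <> 0 -> Cmod (q / X) = (q / Cmod X)%R.
Proof.
  intros HX. unfold Cdiv. rewrite Cmod_mult, Cmod_inv, Cmod_R, Rabs_pos_eq by (lra || exact HX).
  reflexivity.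
Qed.

Lemma qn_diff (M k : nat) :
  (q ^ (Nat.min k M) * (1 - q) <= Rabs (q ^ k - q ^ M))%R \/ k = M.
Proof.
  destruct (Nat.lt_trichotomy k M) as [H | [H | H]]; [left | right; exact H | left].
  - rewrite Nat.min_l by lia. eapply Rle_trans; [| apply Rle_abs].
    replace (q ^ M)%R with (q ^ k * q ^ (M - k))%R by (rewrite <- pow_add; f_equal; lia).
    replace (q ^ k - q ^ k * q ^ (M - k))%R with (q ^ k * (1 - q ^ (M - k)))%R by ring.
    apply Rmult_le_compat_l; [left; apply qn_pos |].
    replace (M - k)%nat with (S (M - k - 1)) by lia. simpl.
    assert (q * q ^ (M - k - 1) <= q * 1)%R
      by (apply Rmult_le_compat_l; [lra | apply qn_le1]). lra.
  - rewrite Nat.min_r by lia. rewrite Rabs_minus_sym. eapply Rle_trans; [| apply Rle_abs].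
    replace (q ^ k)%R with (q ^ M * q ^ (k - M))%R by (rewrite <- pow_add; f_equal; lia).
    replace (q ^ M - q ^ M * q ^ (k - M))%R with (q ^ M * (1 - q ^ (k - M)))%R by ring.
    apply Rmult_le_compat_l; [left; apply qn_pos |].
    replace (k - M)%nat with (S (k - M - 1)) by lia. simpl.
    assert (q * q ^ (k - M - 1) <= q * 1)%R
      by (apply Rmult_le_compat_l; [lra | apply qn_le1]). lra.
Qed.

(** Under [Q X -> Q (q X) - Q X] the coefficient of [X^n] is multiplied by [q^n - 1], which is
    bounded away from [0] for [n > 0] and of size [q^n] for [n < 0]. So the Cauchy estimates on
    the two circles bound every coefficient of [Q] but the constant one. *)
Lemma almost_periodic_const (r B : R) (Q : unit * C -> C) :
  (0 < r < 1)%R -> LP1 Q ->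
  (forall X, Cmod X = r \/ Cmod X = (/ r)%R ->
     (Cmod (Q (tt, (RtoC q * X)%C) - Q (tt, X)) <= B)%R) ->
  exists c : C, forall X, (q <= Cmod X <= 1)%R ->
    (Cmod (Q (tt, X) - c) <= 2 * (B / (1 - q)) / (1 - r))%R.
Proof.
  intros Hr HQ HB.
  destruct (LP_normal unit_calg Q HQ) as [M [n [c' [HMn Hc']]]].
  set (c := fun k => c' k tt).
  assert (Hc : forall X : C, X <> 0 -> Q (tt, X) * X ^ M = psum (fun k => c k * X ^ k) n)
    by (intros X HX; apply (Hc' tt X HX)).
  assert (Hq0 := Cq_neq0).
  assert (Hri : (1 < / r)%R) by (rewrite <- Rinv_1; apply Rinv_lt_contravar; lra).
  assert (HB0 : (0 <= B)%R).
  { eapply Rle_trans; [apply Cmod_ge_0 | apply (HB (RtoC r))].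
    left. rewrite Cmod_R, Rabs_pos_eq; lra. }
  assert (Hest : forall rho, (0 < rho)%R ->
    (forall X, Cmod X = rho -> (Cmod (Q (tt, (RtoC q * X)%C) - Q (tt, X)) <= B)%R) ->
    forall k, (k < n)%nat ->
      (Cmod (c k) * Rabs (q ^ k - q ^ M) * rho ^ k <= q ^ M * rho ^ M * B)%R).
  { intros rho Hrho Hb k Hk.
    replace (Cmod (c k) * Rabs (q ^ k - q ^ M))%R
      with (Cmod (c k * (RtoC q ^ k - RtoC q ^ M)))
      by (rewrite Cmod_mult, <- !RtoC_pow, <- RtoC_minus, Cmod_R; reflexivity).
    apply (cauchy_estimate (fun k => c k * (RtoC q ^ k - RtoC q ^ M)) n rho); auto.
    intros X HX. assert (HX0 : X <> 0) by (apply Cmod_gt_0; lra).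
    rewrite (psum_ext _ (fun k => c k * (RtoC q * X) ^ k
                 + (- RtoC q ^ M) * (c k * X ^ k)))
      by (intros; rewrite Cpow_mult_l; ring).
    rewrite psum_plus, psum_scal, <- (Hc X HX0), <- (Hc (RtoC q * X)).
    2:{ apply Cmult_neq_0; assumption. }
    replace (Q (tt, (RtoC q * X)%C) * (RtoC q * X) ^ M + - RtoC q ^ M * (Q (tt, X) * X ^ M))
      with (RtoC q ^ M * X ^ M * (Q (tt, (RtoC q * X)%C) - Q (tt, X)))
      by (rewrite Cpow_mult_l; ring).
    rewrite !Cmod_mult, Cmod_qn, Cmod_pow, HX.
    apply Rmult_le_compat_l; [| apply Hb, HX].
    apply Rmult_le_pos; apply pow_le; lra. }
  assert (Ein := Hest r (proj1 Hr) (fun X HX => HB X (or_introl HX))).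
  assert (Eout := Hest (/ r)%R ltac:(lra) (fun X HX => HB X (or_intror HX))).
  set (A := (B / (1 - q))%R).
  assert (HA : (0 <= A)%R).
  { unfold A, Rdiv. apply Rmult_le_pos; [exact HB0 | left; apply Rinv_0_lt_compat; lra]. }
  assert (HAB : (A * (1 - q) = B)%R) by (unfold A; field; lra).
  assert (Clow : forall k, (k < M)%nat -> (Cmod (c k) <= A * (q * r) ^ (M - k))%R).
  { intros k Hk. specialize (Ein k ltac:(lia)).
    destruct (qn_diff M k) as [Hd | E]; [| lia]. rewrite Nat.min_l in Hd by lia.
    apply (Rmult_le_reg_r ((q * r) ^ k * (1 - q))).
    { apply Rmult_lt_0_compat; [apply pow_lt, Rmult_lt_0_compat; lra | lra]. }
    replace (A * (q * r) ^ (M - k) * ((q * r) ^ k * (1 - q)))%R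
      with (A * (1 - q) * ((q * r) ^ (M - k) * (q * r) ^ k))%R by ring.
    rewrite HAB, <- pow_add. replace (M - k + k)%nat with M by lia.
    apply Rle_trans with (Cmod (c k) * Rabs (q ^ k - q ^ M) * r ^ k)%R.
    2:{ eapply Rle_trans; [exact Ein |]. rewrite Rpow_mult_distr. apply Req_le. ring. }
    rewrite Rpow_mult_distr.
    replace (Cmod (c k) * (q ^ k * r ^ k * (1 - q)))%R
      with (Cmod (c k) * r ^ k * (q ^ k * (1 - q)))%R by ring.
    replace (Cmod (c k) * Rabs (q ^ k - q ^ M) * r ^ k)%R
      with (Cmod (c k) * r ^ k * Rabs (q ^ k - q ^ M))%R by ring.
    apply Rmult_le_compat_l; [| exact Hd].
    apply Rmult_le_pos; [apply Cmod_ge_0 | apply pow_le; lra]. }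
  assert (Chigh : forall k, (M < k < n)%nat -> (Cmod (c k) <= A * r ^ (k - M))%R).
  { intros k Hk. specialize (Eout k ltac:(lia)).
    destruct (qn_diff M k) as [Hd | E]; [| lia]. rewrite Nat.min_r in Hd by lia.
    assert (Hqm := qn_pos M).
    assert (Hrk : (0 < (/ r) ^ k)%R) by (apply pow_lt; lra).
    apply (Rmult_le_reg_r ((/ r) ^ k * (q ^ M * (1 - q)))).
    { apply Rmult_lt_0_compat; [exact Hrk | apply Rmult_lt_0_compat; lra]. }
    apply Rle_trans with (q ^ M * (/ r) ^ M * B)%R.
    - eapply Rle_trans; [| exact Eout].
      replace (Cmod (c k) * ((/ r) ^ k * (q ^ M * (1 - q))))%R
        with (Cmod (c k) * (/ r) ^ k * (q ^ M * (1 - q)))%R by ring.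
      replace (Cmod (c k) * Rabs (q ^ k - q ^ M) * (/ r) ^ k)%R
        with (Cmod (c k) * (/ r) ^ k * Rabs (q ^ k - q ^ M))%R by ring.
      apply Rmult_le_compat_l; [| exact Hd].
      apply Rmult_le_pos; [apply Cmod_ge_0 | lra].
    - rewrite <- HAB. apply Req_le.
      replace ((/ r) ^ k)%R with ((/ r) ^ (k - M) * (/ r) ^ M)%R
        by (rewrite <- pow_add; f_equal; lia).
      assert (Hone : (r ^ (k - M) * (/ r) ^ (k - M) = 1)%R).
      { rewrite <- Rpow_mult_distr, Rinv_r, pow1 by lra. reflexivity. }
      replace (A * r ^ (k - M) * ((/ r) ^ (k - M) * (/ r) ^ M * (q ^ M * (1 - q))))%R
        with (r ^ (k - M) * (/ r) ^ (k - M) * (A * (/ r) ^ M * (q ^ M * (1 - q))))%R by ring.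
      rewrite Hone. ring. }
  exists (c M). intros X HX.
  assert (HX0 : X <> 0) by (apply Cmod_gt_0; lra).
  assert (HXM : (0 < Cmod X ^ M)%R) by (apply pow_lt; lra).
  apply (Rmult_le_reg_r (Cmod X ^ M)); [exact HXM |].
  rewrite <- Cmod_pow, <- Cmod_mult.
  replace ((Q (tt, X) - c M) * X ^ M) with (Q (tt, X) * X ^ M - c M * X ^ M) by ring.
  rewrite (Hc X HX0).
  replace (psum (fun k => c k * X ^ k) n - c M * X ^ M)
    with (psum (fun k => if Nat.eqb k M then 0 else c k * X ^ k) n).
  2:{ assert (E : psum (fun k => if Nat.eqb k M then c k * X ^ k else 0) n = c M * X ^ M).
      { rewrite (psum_single _ n M HMn); [rewrite Nat.eqb_refl; reflexivity |].
        intros l _ Hl. apply Nat.eqb_neq in Hl. rewrite Hl. reflexivity. }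
      rewrite <- E.
      rewrite (psum_ext (fun k => c k * X ^ k)
        (fun k => (if Nat.eqb k M then 0 else c k * X ^ k)
                  + (if Nat.eqb k M then c k * X ^ k else 0))).
      2:{ intros k _. destruct (Nat.eqb k M); ring. }
      rewrite psum_plus. ring. }
  rewrite Cmod_pow.
  replace (2 * A / (1 - r) * Cmod X ^ M)%R with (2 * (A * Cmod X ^ M) / (1 - r))%R
    by (field; lra).
  apply (psum_geom_two_sided _ _ r M n); [exact Hr | | lia | |].
  - apply Rmult_le_pos; lra.
  - intros k Hk. replace (Nat.eqb k M) with false by (symmetry; apply Nat.eqb_neq; lia).
    rewrite Cmod_mult, Cmod_pow.
    apply Rle_trans with (A * (q * r) ^ (M - k) * Cmod X ^ k)%R.
    + apply Rmult_le_compat_r; [apply pow_le; lra | apply Clow, Hk].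
    + rewrite Rpow_mult_distr.
      replace (Cmod X ^ M)%R with (Cmod X ^ (M - k) * Cmod X ^ k)%R
        by (rewrite <- pow_add; f_equal; lia).
      replace (A * (Cmod X ^ (M - k) * Cmod X ^ k) * r ^ (M - k))%R
        with (A * (Cmod X ^ (M - k) * r ^ (M - k)) * Cmod X ^ k)%R by ring.
      apply Rmult_le_compat_r; [apply pow_le; lra |].
      apply Rmult_le_compat_l; [exact HA |].
      apply Rmult_le_compat_r; [apply pow_le; lra |].
      apply pow_incr. lra.
  - intros k Hk. destruct (Nat.eqb_spec (M + k) M) as [E | E].
    + rewrite Cmod_0. apply Rmult_le_pos; [apply Rmult_le_pos; lra | apply pow_le; lra].
    + rewrite Cmod_mult, Cmod_pow, pow_add.
      assert (H1 := Chigh (M + k)%nat ltac:(lia)).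
      replace (M + k - M)%nat with k in H1 by lia.
      apply Rle_trans with (A * r ^ k * (Cmod X ^ M * Cmod X ^ k))%R.
      * apply Rmult_le_compat_r; [| exact H1].
        apply Rmult_le_pos; apply pow_le; lra.
      * replace (A * Cmod X ^ M * r ^ k)%R with (A * r ^ k * (Cmod X ^ M * 1))%R by ring.
        apply Rmult_le_compat_l; [apply Rmult_le_pos; [exact HA | apply pow_le; lra] |].
        apply Rmult_le_compat_l; [lra |].
        rewrite <- (pow1 k). apply pow_incr. lra.
Qed.

(** The quotient [G X / (X - q/X)] is [q]-periodic. The antisymmetry makes it, up to small
    errors on the circles [|X| = r] and [|X| = 1/r] and their images under [X -> q X], a
    Laurent polynomial, to which [almost_periodic_const] applies. The condition [q < r^2] keeps
    these circles away from the zeros of [X - q/X]. *)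
Lemma annulus_rigidity (r : R) (G : C -> C) :
  (0 < r < 1)%R -> (q < r * r)%R ->
  laurent_on (fun X => q * r <= Cmod X <= / r)%R G ->
  (forall X, (q * r <= Cmod X <= / r)%R -> G (q / X) = - G X) ->
  (forall X, Cmod X = r \/ Cmod X = (/ r)%R ->
     (q - X * X) * G (RtoC q * X) = (1 - q * (X * X)) * G X) ->
  forall X, (q <= Cmod X <= 1)%R -> G X * (1 - q) = G 1 * (X - q / X).
Proof.
  intros Hr Hqr HG Hanti Hfun X HX.
  assert (Hq0 := Cq_neq0).
  assert (Hri : (1 < / r)%R) by (rewrite <- Rinv_1; apply Rinv_lt_contravar; lra).
  assert (Hrr : (r * / r = 1)%R) by (apply Rinv_r; lra).
  set (m := (r - q / r)%R).
  assert (Hqdr : (q / r < r)%R).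
  { apply (Rmult_lt_reg_r r); [lra |]. unfold Rdiv. rewrite Rmult_assoc, Rinv_l by lra. lra. }
  assert (Hm : (0 < m)%R) by (unfold m; lra).
  assert (Hqr2 : (q * r < r)%R).
  { rewrite <- (Rmult_1_l r) at 2. apply Rmult_lt_compat_r; lra. }
  assert (Hm2 : (m <= / r - q * r)%R).
  { unfold m. assert (0 < q / r)%R by (apply Rdiv_lt_0_compat; lra).
    assert (q * r <= q / r)%R.
    { unfold Rdiv. apply Rmult_le_compat_l; lra. } lra. }
  set (C1 := (2 / m / (1 - q) * 2 / (1 - r))%R).
  assert (HC1 : (0 < C1)%R).
  { unfold C1. repeat apply Rdiv_lt_0_compat; try lra.
    apply Rmult_lt_0_compat; [repeat apply Rdiv_lt_0_compat |]; lra. }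
  assert (Hmain : forall eps, (0 < eps)%R -> exists c : C, forall Y, (q <= Cmod Y <= 1)%R ->
    (Cmod (G Y - (Y - q / Y) * c) <= (1 + 2 * C1) * eps)%R).
  { intros eps Heps. destruct (HG eps Heps) as [g [Lg Eg]].
    destruct (LP_subst_div unit_calg (fun Y => q / Y)
      (fun t => RtoC q * / snd t) (fun t => / RtoC q * snd t)) with (f := g)
      as [g' [Q0 [_ [LQ0 EQ0]]]].
    { apply LP_mult; [apply (LP_const unit_calg) | apply LP_inv]. }
    { apply LP_mult; [apply (LP_const unit_calg) | apply LP_X]. }
    { intros Y HY E. apply Hq0. replace (RtoC q) with (q / Y * Y) by (field; exact HY). rewrite E. ring. }
    { intros p Y HY. reflexivity. }
    { intros p Y HY. simpl. field. auto. }
    { exact Lg. }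
    set (Q := fun t => / 2 * Q0 t).
    assert (LQ : LP1 Q) by (apply LP_mult; [apply (LP_const unit_calg) | exact LQ0]).
    assert (HP : forall Y, (q * r <= Cmod Y <= / r)%R ->
      (Cmod (G Y - (Y - q / Y) * Q (tt, Y)) <= eps)%R).
    { intros Y HY.
      assert (Hqrp : (0 < q * r)%R) by (apply Rmult_lt_0_compat; lra).
      assert (HY0 : Y <> 0) by (apply Cmod_gt_0; lra).
      assert (HY' : (q * r <= Cmod (q / Y) <= / r)%R).
      { rewrite Cmod_qdiv by exact HY0. split.
        - apply (Rmult_le_reg_r (Cmod Y)); [lra |]. unfold Rdiv.
          rewrite (Rmult_assoc q (/ _)), Rinv_l, Rmult_assoc by lra.
          apply Rmult_le_compat_l; [lra |].
          apply Rle_trans with (r * / r)%R; [| lra]. apply Rmult_le_compat_l; lra.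
        - apply (Rmult_le_reg_r (Cmod Y)); [lra |]. unfold Rdiv.
          rewrite (Rmult_assoc q (/ _)), Rinv_l by lra.
          apply Rle_trans with (/ r * (q * r))%R; [apply Req_le; field; lra |].
          apply Rmult_le_compat_l; lra. }
      unfold Q. replace ((Y - q / Y) * (/ 2 * Q0 (tt, Y)))
        with (/ 2 * (g (tt, Y) - g (tt, (q / Y)%C)))
        by (rewrite (proj2 (EQ0 tt Y HY0)); ring).
      replace (G Y - / 2 * (g (tt, Y) - g (tt, (q / Y)%C)))
        with (/ 2 * ((G Y - g (tt, Y)) + - (G (q / Y) - g (tt, (q / Y)%C)))).
      2:{ rewrite (Hanti Y HY). field. }
      rewrite Cmod_mult, Cmod_inv, Cmod_R, Rabs_pos_eq
        by (try lra; intros E; apply RtoC_inj in E; lra).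
      assert (H1 := Eg (tt, Y) (conj I HY)). assert (H2 := Eg (tt, (q / Y)%C) (conj I HY')).
      simpl in H1, H2.
      generalize (Cmod_triangle (G Y - g (tt, Y)) (- (G (q / Y) - g (tt, (q / Y)%C)))).
      rewrite Cmod_opp. lra. }
    destruct (almost_periodic_const r (2 / m * eps) Q Hr LQ) as [c Hc].
    { intros Y HY.
      assert (HYp : (0 < Cmod Y)%R) by (destruct HY; lra).
      assert (HY0 : Y <> 0) by (apply Cmod_gt_0; lra).
      assert (HqY : Cmod (RtoC q * Y) = (q * Cmod Y)%R)
        by (rewrite Cmod_mult, Cmod_R, Rabs_pos_eq; lra).
      assert (Hin : (q * r <= Cmod Y <= / r)%R) by (destruct HY as [E | E]; rewrite E; lra).
      assert (Hin' : (q * r <= Cmod (RtoC q * Y) <= / r)%R).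
      { rewrite HqY. assert (q * / r <= 1 * / r)%R by (apply Rmult_le_compat_r; lra).
        destruct HY as [E | E]; rewrite E; split; try lra.
        apply Rmult_le_compat_l; lra. }
      set (D1 := Y - q / Y). set (D2 := RtoC q * Y - / Y).
      assert (HD1 : (m <= Cmod D1)%R).
      { generalize (Cmod_le_plus Y (q / Y)) (Cmod_le_plus (q / Y) Y).
        rewrite (Cmod_minus_sym (q / Y) Y), Cmod_qdiv by exact HY0. fold D1.
        destruct HY as [E | E]; rewrite E; unfold m in *; [lra |].
        replace (q / / r)%R with (q * r)%R by (field; lra). lra. }
      assert (HD2 : (m <= Cmod D2)%R).
      { generalize (Cmod_le_plus (RtoC q * Y) (/ Y)) (Cmod_le_plus (/ Y) (RtoC q * Y)).
        rewrite (Cmod_minus_sym (/ Y)), HqY, Cmod_inv by exact HY0. fold D2.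
        destruct HY as [E | E]; rewrite E; unfold m in *; [lra |].
        rewrite Rinv_inv. unfold Rdiv in *. lra. }
      assert (HD : G (RtoC q * Y) * D1 = D2 * G Y).
      { assert (H := Hfun Y HY). unfold D1, D2.
        replace (G (RtoC q * Y) * (Y - q / Y))
          with (- / Y * ((q - Y * Y) * G (RtoC q * Y))) by (field; exact HY0).
        rewrite H. field. exact HY0. }
      assert (H1 := HP Y Hin). assert (H2 := HP (RtoC q * Y) Hin'). fold D1 in H1.
      replace (RtoC q * Y - q / (RtoC q * Y)) with D2 in H2 by (unfold D2; field; auto).
      assert (HD1n : D1 <> 0) by (apply Cmod_gt_0; lra).
      assert (HD2n : D2 <> 0) by (apply Cmod_gt_0; lra).
      replace (Q (tt, (RtoC q * Y)%C) - Q (tt, Y))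
        with ((G Y - D1 * Q (tt, Y)) * / D1
              + - ((G (RtoC q * Y) - D2 * Q (tt, (RtoC q * Y)%C)) * / D2)).
      2:{ replace (G (RtoC q * Y)) with (D2 * G Y / D1) by (rewrite <- HD; field; exact HD1n).
          field. auto. }
      eapply Rle_trans; [apply Cmod_triangle |].
      rewrite Cmod_opp, !Cmod_mult, !Cmod_inv by assumption.
      assert (Hk1 : (/ Cmod D1 <= / m)%R) by (apply Rinv_le_contravar; lra).
      assert (Hk2 : (/ Cmod D2 <= / m)%R) by (apply Rinv_le_contravar; lra).
      replace (2 / m * eps)%R with (eps * / m + eps * / m)%R by (field; lra).
      apply Rplus_le_compat; apply Rmult_le_compat;
        try apply Cmod_ge_0; try assumption; left; apply Rinv_0_lt_compat; lra. }
    exists c. intros Y HY.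
    assert (HY0 : Y <> 0) by (apply Cmod_gt_0; lra).
    assert (Hin : (q * r <= Cmod Y <= / r)%R).
    { split; [| lra]. apply Rle_trans with (q * 1)%R; [apply Rmult_le_compat_l; lra | lra]. }
    replace (G Y - (Y - q / Y) * c)
      with ((G Y - (Y - q / Y) * Q (tt, Y)) + (Y - q / Y) * (Q (tt, Y) - c)) by ring.
    eapply Rle_trans; [apply Cmod_triangle |].
    assert (H1 := HP Y Hin). assert (H2 := Hc Y HY).
    assert (H3 : (Cmod (Y - q / Y) <= 2)%R).
    { eapply Rle_trans; [apply Cmod_triangle |]. rewrite Cmod_opp, Cmod_qdiv by exact HY0.
      assert (q / Cmod Y <= 1)%R; [| lra].
      apply (Rmult_le_reg_r (Cmod Y)); [lra |]. unfold Rdiv.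
      rewrite Rmult_assoc, Rinv_l; lra. }
    assert (H4 := Cmod_mult_le _ _ _ _ H3 H2).
    replace ((1 + 2 * C1) * eps)%R
      with (eps + 2 * (2 * (2 / m * eps / (1 - q)) / (1 - r)))%R
      by (unfold C1; field; lra).
    lra. }
  apply Cminus_eq_0. apply (Cmod_small_eq0 _ (3 * (1 + 2 * C1))).
  intros eps Heps. destruct (Hmain eps Heps) as [c Hc].
  assert (HX0 : X <> 0) by (apply Cmod_gt_0; lra).
  assert (H1 := Hc X HX). assert (H2 := Hc 1 ltac:(rewrite Cmod_1; lra)).
  replace (1 - q / 1) with (RtoC (1 - q)) in H2 by (rewrite RtoC_minus; field; apply C1_nz).
  replace (G X * (1 - q) - G 1 * (X - q / X))
    with ((G X - (X - q / X) * c) * RtoC (1 - q)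
          + - ((G 1 - RtoC (1 - q) * c) * (X - q / X)))
    by (rewrite RtoC_minus; ring).
  eapply Rle_trans; [apply Cmod_triangle |]. rewrite Cmod_opp.
  assert (H3 : (Cmod (X - q / X) <= 2)%R).
  { eapply Rle_trans; [apply Cmod_triangle |]. rewrite Cmod_opp, Cmod_qdiv by exact HX0.
    assert (q / Cmod X <= 1)%R; [| lra].
    apply (Rmult_le_reg_r (Cmod X)); [lra |]. unfold Rdiv.
    rewrite Rmult_assoc, Rinv_l; lra. }
  assert (H4 : (Cmod (RtoC (1 - q)) <= 1)%R) by (rewrite Cmod_R, Rabs_pos_eq; lra).
  assert (H5 := Cmod_mult_le _ _ _ _ H1 H4). assert (H6 := Cmod_mult_le _ _ _ _ H2 H3).
  lra.
Qed.

Lemma laurent_continuous (D : C -> Prop) (G : C -> C) (X0 : C) :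
  laurent_on D G -> X0 <> 0 -> locally (T := C_UniformSpace) X0 D ->
  clim (locally (T := C_UniformSpace) X0) G (G X0).
Proof.
  intros HG HX0 HD eps Heps.
  assert (He : (0 < eps / 4)%R) by lra.
  destruct (HG _ He) as [g [Lg Eg]].
  assert (Hg : clim (locally (T := C_UniformSpace) X0) (fun X => g (tt, X)) (g (tt, X0))).
  { assert (Hid : clim (locally (T := C_UniformSpace) X0) (fun X => X) X0)
      by (apply clim_filterlim; [apply locally_filter | apply filterlim_id]).
    clear Eg. induction Lg as [c _ | | | f h _ IHf _ IHh | f h _ IHf _ IHh]; simpl.
    - apply clim_const. apply locally_filter.
    - exact Hid.
    - apply clim_inv; [apply locally_filter | exact Hid | exact HX0].
    - apply clim_plus; [apply locally_filter | exact IHf | exact IHh].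
    - apply clim_mult; [apply locally_filter | exact IHf | exact IHh]. }
  assert (HX0D := locally_singleton _ _ HD).
  assert (Hk : forall X : C, D X -> (Cmod (g (tt, X) - g (tt, X0)) < eps / 4)%R ->
    (Cmod (G X - G X0) < eps)%R).
  { intros X HX H.
    assert (H1 := Eg (tt, X) (conj I HX)). assert (H2 := Eg (tt, X0) (conj I HX0D)).
    simpl in H1, H2.
    generalize (Cmod_tri3 (G X) (g (tt, X)) (G X0)) (Cmod_tri3 (g (tt, X)) (g (tt, X0)) (G X0)).
    rewrite (Cmod_minus_sym (g (tt, X0)) (G X0)). lra. }
  generalize (filter_and _ _ HD (Hg _ He)). apply filter_imp. intros X [HX H].
  apply Hk; assumption.
Qed.

(** * The nonterminating q-Saalschuetz sum *)

Lemma Cmod_q_lt1 : (Cmod (RtoC q) < 1)%R.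
Proof. rewrite Cmod_R, Rabs_pos_eq; lra. Qed.

Lemma clim_xqn (x : C) : clim eventually (fun n => x * RtoC q ^ n) 0.
Proof.
  replace (RtoC 0) with (x * 0) by ring.
  apply (clim_mult eventually); [apply (clim_const eventually) |].
  apply clim_pow_0, Cmod_q_lt1.
Qed.

Lemma clim_qinf_shift (x : C) : clim eventually (fun n => qinf (x * RtoC q ^ n)) 1.
Proof.
  rewrite <- qpoch_inf_0.
  apply (clim_qpoch_inf eventually (fun n => x * RtoC q ^ n)), clim_xqn.
Qed.

Lemma qinf_step (x : C) (n : nat) :
  qinf (x * RtoC q ^ n) = (1 - x * RtoC q ^ n) * qinf (x * RtoC q ^ S n).
Proof.
  rewrite qpoch_inf_S. f_equal. f_equal. rewrite Cpow_S. ring.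
Qed.

Lemma qinf_q_neq0 : qinf (RtoC q) <> 0.
Proof. apply qpoch_inf_small_neq0, Cmod_q_lt1. Qed.

Lemma C1mq_neq0 : 1 - RtoC q <> 0.
Proof.
  intros E. apply Cminus_eq_0 in E. symmetry in E. apply RtoC_inj in E. lra.
Qed.

Lemma qser_const (c : C) : qser (fun _ => c) = c / (1 - q).
Proof.
  destruct (qser_clim_rate (fun _ => c) (Cmod c)) as [H _]; [intros; lra |].
  apply (clim_unique eventually _ _ _ H).
  assert (Hn := C1mq_neq0).
  apply (clim_ext eventually (fun n => c / (1 - q) * (1 - RtoC q ^ n))).
  - intros n. unfold qpsum. rewrite <- psum_geom.
    rewrite (psum_ext (fun n0 => RtoC q ^ n0 * c) (fun n0 => c * RtoC q ^ n0))
      by (intros; ring).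
    rewrite (psum_scal c (fun k => RtoC q ^ k)). field. exact Hn.
  - assert (L : clim eventually (fun n => c / (1 - q) * (1 - RtoC q ^ n)) (c / (1 - q) * (1 - 0)));
      [| replace (c / (1 - q) * (1 - 0)) with (c / (1 - q)) in L by ring; exact L].
    apply (clim_mult eventually); [apply (clim_const eventually) |].
    apply (clim_minus eventually); [apply (clim_const eventually) |].
    apply clim_pow_0, Cmod_q_lt1.
Qed.

(** One of the two series, multiplied by what clears its denominators and makes the other
    one its image under [s -> e s], [e -> 1/e]. *)
Definition saal_half (s1 s2 s3 e : C) : C :=
  qinf (e * s1) * qinf (e * s2) * qinf (e * s3)
  * Sg s1 s2 s3 0 (e * s1 * s2 * s3) 0 (q / e).

Definition saal (s1 s2 s3 e : C) : C :=
  saal_half s1 s2 s3 e - e * saal_half (e * s1) (e * s2) (e * s3) (/ e).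

Lemma qpoch_0 (n : nat) : qpoch q 0 n = 1.
Proof. induction n as [|n IH]; simpl; [reflexivity | rewrite IH; ring]. Qed.

Lemma saal_Phi (s1 s2 s3 e : C) :
  e <> 0 -> saal s1 s2 s3 e = Phi s1 s2 s3 0 (e * s1 * s2 * s3) 0 e.
Proof.
  intros He. unfold saal, saal_half, Phi.
  rewrite Cmult_0_r, qpoch_inf_0.
  replace (/ e * (e * s1)) with s1 by (field; exact He).
  replace (/ e * (e * s2)) with s2 by (field; exact He).
  replace (/ e * (e * s3)) with s3 by (field; exact He).
  replace (s1 * (e * s2) * (e * s3)) with (e * (e * s1 * s2 * s3)) by ring.
  replace (q / / e) with (q * e) by (field; exact He).
  ring.
Qed.

(** The partial sums of the difference have the closed form [H n] below, found by writing the
    terms as a difference; the right-hand side is its limit. *)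
Lemma saal_half_step (s1 s2 s3 e : C) :
  e <> 0 ->
  (1 - e * s1 * s2) * (1 - e * s1 * s3) * saal_half (q * s1) s2 s3 e - saal_half s1 s2 s3 e
  = e * s1 * (qinf (q * s1) * qinf s2 * qinf s3
              * (qinf (e * (q * s1)) * qinf (e * s2) * qinf (e * s3))).
Proof.
  intros He. set (be := e * s1 * s2 * s3).
  set (k := qinf (e * (q * s1)) * qinf (e * s2) * qinf (e * s3)).
  set (H := fun n => e * s1 * k * (qpoch q (q * s1) n * qpoch q s2 (S n) * qpoch q s3 (S n)
      * (qinf (1 * RtoC q ^ S n) * qinf (/ e * RtoC q ^ S n) * qinf (be * RtoC q ^ S n)))).
  set (f1 := sg_term (q * s1) s2 s3 0 (e * (q * s1) * s2 * s3) 0 (q / e)).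
  set (f0 := sg_term s1 s2 s3 0 be 0 (q / e)).
  set (c := (1 - e * s1 * s2) * (1 - e * s1 * s3)).
  assert (E : forall n, c * (k * qpsum f1 (S n))
                  - (1 - e * s1) * (k * qpsum f0 (S n)) = H n).
  { assert (Z0 : forall n, qinf (0 * RtoC q ^ n) = 1)
      by (intros n; rewrite Cmult_0_l; apply qpoch_inf_0).
    assert (X1 : forall n, RtoC q * RtoC q ^ n = 1 * RtoC q ^ S n)
      by (intros; rewrite Cpow_S; ring).
    assert (X2 : forall n, q / e * RtoC q ^ n = / e * RtoC q ^ S n)
      by (intros; rewrite Cpow_S; field; exact He).
    assert (X3 : forall n, e * (q * s1) * s2 * s3 * RtoC q ^ n = be * RtoC q ^ S n)
      by (intros; unfold be; rewrite Cpow_S; ring).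
    assert (D : forall n, c * f1 n - (1 - e * s1) * f0 n = 
        qpoch q s2 n * qpoch q s3 n
        * (qinf (1 * RtoC q ^ S n) * qinf (/ e * RtoC q ^ S n) * qinf (be * RtoC q ^ S n))
        * (c * qpoch q (q * s1) n
           - (1 - e * s1) * (1 - be * RtoC q ^ n) * qpoch q s1 n)).
    { intros n. unfold f1, f0, sg_term. rewrite Z0, qpoch_0, X1, X2, X3, (qinf_step be n). ring. }
    induction n as [|n IH].
    - unfold qpsum. simpl psum. 
      transitivity (k * (c * f1 O - (1 - e * s1) * f0 O)); [simpl; ring |].
      rewrite D. unfold H, c, be. simpl. field; exact He.
    - unfold qpsum in *.
      change (psum (fun n0 => RtoC q ^ n0 * f1 n0) (S (S n)))
        with (psum (fun n0 => RtoC q ^ n0 * f1 n0) (S n) + RtoC q ^ S n * f1 (S n)).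
      change (psum (fun n0 => RtoC q ^ n0 * f0 n0) (S (S n)))
        with (psum (fun n0 => RtoC q ^ n0 * f0 n0) (S n) + RtoC q ^ S n * f0 (S n)).
      replace (c * (k * (psum (fun n0 => RtoC q ^ n0 * f1 n0) (S n) + RtoC q ^ S n * f1 (S n))) -
        (1 - e * s1) * (k * (psum (fun n0 => RtoC q ^ n0 * f0 n0) (S n) + RtoC q ^ S n * f0 (S n))))
        with ((c * (k * psum (fun n0 => RtoC q ^ n0 * f1 n0) (S n))
               - (1 - e * s1) * (k * psum (fun n0 => RtoC q ^ n0 * f0 n0) (S n)))
              + k * RtoC q ^ S n * (c * f1 (S n) - (1 - e * s1) * f0 (S n))) by ring.
      rewrite IH, D. unfold H.
      rewrite (qinf_step 1 (S n)), (qinf_step (/ e) (S n)), (qinf_step be (S n)).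
      rewrite (qpoch_S_l s1 n). replace (s1 * q) with (q * s1) by ring.
      change (qpoch q (q * s1) (S n)) with (qpoch q (q * s1) n * (1 - q * s1 * RtoC q ^ n)).
      change (qpoch q s2 (S (S n))) with (qpoch q s2 (S n) * (1 - s2 * RtoC q ^ S n)).
      change (qpoch q s3 (S (S n))) with (qpoch q s3 (S n) * (1 - s3 * RtoC q ^ S n)).
      replace (q * s1 * RtoC q ^ n) with (s1 * RtoC q ^ S n) by (rewrite Cpow_S; ring).
      generalize (RtoC q ^ S n). intros t. unfold c, be.
      generalize (qinf (1 * RtoC q ^ S (S n))) (qinf (/ e * RtoC q ^ S (S n)))
        (qinf (e * s1 * s2 * s3 * RtoC q ^ S (S n))). intros. field. exact He. }
  assert (L1 := Sg_clim (q * s1) s2 s3 0 (e * (q * s1) * s2 * s3) 0 (q / e)).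
  assert (L0 := Sg_clim s1 s2 s3 0 be 0 (q / e)).
  fold f1 in L1. fold f0 in L0.
  assert (LH : clim eventually H (e * s1 * k * (qinf (q * s1) * qinf s2 * qinf s3 * (1 * 1 * 1)))).
  { unfold H.
    assert (S1 : forall u l, clim eventually u l -> clim eventually (fun n => u (S n)) l)
      by (intros u l Hu; apply (clim_seq_shift u l 1 Hu)).
    apply (clim_mult eventually); [apply (clim_const eventually) |].
    repeat apply (clim_mult eventually).
    - apply qpoch_clim.
    - apply (S1 (qpoch q s2)), qpoch_clim.
    - apply (S1 (qpoch q s3)), qpoch_clim.
    - apply (S1 (fun n => qinf (1 * RtoC q ^ n))), clim_qinf_shift.
    - apply (S1 (fun n => qinf (/ e * RtoC q ^ n))), clim_qinf_shift.
    - apply (S1 (fun n => qinf (be * RtoC q ^ n))), clim_qinf_shift. }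
  unfold saal_half. fold be.
  replace (qinf (e * s1)) with ((1 - e * s1) * qinf (e * (q * s1))).
  2:{ rewrite (qpoch_inf_S (e * s1)). do 2 f_equal. ring. }
  transitivity (c * (k * Sg (q * s1) s2 s3 0 (e * (q * s1) * s2 * s3) 0 (q / e))
                - (1 - e * s1) * (k * Sg s1 s2 s3 0 be 0 (q / e))).
  { unfold c, k. ring. }
  transitivity (e * s1 * k * (qinf (q * s1) * qinf s2 * qinf s3 * (1 * 1 * 1))).
  2:{ unfold k. ring. }
  apply (clim_unique eventually H); [| exact LH].
  apply (clim_ext eventually _ H _ E).
  apply (clim_minus eventually); repeat (apply (clim_mult eventually);
    [apply (clim_const eventually) |]).
  - apply (clim_seq_shift _ _ 1 L1).
  - apply (clim_seq_shift _ _ 1 L0).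
Qed.

(** The boundary terms of the two halves agree, so they cancel. *)
Lemma saal_step (s1 s2 s3 e : C) :
  e <> 0 ->
  saal s1 s2 s3 e = (1 - e * s1 * s2) * (1 - e * s1 * s3) * saal (s1 * q) s2 s3 e.
Proof.
  intros He.
  assert (Hi : / e <> 0).
  { intros E. apply C1_nz. rewrite <- (Cinv_l e He), E. ring. }
  assert (A := saal_half_step s1 s2 s3 e He).
  assert (B := saal_half_step (e * s1) (e * s2) (e * s3) (/ e) Hi).
  replace (/ e * (e * s1)) with s1 in B by (field; exact He).
  replace (/ e * (q * (e * s1))) with (q * s1) in B by (field; exact He).
  replace (/ e * (e * s2)) with s2 in B by (field; exact He).
  replace (/ e * (e * s3)) with s3 in B by (field; exact He).
  replace (s1 * (e * s2)) with (e * s1 * s2) in B by ring.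
  replace (s1 * (e * s3)) with (e * s1 * s3) in B by ring.
  replace (q * (e * s1)) with (e * (q * s1)) in B by ring.
  unfold saal. replace (s1 * q) with (q * s1) by ring.
  replace (saal_half s1 s2 s3 e) with
    ((1 - e * s1 * s2) * (1 - e * s1 * s3) * saal_half (q * s1) s2 s3 e
     - e * s1 * (qinf (q * s1) * qinf s2 * qinf s3
              * (qinf (e * (q * s1)) * qinf (e * s2) * qinf (e * s3)))) by (rewrite <- A; ring).
  replace (saal_half (e * s1) (e * s2) (e * s3) (/ e)) with
    ((1 - e * s1 * s2) * (1 - e * s1 * s3) * saal_half (e * (q * s1)) (e * s2) (e * s3) (/ e)
     - s1 * (qinf (e * (q * s1)) * qinf (e * s2) * qinf (e * s3)
              * (qinf (q * s1) * qinf s2 * qinf s3))) by (rewrite <- B; ring).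
  ring.
Qed.

Lemma saal_swap12 (s1 s2 s3 e : C) : saal s1 s2 s3 e = saal s2 s1 s3 e.
Proof.
  assert (H : forall s1 s2 s3 e, saal_half s1 s2 s3 e = saal_half s2 s1 s3 e).
  { clear. intros s1 s2 s3 e. unfold saal_half, Sg.
    replace (sg_term s2 s1 s3 0 (e * s2 * s1 * s3) 0 (q / e))
      with (sg_term s1 s2 s3 0 (e * s1 * s2 * s3) 0 (q / e)); [ring |].
    apply functional_extensionality. intros n. unfold sg_term.
    replace (e * s2 * s1 * s3) with (e * s1 * s2 * s3) by ring. ring. }
  unfold saal. rewrite (H s1), (H (e * s1)). reflexivity.
Qed.

Lemma saal_swap13 (s1 s2 s3 e : C) : saal s1 s2 s3 e = saal s3 s2 s1 e.
Proof.
  assert (H : forall s1 s2 s3 e, saal_half s1 s2 s3 e = saal_half s3 s2 s1 e).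
  { clear. intros s1 s2 s3 e. unfold saal_half, Sg.
    replace (sg_term s3 s2 s1 0 (e * s3 * s2 * s1) 0 (q / e))
      with (sg_term s1 s2 s3 0 (e * s1 * s2 * s3) 0 (q / e)); [ring |].
    apply functional_extensionality. intros n. unfold sg_term.
    replace (e * s3 * s2 * s1) with (e * s1 * s2 * s3) by ring. ring. }
  unfold saal. rewrite (H s1), (H (e * s1)). reflexivity.
Qed.

(** Iterating [saal_step] replaces [s1] by [s1 q^n], which tends to [0]. *)
Lemma saal_to_0 (s1 s2 s3 e : C) :
  e <> 0 -> saal s1 s2 s3 e = qinf (e * s1 * s2) * qinf (e * s1 * s3) * saal 0 s2 s3 e.
Proof.
  intros He.
  assert (E : forall n, qpoch q (e * s1 * s2) n * qpoch q (e * s1 * s3) n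
                * saal (s1 * RtoC q ^ n) s2 s3 e = saal s1 s2 s3 e).
  { induction n as [|n IH].
    - replace (s1 * RtoC q ^ 0) with s1 by (simpl; ring). simpl qpoch. ring.
    - rewrite <- IH, (saal_step (s1 * RtoC q ^ n) s2 s3 e He). simpl qpoch.
      replace (s1 * RtoC q ^ n * q) with (s1 * RtoC q ^ S n) by (rewrite Cpow_S; ring).
      ring. }
  apply (clim_unique eventually (fun n : nat => saal s1 s2 s3 e));
    [apply (clim_const eventually) |].
  apply (clim_ext eventually _ _ _ E).
  apply (clim_mult eventually);
    [apply (clim_mult eventually); apply qpoch_clim |].
  rewrite saal_Phi by exact He.
  apply (clim_ext eventually (fun n => Phi (s1 * RtoC q ^ n) s2 s3 0
    (e * (s1 * RtoC q ^ n) * s2 * s3) 0 e)).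
  { intros n. symmetry. apply saal_Phi, He. }
  assert (Hx := clim_xqn s1). assert (Hc := clim_const eventually).
  apply (clim_Phi eventually); try apply Hc; try assumption.
  repeat apply (clim_mult eventually); try apply Hc; assumption.
Qed.

Lemma saal_reduce (s1 s2 s3 e : C) :
  e <> 0 ->
  saal s1 s2 s3 e = qinf (e * s1 * s2) * qinf (e * s1 * s3) * qinf (e * s2 * s3)
                    * saal 0 0 0 e.
Proof.
  intros He. rewrite (saal_to_0 s1) by exact He.
  rewrite (saal_swap12 0 s2 s3), (saal_to_0 s2) by exact He.
  rewrite (saal_swap13 0 0 s3), (saal_to_0 s3) by exact He.
  rewrite !Cmult_0_r, qpoch_inf_0. ring.
Qed.

(** By [saal_reduce] only [saal 0 0 0 e] is unknown. It follows from the case [s1 = q],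
    [s2 = q/e], [s3 = 0], in which both series are geometric. *)
Lemma q_saalschuetz (s1 s2 s3 e : C) :
  e <> 0 ->
  saal s1 s2 s3 e = qinf q * qinf e * qinf (q / e)
    * (qinf (e * s1 * s2) * qinf (e * s1 * s3) * qinf (e * s2 * s3)).
Proof.
  intros He.
  assert (Hspec : saal q (q / e) 0 e = qinf e * qinf q * qinf q * qinf (q / e) / (1 - q)).
  { assert (Hp : forall x n, qpoch q x n * qinf (x * RtoC q ^ n) = qinf x)
      by (intros x n; symmetry; apply qpoch_inf_split).
    assert (Hh : forall e' : C, e' <> 0 ->
      Sg q (q / e') 0 0 (e' * q * (q / e') * 0) 0 (q / e') = qinf q * qinf (q / e') / (1 - q)).
    { intros e' He'. unfold Sg. rewrite <- qser_const. f_equal.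
      apply functional_extensionality. intros n. unfold sg_term.
      rewrite Cmult_0_r, Cmult_0_l, qpoch_0, qpoch_inf_0.
      rewrite <- (Hp q n), <- (Hp (q / e') n). ring. }
    unfold saal, saal_half. rewrite (Hh e He).
    assert (Hi : / e <> 0).
    { intros E. apply C1_nz. rewrite <- (Cinv_l e He), E. ring. }
    assert (H2 := Hh (/ e) Hi).
    replace (q / / e) with (e * q) in H2 |- * by (field; exact He).
    replace (/ e * (e * q)) with (RtoC q) by (field; exact He).
    replace (e * (q / e)) with (RtoC q) by (field; exact He).
    replace (/ e * q) with (q / e) by (field; exact He).
    rewrite !Cmult_0_r, qpoch_inf_0. rewrite Cmult_0_r in H2.
    assert (Hsw : Sg (e * q) q 0 0 0 0 (e * q) = Sg q (e * q) 0 0 0 0 (e * q)).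
    { unfold Sg. f_equal. apply functional_extensionality. intros n. unfold sg_term. ring. }
    rewrite Hsw, H2, (qpoch_inf_S e).
    replace (e * q) with (e * RtoC q) by ring.
    field. apply C1mq_neq0. }
  rewrite saal_reduce in Hspec |- * by exact He.
  replace (e * q * (q / e)) with (RtoC q * q) in Hspec by (field; exact He).
  rewrite !Cmult_0_r, qpoch_inf_0, !Cmult_1_r in Hspec.
  assert (Hq := qpoch_inf_S q).
  assert (H0 : saal 0 0 0 e = qinf q * qinf e * qinf (q / e)).
  { assert (Hn : qinf (q * q) <> 0).
    { intros E. apply qinf_q_neq0. rewrite Hq, E. ring. }
    replace (saal 0 0 0 e) with (qinf (q * q) * saal 0 0 0 e / qinf (q * q)) by (field; exact Hn).
    rewrite Hspec, Hq. field. split; [apply C1mq_neq0 | exact Hn]. }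
  rewrite H0. ring.
Qed.

(* Closes the side conditions of [field] that agree up to sign with a hypothesis. *)
Ltac nz :=
  repeat split; try assumption;
  let E := fresh "E" in
  intros E;
  match type of E with ?P = _ =>
    match goal with H : ?u <> _ |- _ =>
      apply H; first [ transitivity P; [ring | exact E]
                     | transitivity (- P); [ring | rewrite E; ring] ]
    end
  end.

(** * The second-order q-difference equation *)

Section DifferenceEquation.

(** The numerator of [u], with [N = q^nu] and [X = q^z]; the denominator is
    [Uden a b c d X * (q/(ad); q)_oo], see [u_formula_Phi]. *)
Definition PhiU (a b c d N X : C) : C :=
  Phi (/ N) (a * b * c * d * N / q) (a * X) (a / X) (a * b) (a * c) (q / (a * d)).

Definition eqB (b c d X : C) : C :=
  (1 - b * X) * (1 - c * X) * (1 - d * X) / ((1 - X * X) * (1 - q * (X * X))).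

(** The coefficients of the Askey-Wilson equation
    [A(X) (u(qX) - u(X)) + A(1/X) (u(X/q) - u(X)) = (1/N - 1) (1 - abcdN/q) u(X)]. *)
Definition eqA (a b c d X : C) : C := (1 - a * X) * eqB b c d X.

Definition eqK (a b c d N X : C) : C :=
  eqA a b c d X + eqA a b c d (/ X) + (/ N - 1) * (1 - a * b * c * d * N / q).

Context (a b c d N X : C) (ha : a <> 0) (hd : d <> 0) (hN : N <> 0) (hX : X <> 0)
  (hX1 : 1 - X * X <> 0) (hX2 : 1 - q * (X * X) <> 0) (hX3 : q - X * X <> 0).
Let s1 : C := / N.
Let s2 : C := a * b * c * d * N / q.
Let x : C := a * X.
Let y : C := a / X.
Let e : C := q / (a * d).
Let B : C := eqB b c d X.
Let B' : C := eqB b c d (/ X).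
Let kap : C := eqK a b c d N X.

(** The action of the difference operator on the basis function
    [phi_t(X) = (a X, a / X; q)_oo / (a t X, a t / X; q)_oo], divided by [phi_(t/q)(X)], at [t = q p].
    The first product on the right is the eigenvalue part, the second one the coefficient
    of [phi_(t/q)]; it vanishes at [t = 1] and at [t = q/(ad)], where the two series start. *)
Lemma basis_identity (p : C) :
  q * p * (B * ((1 - x * p) * (1 - x * (q * p)) * (1 - y / q))
           + B' * ((1 - y * p) * (1 - y * (q * p)) * (1 - x / q))
           - kap * ((1 - x * p) * (1 - y * p)))
  = (1 - s1 * (q * p)) * (1 - s2 * (q * p)) * ((1 - x * p) * (1 - y * p))
    - (1 - q * p) * (1 - a * b * p) * (1 - a * c * p) * (1 - a * d * p).
Proof.
  unfold B, B', kap, eqK, eqA, eqB, x, y, s1, s2. field. nz.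
Qed.

(** The case [t = e] of [basis_identity] divided by a product that may vanish. *)
Lemma basis_identity_e :
  e * (eqB b c 0 X * (X * (q * X - d)) * (1 - y / q)
       + eqB b c 0 (/ X) * (/ X * (q / X - d)) * (1 - x / q) - kap)
  = (1 - s1 * e) * (1 - s2 * e).
Proof.
  unfold kap, eqK, eqA, eqB, x, y, s1, s2, e. field. nz.
Qed.

Lemma qpoch_up (z : C) (n : nat) :
  (1 - z) * qpoch q (q * z) (S n)
  = qpoch q z n * (1 - z * RtoC q ^ n) * (1 - z * (q * RtoC q ^ n)).
Proof.
  replace (q * z) with (z * q) by ring. rewrite <- qpoch_S_l.
  simpl. reflexivity.
Qed.

Lemma qpoch_down (z : C) (n : nat) :
  qpoch q (z / q) (S n) = (1 - z / q) * qpoch q z n.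
Proof.
  rewrite qpoch_S_l. do 2 f_equal. field. exact hq.
Qed.

Let W (b1 b2 b3 : C) (n : nat) : C :=
  qinf (RtoC q * RtoC q ^ n) * qinf (b1 * RtoC q ^ n) * qinf (b2 * RtoC q ^ n)
  * qinf (b3 * RtoC q ^ n).

Lemma W_step (b1 b2 b3 : C) (n : nat) :
  W b1 b2 b3 n = (1 - q * RtoC q ^ n) * (1 - b1 * RtoC q ^ n) * (1 - b2 * RtoC q ^ n)
                 * (1 - b3 * RtoC q ^ n) * W b1 b2 b3 (S n).
Proof.
  unfold W. rewrite (qinf_step q n), (qinf_step b1 n),
    (qinf_step b2 n), (qinf_step b3 n). ring.
Qed.

Lemma W_clim (b1 b2 b3 : C) : clim eventually (W b1 b2 b3) 1.
Proof.
  replace (RtoC 1) with (1 * 1 * 1 * 1) by ring. unfold W.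
  repeat apply (clim_mult eventually); apply clim_qinf_shift.
Qed.

Lemma qpsum_S (f : nat -> C) (n : nat) : qpsum f (S n) = qpsum f n + RtoC q ^ n * f n.
Proof. reflexivity. Qed.

Lemma clim_succ (u : nat -> C) (l : C) :
  clim eventually u l -> clim eventually (fun n => u (S n)) l.
Proof. apply (clim_seq_shift u l 1). Qed.

(** The difference operator applied to a series over the lattice [t = z q^n], for [z = 1]
    and for [z = q/(ad)]: by [basis_identity] the partial sums telescope, and only the
    boundary term at infinity is left. It is the same for both lattices up to the factors by
    which the two series are combined, so it cancels in [difference_equation]. *)
Lemma series_equation (z b3 c1 c2 : C) :
  (forall n : nat, (1 - q * RtoC q ^ n) * (1 - b3 * RtoC q ^ n)
     = (1 - q * (z * RtoC q ^ n)) * (1 - a * d * (z * RtoC q ^ n))) ->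
  c1 * (1 - z * y / q) = B * (1 - y / q) * (1 - z * x) ->
  c2 * (1 - z * x / q) = B' * (1 - x / q) * (1 - z * y) ->
  z * (c1 + c2 - kap) = (1 - s1 * z) * (1 - s2 * z) ->
  z * (c1 * Sg (z * s1) (z * s2) (q * (z * x)) (z * y / q) (z * (a * b)) (z * (a * c)) b3
       + c2 * Sg (z * s1) (z * s2) (z * x / q) (q * (z * y)) (z * (a * b)) (z * (a * c)) b3
       - kap * Sg (z * s1) (z * s2) (z * x) (z * y) (z * (a * b)) (z * (a * c)) b3)
  = qinf (z * s1) * qinf (z * s2) * qinf (z * x) * qinf (z * y).
Proof.
  intros Hlat E1 E2 E0.
  set (f := fun x y => sg_term (z * s1) (z * s2) x y (z * (a * b)) (z * (a * c)) b3).
  set (w := W (z * (a * b)) (z * (a * c)) b3).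
  set (G := fun n => qpoch q (z * s1) (S n) * qpoch q (z * s2) (S n)
                     * qpoch q (z * x) n * qpoch q (z * y) n * w n).
  assert (E : forall n, z * (c1 * qpsum (f (q * (z * x)) (z * y / q)) (S n)
                + c2 * qpsum (f (z * x / q) (q * (z * y))) (S n)
                - kap * qpsum (f (z * x) (z * y)) (S n)) = G n).
  { induction n as [|n IH].
    - rewrite !qpsum_S. unfold qpsum. simpl psum. unfold f, sg_term, G.
      transitivity (z * (c1 + c2 - kap) * w O); [unfold w, W; simpl; ring |].
      rewrite E0. simpl. ring.
    - rewrite (qpsum_S (f (q * (z * x)) (z * y / q)) (S n)),
        (qpsum_S (f (z * x / q) (q * (z * y))) (S n)), (qpsum_S (f (z * x) (z * y)) (S n)).
      match goal with |- ?L = _ =>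
        transitivity (G n + z * RtoC q ^ S n * (c1 * f (q * (z * x)) (z * y / q) (S n)
          + c2 * f (z * x / q) (q * (z * y)) (S n) - kap * f (z * x) (z * y) (S n)));
        [rewrite <- IH; ring |]
      end.
      assert (F : forall x y, f x y (S n) = qpoch q (z * s1) (S n) * qpoch q (z * s2) (S n)
                * w (S n) * (qpoch q x (S n) * qpoch q y (S n)))
        by (intros; unfold f, sg_term, w, W; ring).
      rewrite !F. unfold G.
      set (p := z * RtoC q ^ n).
      assert (Hw : w n = (1 - q * p) * (1 - a * b * p) * (1 - a * c * p) * (1 - a * d * p)
                         * w (S n)).
      { transitivity ((1 - q * RtoC q ^ n) * (1 - b3 * RtoC q ^ n)
          * ((1 - z * (a * b) * RtoC q ^ n) * (1 - z * (a * c) * RtoC q ^ n) * w (S n))).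
        - unfold w. rewrite W_step. ring.
        - rewrite Hlat. unfold p. ring. }
      rewrite Hw.
      change (qpoch q (z * s1) (S (S n)))
        with (qpoch q (z * s1) (S n) * (1 - z * s1 * RtoC q ^ S n)).
      change (qpoch q (z * s2) (S (S n)))
        with (qpoch q (z * s2) (S n) * (1 - z * s2 * RtoC q ^ S n)).
      set (Z := qpoch q (z * s1) (S n) * qpoch q (z * s2) (S n)).
      transitivity (Z * (qpoch q (z * x) n * qpoch q (z * y) n * w (S n))
        * ((1 - q * p) * (1 - a * b * p) * (1 - a * c * p) * (1 - a * d * p)
           + q * p * (B * ((1 - x * p) * (1 - x * (q * p)) * (1 - y / q))
           + B' * ((1 - y * p) * (1 - y * (q * p)) * (1 - x / q))
           - kap * ((1 - x * p) * (1 - y * p))))).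
      + rewrite !qpoch_down.
        replace (c1 * (Z * w (S n) * (qpoch q (q * (z * x)) (S n)
                   * ((1 - z * y / q) * qpoch q (z * y) n))))
          with (c1 * (1 - z * y / q) * (Z * w (S n)) * (qpoch q (q * (z * x)) (S n)
                   * qpoch q (z * y) n)) by ring.
        replace (c2 * (Z * w (S n) * ((1 - z * x / q) * qpoch q (z * x) n
                   * qpoch q (q * (z * y)) (S n))))
          with (c2 * (1 - z * x / q) * (Z * w (S n)) * (qpoch q (q * (z * y)) (S n)
                   * qpoch q (z * x) n)) by ring.
        rewrite E1, E2.
        replace (B * (1 - y / q) * (1 - z * x) * (Z * w (S n))
                 * (qpoch q (q * (z * x)) (S n) * qpoch q (z * y) n))
          with (B * (1 - y / q) * (Z * w (S n))
                 * (((1 - z * x) * qpoch q (q * (z * x)) (S n)) * qpoch q (z * y) n)) by ring.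
        replace (B' * (1 - x / q) * (1 - z * y) * (Z * w (S n))
                 * (qpoch q (q * (z * y)) (S n) * qpoch q (z * x) n))
          with (B' * (1 - x / q) * (Z * w (S n))
                 * (((1 - z * y) * qpoch q (q * (z * y)) (S n)) * qpoch q (z * x) n)) by ring.
        rewrite !qpoch_up, Cpow_S. simpl qpoch. unfold Z, p. ring.
      + rewrite basis_identity, Cpow_S. unfold Z. simpl qpoch. unfold p. ring. }
  assert (LG : clim eventually G
    (qinf (z * s1) * qinf (z * s2) * qinf (z * x) * qinf (z * y) * 1)).
  { unfold G. repeat apply (clim_mult eventually); try apply qpoch_clim.
    - apply (clim_succ (qpoch q (z * s1))), qpoch_clim.
    - apply (clim_succ (qpoch q (z * s2))), qpoch_clim.
    - apply W_clim. }
  rewrite Cmult_1_r in LG.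
  apply (clim_unique eventually G); [| exact LG].
  apply (clim_ext eventually _ G _ E).
  assert (L : forall k x y, clim eventually (fun n => k * qpsum (f x y) (S n))
    (k * Sg (z * s1) (z * s2) x y (z * (a * b)) (z * (a * c)) b3)).
  { intros k x' y'. apply (clim_mult eventually); [apply (clim_const eventually) |].
    exact (clim_succ _ _ (Sg_clim (z * s1) (z * s2) x' y' (z * (a * b)) (z * (a * c)) b3)). }
  apply (clim_mult eventually); [apply (clim_const eventually) |].
  apply (clim_minus eventually); [apply (clim_plus eventually) |]; apply L.
Qed.

(** The Askey-Wilson equation in terms of [PhiU]: passing from [u] to [PhiU] replaces the
    factor [1 - d X] of [A(X)] by [X (q X - d)] in the coefficients of the shifted terms. *)
Lemma difference_equation :
  eqA a b c 0 X * (X * (q * X - d)) * PhiU a b c d N (q * X)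
  + eqA a b c 0 (/ X) * (/ X * (q / X - d)) * PhiU a b c d N (X / q)
  = kap * PhiU a b c d N X.
Proof.
  set (c1 := eqB b c 0 X * (X * (q * X - d))).
  set (c2 := eqB b c 0 (/ X) * (/ X * (q / X - d))).
  assert (H1 : eqA a b c d X * Sg s1 s2 (q * x) (y / q) (a * b) (a * c) (a * d)
    + eqA a b c d (/ X) * Sg s1 s2 (x / q) (q * y) (a * b) (a * c) (a * d)
    - kap * Sg s1 s2 x y (a * b) (a * c) (a * d) = qinf s1 * qinf s2 * qinf x * qinf y).
  { generalize (series_equation 1 (a * d) (eqA a b c d X) (eqA a b c d (/ X))).
    rewrite !Cmult_1_l. intros H. apply H.
    - intros n. ring.
    - unfold eqA, B, x. ring.
    - unfold eqA, B', y, Cdiv. ring.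
    - unfold kap, eqK, s1. fold s2. ring. }
  assert (H2 := series_equation e (q * e) (c1 * (1 - y / q)) (c2 * (1 - x / q))).
  assert (EA : eqA a b c 0 X * (X * (q * X - d)) = c1 * (1 - x)) by (unfold eqA, c1, x; ring).
  assert (EA' : eqA a b c 0 (/ X) * (/ X * (q / X - d)) = c2 * (1 - y))
    by (unfold eqA, c2, y, Cdiv; ring).
  assert (E1 : c1 * (1 - x) * (1 - e * y / q) = eqA a b c d X * (1 - e * x)).
  { unfold c1, eqA, eqB, e, x, y. field. nz. }
  assert (E2 : c2 * (1 - y) * (1 - e * x / q) = eqA a b c d (/ X) * (1 - e * y)).
  { unfold c2, eqA, eqB, e, x, y. field. nz. }
  specialize (H2 ltac:(intros n; unfold e; field; auto)
    ltac:(unfold c1, B, eqB, e, x, y; field; nz) ltac:(unfold c2, B', eqB, e, x, y; field; nz)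
    basis_identity_e).
  rewrite EA, EA'. unfold PhiU, Phi. fold s1 s2 e.
  replace (q / e) with (a * d) by (unfold e; field; auto).
  replace (a * (q * X)) with (q * x) by (unfold x; ring).
  replace (a / (q * X)) with (y / q) by (unfold y; field; auto).
  replace (a * (X / q)) with (x / q) by (unfold x; field; auto).
  replace (a / (X / q)) with (q * y) by (unfold y; field; auto).
  fold x y.
  replace (e * (q * x)) with (q * (e * x)) by ring.
  replace (e * (q * y)) with (q * (e * y)) by ring.
  replace (e * (y / q)) with (e * y / q) by (field; auto).
  replace (e * (x / q)) with (e * x / q) by (field; auto).
  assert (Up : forall z, qinf z = (1 - z) * qinf (q * z)).
  { intros z. rewrite qpoch_inf_S. do 2 f_equal. ring. }
  assert (Dn : forall z, qinf (z / q) = (1 - z / q) * qinf z).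
  { intros z. rewrite qpoch_inf_S. do 2 f_equal. field. exact hq. }
  rewrite !Dn.
  set (S1u := Sg s1 s2 (q * x) (y / q) (a * b) (a * c) (a * d)) in *.
  set (S1d := Sg s1 s2 (x / q) (q * y) (a * b) (a * c) (a * d)) in *.
  set (S1 := Sg s1 s2 x y (a * b) (a * c) (a * d)) in *.
  set (S2u := Sg (e * s1) (e * s2) (q * (e * x)) (e * y / q) (e * (a * b)) (e * (a * c)) (q * e)) in *.
  set (S2d := Sg (e * s1) (e * s2) (e * x / q) (q * (e * y)) (e * (a * b)) (e * (a * c)) (q * e)) in *.
  set (S2 := Sg (e * s1) (e * s2) (e * x) (e * y) (e * (a * b)) (e * (a * c)) (q * e)) in *.
  apply Cminus_eq_0.
  set (P := qinf (e * s1) * qinf (e * s2)). set (Q := qinf s1 * qinf s2).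
  transitivity (P * (c1 * (1 - x) * (1 - e * y / q) * qinf (q * (e * x)) * qinf (e * y) * S1u
                     + c2 * (1 - y) * (1 - e * x / q) * qinf (e * x) * qinf (q * (e * y)) * S1d
                     - kap * qinf (e * x) * qinf (e * y) * S1)
                - Q * (e * (c1 * (1 - y / q) * ((1 - x) * qinf (q * x)) * qinf y * S2u
                     + c2 * (1 - x / q) * qinf x * ((1 - y) * qinf (q * y)) * S2d
                     - kap * qinf x * qinf y * S2))).
  { unfold P, Q. ring. }
  rewrite <- (Up x), <- (Up y), E1, E2.
  transitivity (P * (eqA a b c d X * ((1 - e * x) * qinf (q * (e * x))) * qinf (e * y) * S1u
                     + eqA a b c d (/ X) * qinf (e * x) * ((1 - e * y) * qinf (q * (e * y))) * S1d
                     - kap * qinf (e * x) * qinf (e * y) * S1)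
                - Q * (e * (c1 * (1 - y / q) * S2u + c2 * (1 - x / q) * S2d - kap * S2))
                  * qinf x * qinf y).
  { ring. }
  rewrite <- (Up (e * x)), <- (Up (e * y)), H2.
  transitivity (P * qinf (e * x) * qinf (e * y)
                  * (eqA a b c d X * S1u + eqA a b c d (/ X) * S1d - kap * S1)
                - Q * (qinf (e * s1) * qinf (e * s2) * qinf (e * x) * qinf (e * y))
                  * qinf x * qinf y).
  { ring. }
  rewrite H1. unfold P, Q. ring.
Qed.

End DifferenceEquation.

(** * The Casoratian *)

Lemma Sg_swap34 (s1 s2 s3 s4 b1 b2 b3 : C) :
  Sg s1 s2 s3 s4 b1 b2 b3 = Sg s1 s2 s4 s3 b1 b2 b3.
Proof.
  unfold Sg. f_equal. apply functional_extensionality. intros n. unfold sg_term. ring.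
Qed.

Lemma Phi_swap34 (s1 s2 s3 s4 b1 b2 e : C) :
  Phi s1 s2 s3 s4 b1 b2 e = Phi s1 s2 s4 s3 b1 b2 e.
Proof.
  unfold Phi. rewrite (Sg_swap34 s1), (Sg_swap34 (e * s1)). ring.
Qed.

Lemma PhiU_inv (a b c d N X : C) : X <> 0 -> PhiU a b c d N (/ X) = PhiU a b c d N X.
Proof.
  intros HX. unfold PhiU. rewrite Phi_swap34. f_equal; field; auto using C1_nz.
Qed.

(** The Casoratian [u(z-1) v(z) - u(z) v(z-1)], cleared of denominators. *)
Definition casoratian (a b c d N X : C) : C :=
  (1 - q / (X * d)) * (1 - X / c) * PhiU a b c d N (X / q) * PhiU a b d c N X
  - (1 - X / d) * (1 - q / (X * c)) * PhiU a b c d N X * PhiU a b d c N (X / q).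

Definition cas_zeros (a b X : C) : C :=
  qinf (a * X) * qinf (a * q / X) * qinf (b * X) * qinf (b * q / X).

Definition cas_shape (a b X : C) : C := (X - q / X) * cas_zeros a b X.

Lemma casoratian_anti (a b c d N X : C) : X <> 0 -> c <> 0 -> d <> 0 ->
  casoratian a b c d N (q / X) = - casoratian a b c d N X.
Proof.
  intros HX Hc Hd. unfold casoratian.
  replace (q / X / q) with (/ X) by (field; auto).
  assert (HXq : X / q <> 0).
  { intros E. apply HX. replace X with (X / q * q) by (field; auto). rewrite E. ring. }
  replace (q / X) with (/ (X / q)) by (field; auto).
  rewrite !PhiU_inv by assumption.
  generalize (PhiU a b c d N (X / q)) (PhiU a b d c N X) (PhiU a b c d N X)
    (PhiU a b d c N (X / q)). intros. field. auto.
Qed.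

Lemma cas_zeros_sym (a b X : C) : X <> 0 -> cas_zeros a b (q / X) = cas_zeros a b X.
Proof.
  intros HX. unfold cas_zeros.
  replace (a * (q / X)) with (a * q / X) by (field; auto).
  replace (b * (q / X)) with (b * q / X) by (field; auto).
  replace (a * q / (q / X)) with (a * X) by (field; auto).
  replace (b * q / (q / X)) with (b * X) by (field; auto). ring.
Qed.

Lemma cas_zeros_shift (a b X : C) : X <> 0 ->
  (1 - a * X) * (1 - b * X) * cas_zeros a b (q * X)
  = (1 - a / X) * (1 - b / X) * cas_zeros a b X.
Proof.
  intros HX. unfold cas_zeros.
  replace (a * (q * X)) with (a * X * q) by ring.
  replace (b * (q * X)) with (b * X * q) by ring.
  replace (a * q / (q * X)) with (a / X) by (field; auto).
  replace (b * q / (q * X)) with (b / X) by (field; auto).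
  rewrite (qpoch_inf_S (a * X)), (qpoch_inf_S (b * X)),
    (qpoch_inf_S (a / X)), (qpoch_inf_S (b / X)).
  replace (a / X * q) with (a * q / X) by (field; auto).
  replace (b / X * q) with (b * q / X) by (field; auto). ring.
Qed.

Lemma cas_shape_anti (a b X : C) : X <> 0 -> cas_shape a b (q / X) = - cas_shape a b X.
Proof.
  intros HX. unfold cas_shape. rewrite cas_zeros_sym by exact HX.
  replace (q / (q / X)) with X by (field; auto). ring.
Qed.

(** Eliminating the term with [kap] between the equations of [u] and [v]; the coefficient
    [kap] is the same for both because it is symmetric in [c] and [d]. *)
Lemma casoratian_shift (a b c d N X : C) :
  a <> 0 -> c <> 0 -> d <> 0 -> N <> 0 -> X <> 0 ->
  1 - X * X <> 0 -> 1 - q * (X * X) <> 0 -> q - X * X <> 0 ->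
  (1 - a * X) * (1 - b * X) * (q - X * X) * casoratian a b c d N (q * X)
  = (1 - a / X) * (1 - b / X) * (1 - q * (X * X)) * casoratian a b c d N X.
Proof.
  intros Ha Hc Hd HN HX H1 H2 H3.
  assert (EU := difference_equation a b c d N X Ha Hd HN HX H1 H2 H3).
  assert (EV := difference_equation a b d c N X Ha Hc HN HX H1 H2 H3).
  assert (EK : eqK a b d c N X = eqK a b c d N X).
  { unfold eqK, eqA, eqB. replace (a * b * d * c) with (a * b * c * d) by ring.
    unfold Cdiv. ring. }
  rewrite EK in EV. unfold casoratian.
  replace (q * X / q) with X by (field; auto).
  set (U := PhiU a b c d N X) in *. set (V := PhiU a b d c N X) in *.
  set (Uu := PhiU a b c d N (q * X)) in *. set (Vu := PhiU a b d c N (q * X)) in *.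
  set (Ud := PhiU a b c d N (X / q)) in *. set (Vd := PhiU a b d c N (X / q)) in *.
  set (k := eqK a b c d N X) in *. clearbody U V Uu Vu Ud Vd k.
  set (au := eqA a b c 0 X * (X * (q * X - d))) in *.
  set (av := eqA a b d 0 X * (X * (q * X - c))) in *.
  set (bu := eqA a b c 0 (/ X) * (/ X * (q / X - d))) in *.
  set (bv := eqA a b d 0 (/ X) * (/ X * (q / X - c))) in *.
  set (m := (1 - X * X) * (1 - q * (X * X)) * (q - X * X) / (X * X * (c * d))).
  transitivity (m * (av * Vu * U - au * Uu * V)).
  { unfold m, au, av, eqA, eqB. field. nz. }
  replace (av * Vu) with (k * V - bv * Vd) by (rewrite <- EV; ring).
  replace (au * Uu) with (k * U - bu * Ud) by (rewrite <- EU; ring).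
  transitivity (m * (bu * Ud * V - bv * Vd * U)); [ring |].
  unfold m, bu, bv, eqA, eqB. field. nz.
Qed.

Lemma cas_shape_shift (a b X : C) : X <> 0 ->
  (1 - a * X) * (1 - b * X) * (q - X * X) * cas_shape a b (q * X)
  = (1 - a / X) * (1 - b / X) * (1 - q * (X * X)) * cas_shape a b X.
Proof.
  intros HX. unfold cas_shape.
  transitivity ((q - X * X) * (q * X - q / (q * X))
    * ((1 - a * X) * (1 - b * X) * cas_zeros a b (q * X))); [ring |].
  rewrite cas_zeros_shift by exact HX. field. auto.
Qed.

Section LaurentMembership.
Context (D : C -> Prop) (r1 r2 : R) (hr1 : (0 < r1)%R)
  (hD : forall X, D X -> (r1 <= Cmod X <= r2)%R).

Let HK := laurent_calg D r1 r2 hr1 hD.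

Lemma laurent_mult (f g : C -> C) :
  laurent_on D f -> laurent_on D g -> laurent_on D (fun X => f X * g X).
Proof. apply (calg_mult HK). Qed.

Lemma laurent_const (k : C) : laurent_on D (fun _ => k).
Proof. apply (calg_const HK). Qed.

Lemma laurent_PhiU (a b c d N k : C) : k <> 0 ->
  laurent_on D (fun X => PhiU a b c d N (X / k)).
Proof.
  intros Hk. unfold PhiU.
  apply (calg_Phi HK (fun _ => / N) (fun _ => a * b * c * d * N / q)
    (fun X => a * (X / k)) (fun X => a / (X / k)) (fun _ => a * b) (fun _ => a * c)
    (fun _ => q / (a * d))); try apply laurent_const.
  - apply laurent_mult; [apply laurent_const |].
    apply laurent_mult; [apply laurent_X | apply laurent_const].
  - apply (calg_ext HK (fun X => a * k * / X)).
    + intros X HX. assert (X <> 0) by (apply Cmod_gt_0; generalize (hD X HX); lra).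
      field. auto.
    + apply laurent_mult; [apply laurent_const | apply laurent_inv].
Qed.

Lemma laurent_casoratian (a b c d N : C) : c <> 0 -> d <> 0 -> laurent_on D (casoratian a b c d N).
Proof.
  intros Hc Hd.
  assert (H0 : forall X, D X -> X <> 0)
    by (intros X HX; apply Cmod_gt_0; generalize (hD X HX); lra).
  assert (HU : forall a b c d, laurent_on D (PhiU a b c d N)).
  { intros. apply (calg_ext HK (fun X => PhiU a0 b0 c0 d0 N (X / 1))).
    - intros X _. f_equal. field.
    - apply laurent_PhiU, C1_nz. }
  assert (HL : forall k : C, k <> 0 -> laurent_on D (fun X => 1 - X / k)).
  { intros k Hk. apply (calg_minus HK); [apply laurent_const |].
    apply laurent_mult; [apply laurent_X | apply laurent_const]. }
  assert (HI : forall k : C, k <> 0 -> laurent_on D (fun X => 1 - q / (X * k))).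
  { intros k Hk. apply (calg_minus HK); [apply laurent_const |].
    apply (calg_ext HK (fun X => q / k * / X)).
    - intros X HX. specialize (H0 X HX). field. auto.
    - apply laurent_mult; [apply laurent_const | apply laurent_inv]. }
  unfold casoratian. apply (calg_minus HK); repeat apply laurent_mult; auto;
    apply laurent_PhiU, hq.
Qed.

Lemma laurent_linear_arg (a : C) :
  laurent_on D (fun X => a * X) /\ laurent_on D (fun X => a * q / X).
Proof.
  split; apply laurent_mult; first [apply laurent_const | apply laurent_X | apply laurent_inv].
Qed.

Lemma laurent_cas_shape (a b : C) : laurent_on D (cas_shape a b).
Proof.
  destruct (laurent_linear_arg a) as [A1 A2]. destruct (laurent_linear_arg b) as [B1 B2].
  unfold cas_shape, cas_zeros. apply laurent_mult.
  - apply (calg_minus HK); [apply laurent_X |].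
    apply laurent_mult; [apply laurent_const | apply laurent_inv].
  - repeat apply laurent_mult;
      [apply (calg_qpoch_inf HK _ A1) | apply (calg_qpoch_inf HK _ A2)
      | apply (calg_qpoch_inf HK _ B1) | apply (calg_qpoch_inf HK _ B2)].
Qed.

End LaurentMembership.

(** As [|a|, |b| < 1], the factor [cas_zeros] has no zero on an annulus slightly larger than
    [q <= |X| <= 1], so that the quotient by it is a uniform limit of Laurent polynomials there
    and [annulus_rigidity] applies to it. *)
Lemma casoratian_annulus (a b c d N : C) :
  a <> 0 -> b <> 0 -> c <> 0 -> d <> 0 -> N <> 0 -> (Cmod a < 1)%R -> (Cmod b < 1)%R ->
  exists K, forall X, (q <= Cmod X <= 1)%R -> casoratian a b c d N X = K * cas_shape a b X.
Proof.
  intros Ha Hb Hc Hd HN Ha1 Hb1.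
  set (mx := Rmax (Rmax (Cmod a) (Cmod b)) (sqrt q)).
  assert (Hs1 : (sqrt q < 1)%R) by (rewrite <- sqrt_1; apply sqrt_lt_1; lra).
  assert (Hs0 : (0 < sqrt q)%R) by (apply sqrt_lt_R0, hq0).
  assert (Hmx : (mx < 1)%R) by (repeat apply Rmax_lub_lt; assumption).
  assert (Hma : (Cmod a <= mx)%R) by (eapply Rle_trans; [apply Rmax_l | apply Rmax_l]).
  assert (Hmb : (Cmod b <= mx)%R) by (eapply Rle_trans; [apply Rmax_r | apply Rmax_l]).
  assert (Hmq : (sqrt q <= mx)%R) by apply Rmax_r.
  set (r := ((1 + mx) / 2)%R).
  assert (Hr0 : (0 < r < 1)%R) by (unfold r; lra).
  assert (Hra : (Cmod a < r)%R) by (unfold r; lra).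
  assert (Hrb : (Cmod b < r)%R) by (unfold r; lra).
  assert (Hrq : (q < r * r)%R).
  { rewrite <- (sqrt_sqrt q) by lra. apply Rmult_le_0_lt_compat; unfold r; lra. }
  assert (Hri : (1 < / r)%R) by (rewrite <- Rinv_1; apply Rinv_lt_contravar; lra).
  set (D := fun X : C => (q * r <= Cmod X <= / r)%R).
  assert (Hqr : (0 < q * r)%R) by (apply Rmult_lt_0_compat; lra).
  assert (HK := laurent_calg D (q * r) (/ r) Hqr (fun X HX => HX)).
  (* the arguments of the four products are at most |a| / r or |b| / r on D *)
  assert (Hbd1 : forall k X, D X -> (Cmod (k * X) <= Cmod k / r)%R).
  { intros k X [_ HX]. rewrite Cmod_mult. unfold Rdiv.
    apply Rmult_le_compat_l; [apply Cmod_ge_0 | exact HX]. }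
  assert (Hbd2 : forall k X, D X -> (Cmod (k * q / X) <= Cmod k / r)%R).
  { intros k X [HX _]. assert (HX0 : X <> 0) by (apply Cmod_gt_0; lra).
    unfold Cdiv. rewrite !Cmod_mult, Cmod_inv, Cmod_R, Rabs_pos_eq by (lra || exact HX0).
    rewrite Rmult_assoc. unfold Rdiv. apply Rmult_le_compat_l; [apply Cmod_ge_0 |].
    apply (Rmult_le_reg_r (Cmod X)); [lra |]. rewrite Rmult_assoc, Rinv_l by lra.
    apply Rle_trans with (/ r * (q * r))%R; [apply Req_le; field; lra |].
    apply Rmult_le_compat_l; lra. }
  assert (Hth : forall k, (Cmod k < r)%R -> (0 <= Cmod k / r < 1)%R).
  { intros k Hk. split.
    - unfold Rdiv. apply Rmult_le_pos; [apply Cmod_ge_0 | left; apply Rinv_0_lt_compat; lra].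
    - apply (Rmult_lt_reg_r r); [lra |]. unfold Rdiv. rewrite Rmult_assoc, Rinv_l by lra. lra. }
  assert (Hnz : forall k X, (Cmod k < r)%R -> D X -> qinf (k * X) <> 0 /\ qinf (k * q / X) <> 0).
  { intros k X Hk HX. specialize (Hth k Hk).
    split; apply qpoch_inf_small_neq0;
      [generalize (Hbd1 k X HX) | generalize (Hbd2 k X HX)]; lra. }
  set (Th := cas_zeros a b).
  assert (HTh : forall X, D X -> Th X <> 0).
  { intros X HX. destruct (Hnz a X Hra HX). destruct (Hnz b X Hrb HX).
    unfold Th, cas_zeros. repeat apply Cmult_neq_0; assumption. }
  set (G := fun X : C => casoratian a b c d N X / Th X).
  assert (HG : laurent_on D G).
  { apply (calg_ext HK (fun X => casoratian a b c d N X * (/ qinf (a * X) * / qinf (a * q / X)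
             * / qinf (b * X) * / qinf (b * q / X)))).
    - intros X HX. destruct (Hnz a X Hra HX). destruct (Hnz b X Hrb HX).
      unfold G, Th, cas_zeros. field. auto.
    - destruct (laurent_linear_arg D (q * r) (/ r) Hqr (fun X HX => HX) a) as [A1 A2].
      destruct (laurent_linear_arg D (q * r) (/ r) Hqr (fun X HX => HX) b) as [B1 B2].
      apply (calg_mult HK).
      + apply (laurent_casoratian D (q * r) (/ r)); auto.
      + repeat apply (calg_mult HK).
        * apply (calg_qpoch_inf_inv HK _ (Cmod a / r)); auto.
        * apply (calg_qpoch_inf_inv HK (fun X => a * q / X) (Cmod a / r)); auto.
        * apply (calg_qpoch_inf_inv HK _ (Cmod b / r)); auto.
        * apply (calg_qpoch_inf_inv HK (fun X => b * q / X) (Cmod b / r)); auto. }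
  assert (Hrig := annulus_rigidity r G Hr0 Hrq HG).
  assert (Hin : forall X, (q <= Cmod X <= 1)%R -> D X).
  { intros X HX. split; [| lra]. apply Rle_trans with (q * 1)%R; [apply Rmult_le_compat_l; lra | lra]. }
  exists (G 1 / (1 - q)). intros X HX.
  assert (HX0 : X <> 0) by (apply Cmod_gt_0; lra).
  assert (H1q := C1mq_neq0).
  transitivity (G X * (1 - q) / (1 - q) * Th X).
  { unfold G. field. split; [apply HTh, Hin, HX | exact H1q]. }
  rewrite Hrig; [| | | exact HX].
  - unfold cas_shape, Th. field. auto.
  - intros Y HY. assert (HY0 : Y <> 0) by (apply Cmod_gt_0; destruct HY; lra).
    unfold G. rewrite casoratian_anti by assumption.
    unfold Th. rewrite cas_zeros_sym by exact HY0. unfold Cdiv. ring.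
  - intros Y HY.
    assert (Hrr : (r * r < 1)%R) by (rewrite <- (Rmult_1_r 1); apply Rmult_le_0_lt_compat; lra).
    assert (Hir : (/ r * / r * (r * r) = 1)%R) by (field; lra).
    assert (Hii : (1 < / r * / r)%R).
    { apply (Rmult_lt_reg_r (r * r)); [apply Rmult_lt_0_compat; lra | rewrite Hir; lra]. }
    assert (Hiq : (q * (/ r * / r) < 1)%R).
    { apply (Rmult_lt_reg_r (r * r)); [apply Rmult_lt_0_compat; lra |].
      rewrite Rmult_assoc, Hir. lra. }
    assert (HYp : (r <= Cmod Y <= / r)%R) by (destruct HY as [E | E]; rewrite E; lra).
    assert (HY0 : Y <> 0) by (apply Cmod_gt_0; lra).
    assert (HYD : D Y).
    { split; [| lra]. apply Rle_trans with (1 * r)%R; [apply Rmult_le_compat_r; lra | lra]. }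
    assert (HqYm : Cmod (RtoC q * Y) = (q * Cmod Y)%R)
      by (rewrite Cmod_mult, Cmod_R, Rabs_pos_eq; lra).
    assert (HqYD : D (RtoC q * Y)).
    { unfold D. rewrite HqYm. split; [apply Rmult_le_compat_l; lra |].
      apply Rle_trans with (1 * Cmod Y)%R; [apply Rmult_le_compat_r; lra | lra]. }
    assert (HYY : Cmod (Y * Y) = (r * r)%R \/ Cmod (Y * Y) = (/ r * / r)%R).
    { rewrite Cmod_mult. destruct HY as [E | E]; rewrite E; auto. }
    assert (HqYY : Cmod (RtoC q * (Y * Y)) = (q * Cmod (Y * Y))%R)
      by (rewrite Cmod_mult, Cmod_R, Rabs_pos_eq; lra).
    assert (N1 : 1 - Y * Y <> 0).
    { destruct HYY as [E | E].
      - apply Cmod_lt_neq. rewrite Cmod_1, E. exact Hrr.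
      - intros E1. apply Cminus_eq_0 in E1. rewrite <- E1, Cmod_1 in E. lra. }
    assert (N2 : 1 - q * (Y * Y) <> 0).
    { apply Cmod_lt_neq. rewrite Cmod_1, HqYY. destruct HYY as [E | E]; rewrite E; [| exact Hiq].
      apply Rle_lt_trans with (1 * (r * r))%R; [| lra].
      apply Rmult_le_compat_r; [apply Rmult_le_pos; lra | lra]. }
    assert (N3 : q - Y * Y <> 0).
    { intros E. apply Cminus_eq_0 in E.
      assert (Ec : Cmod (Y * Y) = q) by (rewrite <- E, Cmod_R, Rabs_pos_eq; lra).
      destruct HYY as [E1 | E1]; rewrite E1 in Ec; lra. }
    assert (Hlin : forall k, (Cmod k < r)%R -> 1 - k * Y <> 0 /\ 1 - k / Y <> 0).
    { intros k Hk. split; apply Cmod_lt_neq; rewrite Cmod_1.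
      - generalize (Hbd1 k Y HYD) (Hth k Hk). lra.
      - unfold Cdiv. rewrite Cmod_mult, Cmod_inv by exact HY0.
        apply (Rmult_lt_reg_r (Cmod Y)); [lra |].
        rewrite Rmult_assoc, Rinv_l by lra. lra. }
    destruct (Hlin a Hra) as [La1 La2]. destruct (Hlin b Hrb) as [Lb1 Lb2].
    assert (HF := casoratian_shift a b c d N Y Ha Hc Hd HN HY0 N1 N2 N3).
    assert (HE := cas_zeros_shift a b Y HY0). fold Th in HE.
    assert (T1 := HTh Y HYD). assert (T2 := HTh (q * Y) HqYD).
    unfold G.
    transitivity ((1 - a * Y) * (1 - b * Y) * (q - Y * Y) * casoratian a b c d N (q * Y)
                  / ((1 - a * Y) * (1 - b * Y) * Th (q * Y))).
    { field. auto. }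
    rewrite HF, HE. field.
    repeat split; auto; intros E; [apply Lb2 | apply La2];
      match type of E with ?P = _ => transitivity (P / Y); [field; exact HY0 | rewrite E; field; exact HY0] end.
Qed.

(** The functional equation propagates the identity from [X] to [q X] when [|X| <= 1], and
    the antisymmetry under [X -> q/X] then gives [|X| > 1]. The equation degenerates at
    [X^2 = 1], where the antisymmetry replaces it, and at [X^2 = q], where continuity does. *)
Lemma casoratian_global (a b c d N : C) :
  a <> 0 -> b <> 0 -> c <> 0 -> d <> 0 -> N <> 0 -> (Cmod a < 1)%R -> (Cmod b < 1)%R ->
  exists K, forall X : C, X <> 0 -> casoratian a b c d N X = K * cas_shape a b X.
Proof.
  intros Ha Hb Hc Hd HN Ha1 Hb1.
  destruct (casoratian_annulus a b c d N Ha Hb Hc Hd HN Ha1 Hb1) as [K HKX].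
  exists K. set (De := fun X => casoratian a b c d N X - K * cas_shape a b X).
  assert (Hanti : forall X : C, X <> 0 -> De (q / X) = - De X).
  { intros X HX. unfold De. rewrite casoratian_anti, cas_shape_anti by assumption. ring. }
  assert (Hshift : forall X : C, X <> 0 -> 1 - X * X <> 0 -> q - X * X <> 0 -> (Cmod X <= 1)%R ->
    De X = 0 -> De (q * X) = 0).
  { intros X HX N1 N3 HX1 HD.
    assert (Hxx : (Cmod X * Cmod X <= 1 * 1)%R)
      by (apply Rmult_le_compat; auto using Cmod_ge_0).
    assert (N2 : 1 - q * (X * X) <> 0).
    { apply Cmod_lt_neq. rewrite Cmod_1, !Cmod_mult, Cmod_R, Rabs_pos_eq by lra.
      apply Rle_lt_trans with (q * (1 * 1))%R; [apply Rmult_le_compat_l; lra | lra]. }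
    assert (Hlin : forall k, (Cmod k < 1)%R -> 1 - k * X <> 0).
    { intros k Hk. apply Cmod_lt_neq. rewrite Cmod_1, Cmod_mult.
      apply Rle_lt_trans with (Cmod k * 1)%R; [| lra].
      apply Rmult_le_compat_l; [apply Cmod_ge_0 | exact HX1]. }
    assert (E1 := casoratian_shift a b c d N X Ha Hc Hd HN HX N1 N2 N3).
    assert (E2 := cas_shape_shift a b X HX).
    assert (E : (1 - a * X) * (1 - b * X) * (q - X * X) * De (q * X) = 0).
    { unfold De.
      transitivity ((1 - a * X) * (1 - b * X) * (q - X * X) * casoratian a b c d N (q * X)
        - K * ((1 - a * X) * (1 - b * X) * (q - X * X) * cas_shape a b (q * X))); [ring |].
      rewrite E1, E2.
      transitivity ((1 - a / X) * (1 - b / X) * (1 - q * (X * X)) * De X); [unfold De; ring |].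
      rewrite HD. ring. }
    assert (P1 := Hlin a Ha1). assert (P2 := Hlin b Hb1).
    transitivity ((1 - a * X) * (1 - b * X) * (q - X * X) * De (q * X)
                  / ((1 - a * X) * (1 - b * X) * (q - X * X))).
    - field. auto.
    - rewrite E. unfold Cdiv. ring. }
  assert (Hcont : forall X : C, X <> 0 -> clim (locally (T := C_UniformSpace) X) De (De X)).
  { intros X HX. assert (HXp := proj1 (Cmod_gt_0 X) HX).
    set (D := fun Y : C => (Cmod X / 2 <= Cmod Y <= 2 * Cmod X)%R).
    assert (Hr : (0 < Cmod X / 2)%R) by lra.
    apply (laurent_continuous D De X).
    - apply (calg_minus (laurent_calg D _ _ Hr (fun Y HY => HY))).
      + apply (laurent_casoratian D _ _ Hr (fun Y HY => HY)); assumption.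
      + apply (laurent_mult D _ _ Hr (fun Y HY => HY)).
        * apply (laurent_const D _ _ Hr (fun Y HY => HY)).
        * apply (laurent_cas_shape D _ _ Hr (fun Y HY => HY)).
    - exact HX.
    - assert (Hid : clim (locally (T := C_UniformSpace) X) (fun Y => Y) X)
        by (apply clim_filterlim; [apply locally_filter | apply filterlim_id]).
      generalize (Hid _ Hr). apply filter_imp. intros Y HY.
      assert (A1 := Cmod_le_plus X Y). assert (A2 := Cmod_le_plus Y X).
      rewrite (Cmod_minus_sym X Y) in A1. unfold D. split; lra. }
  assert (Hdown : forall n X, (q ^ S n <= Cmod X <= 1)%R -> De X = 0).
  { induction n as [|n IH]; intros X HX.
    - unfold De. rewrite HKX; [ring |]. simpl in HX. lra.
    - assert (Hqn := qn_pos (S (S n))).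
      assert (HX0 : X <> 0) by (apply Cmod_gt_0; lra).
      destruct (Rle_lt_dec (q ^ S n) (Cmod X)) as [Hle | Hlt]; [apply IH; lra |].
      set (Y := X / q).
      assert (HY0 : Y <> 0).
      { intros E. apply HX0. replace X with (Y * q) by (unfold Y; field; auto). rewrite E. ring. }
      assert (HXY : X = q * Y) by (unfold Y; field; auto).
      assert (HYm : Cmod X = (q * Cmod Y)%R)
        by (rewrite HXY, Cmod_mult, Cmod_R, Rabs_pos_eq; lra).
      assert (HqY : (q ^ S n <= Cmod Y <= 1)%R).
      { split; apply (Rmult_le_reg_l q); try exact hq0; rewrite <- HYm.
        - change (q * q ^ S n)%R with (q ^ S (S n))%R. lra.
        - rewrite Rmult_1_r. apply Rle_trans with (q ^ S n)%R; [lra |].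
          apply qn_S_le_q. }
      rewrite HXY.
      destruct (Ceq_dec (1 - Y * Y) 0) as [E1 | N1].
      + (* here Y = 1/Y, so that q Y = q / Y is the mirror image of Y *)
        replace (q * Y) with (q / Y).
        * rewrite Hanti, (IH Y HqY) by exact HY0. ring.
        * apply Cminus_eq_0 in E1.
          replace (q / Y) with (q * 1 / Y) by (field; exact HY0). rewrite E1. field. exact HY0.
      + destruct (Ceq_dec (q - Y * Y) 0) as [E3 | N3]; [| apply Hshift; auto; lra].
        apply Cminus_eq_0 in E3.
        assert (Hqq : (Cmod Y * Cmod Y)%R = q)
          by (rewrite <- Cmod_mult, <- E3, Cmod_R, Rabs_pos_eq; lra).
        assert (HY1 : (Cmod Y < 1)%R).
        { destruct (Rle_lt_dec 1 (Cmod Y)) as [H | H]; [| exact H].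
          assert (1 * 1 <= Cmod Y * Cmod Y)%R by (apply Rmult_le_compat; lra). lra. }
        assert (HYq : (q < Cmod Y)%R).
        { assert (Cmod Y * Cmod Y < Cmod Y * 1)%R
            by (apply Rmult_lt_compat_l; [apply Cmod_gt_0; exact HY0 | exact HY1]). lra. }
        assert (HS : clim eventually (fun k => q * Y - q * Y * RtoC q ^ k) (q * Y - 0)).
        { apply (clim_minus eventually); [apply (clim_const eventually) |].
          apply clim_xqn. }
        replace (q * Y - 0) with (q * Y) in HS by ring.
        assert (HqY0 : q * Y <> 0) by (apply Cmult_neq_0; assumption).
        assert (HL : clim eventually (fun k => De (q * Y - q * Y * RtoC q ^ k)) (De (q * Y))).
        { apply (clim_map eventually (locally (T := C_UniformSpace) (q * Y))
            (fun k => q * Y - q * Y * RtoC q ^ k) De).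
          - apply (proj1 (clim_filterlim eventually _ _) HS).
          - apply Hcont, HqY0. }
        apply (clim_unique eventually _ _ _ HL).
        apply (clim_ext_loc eventually (fun _ => RtoC 0)); [| apply (clim_const eventually)].
        destruct (qn_small ((Cmod Y - q) / Cmod Y)) as [M HM].
        { apply Rdiv_lt_0_compat; lra. }
        exists (S M). intros k Hk. symmetry.
        replace (q * Y - q * Y * RtoC q ^ k) with (q * (Y * RtoC (1 - q ^ k)))
          by (rewrite RtoC_minus, RtoC_pow; ring).
        assert (Hk1 := qn_pos k).
        assert (Hk2 : (q ^ k <= q)%R).
        { destruct k as [|k]; [lia |]. apply qn_S_le_q. }
        assert (Hm : Cmod (Y * RtoC (1 - q ^ k)) = (Cmod Y * (1 - q ^ k))%R)
          by (rewrite Cmod_mult, Cmod_R, Rabs_pos_eq; lra).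
        assert (Hlo : (q <= Cmod Y * (1 - q ^ k))%R).
        { specialize (HM k ltac:(lia)).
          assert (Cmod Y * q ^ k < Cmod Y * ((Cmod Y - q) / Cmod Y))%R
            by (apply Rmult_lt_compat_l; lra).
          replace (Cmod Y * ((Cmod Y - q) / Cmod Y))%R with (Cmod Y - q)%R in * by (field; lra).
          lra. }
        assert (Hhi : (Cmod Y * (1 - q ^ k) < Cmod Y)%R).
        { assert (Cmod Y * (1 - q ^ k) < Cmod Y * 1)%R by (apply Rmult_lt_compat_l; lra). lra. }
        assert (Hsq : (Cmod (Y * RtoC (1 - q ^ k) * (Y * RtoC (1 - q ^ k))) < q)%R).
        { rewrite Cmod_mult, Hm. apply Rlt_le_trans with (Cmod Y * Cmod Y)%R; [| lra].
          apply Rmult_le_0_lt_compat; lra. }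
        apply Hshift.
        * apply Cmod_gt_0. lra.
        * apply Cmod_lt_neq. rewrite Cmod_1. lra.
        * apply Cmod_lt_neq. rewrite (Cmod_R q), Rabs_pos_eq by lra. exact Hsq.
        * lra.
        * unfold De. rewrite HKX; [ring |]. lra. }
  assert (Hsmall : forall X : C, X <> 0 -> (Cmod X <= 1)%R -> De X = 0).
  { intros X HX HX1. destruct (qn_small (Cmod X)) as [n Hn].
    { apply Cmod_gt_0, HX. }
    apply (Hdown n). split; [left; apply Hn; lia | exact HX1]. }
  intros X HX. apply Cminus_eq_0. change (De X = 0).
  destruct (Rle_lt_dec (Cmod X) 1) as [H | H]; [apply Hsmall; assumption |].
  assert (HqX : q / X <> 0).
  { intros E. apply hq. replace (RtoC q) with (q / X * X) by (field; exact HX). rewrite E. ring. }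
  replace (De X) with (- De (q / X)) by (rewrite Hanti by exact HX; ring).
  rewrite Hsmall; [ring | exact HqX |].
  rewrite Cmod_qdiv by exact HX.
  apply (Rmult_le_reg_r (Cmod X)); [lra |]. unfold Rdiv. rewrite Rmult_assoc, Rinv_l; lra.
Qed.

(** * The constant *)

Lemma Phi_cancel (s1 s2 b2 s4 b1 e : C) :
  e <> 0 -> b1 = e * s1 * s2 * s4 ->
  Phi s1 s2 b2 s4 b1 b2 e = qinf b2 * qinf (e * b2) * saal s1 s2 s4 e.
Proof.
  intros He Hb. rewrite saal_Phi by assumption. rewrite <- Hb. unfold Phi.
  assert (HS : forall s1 s2 b2 s4 b1 b3,
    Sg s1 s2 b2 s4 b1 b2 b3 = qinf b2 * Sg s1 s2 s4 0 b1 0 b3).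
  { clear - hq0 hq1. intros s1 s2 b2 s4 b1 b3.
    apply (clim_unique eventually _ _ _ (Sg_clim s1 s2 b2 s4 b1 b2 b3)).
    apply (clim_ext eventually (fun n => qinf b2 * qpsum (sg_term s1 s2 s4 0 b1 0 b3) n)).
    - intros n. unfold qpsum. rewrite <- psum_scal. apply psum_ext. intros k _.
      unfold sg_term. rewrite Cmult_0_l, qpoch_inf_0, qpoch_0.
      rewrite (qpoch_inf_split b2 k). ring.
    - apply (clim_mult eventually); [apply (clim_const eventually) | apply Sg_clim]. }
  rewrite !HS, Cmult_0_r, qpoch_inf_0. ring.
Qed.

(** At [X = d] the parameter [a X] of the numerators of [v] equals the parameter [a d] of its
    denominators. *)
Lemma PhiU_at_d (a b c d N : C) :
  a <> 0 -> c <> 0 -> d <> 0 -> N <> 0 ->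
  PhiU a b d c N d
  = qinf (a * d) * qinf (q * d / c) * (qinf q * qinf (q / (a * c)) * qinf (a * c)
      * (qinf (b * d) * qinf (q / (N * c * d)) * qinf (a * b * N))).
Proof.
  intros Ha Hc Hd HN. unfold PhiU.
  assert (He : q / (a * c) <> 0).
  { intros E. apply hq. replace (RtoC q) with (q / (a * c) * (a * c)) by (field; auto).
    rewrite E. ring. }
  rewrite Phi_cancel; [| exact He | field; auto].
  rewrite q_saalschuetz by exact He.
  replace (q / (a * c) * (a * d)) with (q * d / c) by (field; auto).
  replace (q / (q / (a * c))) with (a * c) by (field; auto).
  replace (q / (a * c) * / N * (a * b * d * c * N / q)) with (b * d) by (field; auto).
  replace (q / (a * c) * / N * (a / d)) with (q / (N * c * d)) by (field; auto).
  replace (q / (a * c) * (a * b * d * c * N / q) * (a / d)) with (a * b * N) by (field; auto).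
  reflexivity.
Qed.

Lemma qpoch_1_S (n : nat) : qpoch q 1 (S n) = 0.
Proof. rewrite qpoch_S_l. ring. Qed.

(** At [X = d/q] the first series of [u] is multiplied by [(1; q)_oo = 0], and the second one
    breaks off after its first term. *)
Lemma PhiU_at_d_div_q (a b c d N : C) :
  a <> 0 -> d <> 0 -> N <> 0 ->
  PhiU a b c d N (d / q)
  = qinf (/ N) * qinf (a * b * c * d * N / q) * qinf (a * q / d) * qinf q
    * qinf (b * q / d) * qinf (q * c / d) * qinf (a * d) * qinf (q / (a * d)).
Proof.
  intros Ha Hd HN. unfold PhiU, Phi.
  set (e := q / (a * d)).
  assert (E3 : e * (a * (d / q)) = 1) by (unfold e; field; auto).
  rewrite E3.
  rewrite (qpoch_inf_eq0 1 0) by (simpl; ring).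
  assert (HS : forall s1 s2 s4 b1 b2 b3, Sg s1 s2 1 s4 b1 b2 b3
             = qinf q * qinf b1 * qinf b2 * qinf b3).
  { clear - hq0 hq1. intros s1 s2 s4 b1 b2 b3.
    assert (E : forall n, qpsum (sg_term s1 s2 1 s4 b1 b2 b3) (S n)
                = qinf q * qinf b1 * qinf b2 * qinf b3).
    { intros n. unfold qpsum. rewrite psum_head, psum_zero.
      - unfold sg_term. simpl. rewrite !Cmult_1_r. ring.
      - intros k _. unfold sg_term. rewrite qpoch_1_S. ring. }
    apply (clim_unique eventually (fun n => qpsum (sg_term s1 s2 1 s4 b1 b2 b3) (S n))).
    - apply clim_succ, Sg_clim.
    - apply (clim_ext eventually _ _ _ (fun n => eq_sym (E n))), (clim_const eventually). }
  rewrite HS.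
  replace (a * (d / q)) with (a * d / q) by (field; auto).
  replace (a / (d / q)) with (a * q / d) by (field; auto).
  replace (e * (a * b)) with (b * q / d) by (unfold e; field; auto).
  replace (e * (a * c)) with (q * c / d) by (unfold e; field; auto).
  rewrite (qpoch_inf_S (a * d / q)), (qpoch_inf_S e).
  replace (a * d / q * q) with (a * d) by (field; auto).
  replace (e * q) with (q * e) by ring.
  replace (1 - e) with (- e * (1 - a * d / q)) by (unfold e; field; auto).
  ring.
Qed.

(** The constant of [casoratian_global] is read off at [X = d], where the second product in
    the Casoratian has the factor [1 - X/d = 0] and the first one is known in closed form. *)
Lemma casoratian_closed_form (a b c d N X : C) :
  a <> 0 -> b <> 0 -> c <> 0 -> d <> 0 -> N <> 0 -> X <> 0 ->
  (Cmod a < 1)%R -> (Cmod b < 1)%R -> (Cmod (q / d) < 1)%R ->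
  qinf (a * d) <> 0 -> qinf (b * d) <> 0 -> q - d * d <> 0 ->
  casoratian a b c d N X
  = - (/ c * (qinf (c / d) * qinf (q * d / c) * qinf (/ N) * qinf (a * b * c * d * N / q)
              * qinf (a * b * N) * qinf (q / (N * c * d)))
       * (qinf q * qinf q * qinf (a * d) * qinf (q / (a * d)) * qinf (a * c) * qinf (q / (a * c))))
    * cas_shape a b X.
Proof.
  intros Ha Hb Hc Hd HN HX Ha1 Hb1 Hqd Had Hbd Hdd.
  destruct (casoratian_global a b c d N Ha Hb Hc Hd HN Ha1 Hb1) as [K HK].
  rewrite (HK X HX). f_equal.
  assert (HFd := HK d Hd).
  assert (Hsm : forall k, (Cmod k < 1)%R -> qinf (k * q / d) <> 0).
  { intros k Hk. apply qpoch_inf_small_neq0.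
    replace (k * q / d) with (k * (q / d)) by (field; exact Hd). rewrite Cmod_mult.
    apply Rle_lt_trans with (1 * Cmod (q / d))%R; [| lra].
    apply Rmult_le_compat_r; [apply Cmod_ge_0 | lra]. }
  assert (Haq := Hsm a Ha1). assert (Hbq := Hsm b Hb1).
  set (T := qinf (a * d) * qinf (a * q / d) * qinf (b * d) * qinf (b * q / d)).
  assert (HT : T <> 0) by (unfold T; repeat apply Cmult_neq_0; assumption).
  assert (HE : cas_shape a b d = (d * d - q) / d * T) by (unfold cas_shape, cas_zeros, T; field; exact Hd).
  assert (HF : casoratian a b c d N d
    = (d * d - q) / (d * d) * (1 - d / c) * PhiU a b c d N (d / q) * PhiU a b d c N d).
  { unfold casoratian. replace (1 - d / d) with (RtoC 0) by (field; exact Hd). field. auto. }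
  rewrite HE, HF, PhiU_at_d_div_q, PhiU_at_d in HFd by assumption.
  assert (Hdd' : d * d - q <> 0).
  { intros E. apply Hdd. transitivity (- (d * d - q)); [ring | rewrite E; ring]. }
  transitivity (K * ((d * d - q) / d * T) / ((d * d - q) / d * T)).
  { field. auto. }
  rewrite <- HFd. rewrite (qpoch_inf_S (c / d)).
  replace (c / d * q) with (q * c / d) by (field; exact Hd).
  unfold T. field. repeat split; assumption.
Qed.

(** * The function [u] *)

Lemma qpow_plus (z w : C) : qpow q (z + w) = qpow q z * qpow q w.
Proof.
  destruct z as [z1 z2], w as [w1 w2]. unfold qpow, Cmult, Cplus, Re, Im, RtoC. simpl.
  replace ((z1 + w1) * ln q - (z2 + w2) * 0)%R
    with ((z1 * ln q - z2 * 0) + (w1 * ln q - w2 * 0))%R by ring.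
  replace ((z1 + w1) * 0 + (z2 + w2) * ln q)%R
    with ((z1 * 0 + z2 * ln q) + (w1 * 0 + w2 * ln q))%R by ring.
  set (x := (z1 * ln q - z2 * 0)%R). set (x' := (w1 * ln q - w2 * 0)%R).
  set (y := (z1 * 0 + z2 * ln q)%R). set (y' := (w1 * 0 + w2 * ln q)%R).
  rewrite (exp_plus x x'), (cos_plus y y'), (sin_plus y y'). f_equal; ring.
Qed.

Lemma qpow_1 : qpow q 1 = q.
Proof.
  unfold qpow, Cmult, Re, Im, RtoC. simpl.
  replace (1 * ln q - 0 * 0)%R with (ln q) by ring.
  replace (1 * 0 + 0 * ln q)%R with 0%R by ring.
  rewrite cos_0, sin_0, exp_ln by exact hq0. f_equal; ring.
Qed.

Lemma qpow_0 : qpow q 0 = 1.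
Proof.
  unfold qpow, Cmult, Re, Im, RtoC. simpl.
  replace (0 * ln q - 0 * 0)%R with 0%R by ring.
  replace (0 * 0 + 0 * ln q)%R with 0%R by ring.
  rewrite cos_0, sin_0, exp_0. f_equal; ring.
Qed.

Lemma qpow_opp_l (z : C) : qpow q (- z) * qpow q z = 1.
Proof. rewrite <- qpow_plus, <- qpow_0. f_equal. ring. Qed.

Lemma qpow_neq0 (z : C) : qpow q z <> 0.
Proof.
  intros E. apply C1_nz. rewrite <- (qpow_opp_l z), E. ring.
Qed.

Lemma qpow_opp (z : C) : qpow q (- z) = / qpow q z.
Proof.
  transitivity (qpow q (- z) * qpow q z / qpow q z).
  - field. apply qpow_neq0.
  - rewrite qpow_opp_l. field. apply qpow_neq0.
Qed.

Lemma qpow_1_plus (z : C) : qpow q (1 + z) = q * qpow q z.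
Proof. rewrite qpow_plus, qpow_1. reflexivity. Qed.

Lemma qpow_1_minus (z : C) : qpow q (1 - z) = q / qpow q z.
Proof.
  unfold Cminus. rewrite qpow_plus, qpow_1, qpow_opp. reflexivity.
Qed.

Lemma qpow_minus_1 (z : C) : qpow q (z - 1) = qpow q z / q.
Proof.
  unfold Cminus. rewrite qpow_plus, qpow_opp, qpow_1. reflexivity.
Qed.

Lemma phi43_Sg (s1 s2 s3 s4 b1 b2 b3 : C) :
  (forall k, 1 - b1 * RtoC q ^ k <> 0) -> (forall k, 1 - b2 * RtoC q ^ k <> 0) ->
  (forall k, 1 - b3 * RtoC q ^ k <> 0) ->
  phi43 q s1 s2 s3 s4 b1 b2 b3 q
  = Sg s1 s2 s3 s4 b1 b2 b3 / (qinf q * qinf b1 * qinf b2 * qinf b3).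
Proof.
  intros H1 H2 H3. unfold phi43.
  assert (N1 := qpoch_inf_neq0 b1 H1).
  assert (N2 := qpoch_inf_neq0 b2 H2).
  assert (N3 := qpoch_inf_neq0 b3 H3).
  assert (Nq := qinf_q_neq0).
  apply Csum_unique.
  apply (clim_ext eventually (fun n => qpsum (sg_term s1 s2 s3 s4 b1 b2 b3) n
           / (qinf q * qinf b1 * qinf b2 * qinf b3))).
  - intros n. unfold Cdiv. rewrite Cmult_comm. unfold qpsum. rewrite <- psum_scal.
    apply psum_ext. intros k _.
    assert (P1 := qpoch_neq0 b1 k H1). assert (P2 := qpoch_neq0 b2 k H2).
    assert (P3 := qpoch_neq0 b3 k H3).
    assert (Pq : qpoch q q k <> 0)
      by (apply qpoch_neq0; intros j; apply factor_neq0_small, Cmod_q_lt1).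
    cbv [qpochs Cprod map fold_right]. unfold sg_term.
    rewrite (qpoch_inf_split b1 k) in N1 |- *.
    rewrite (qpoch_inf_split b2 k) in N2 |- *.
    rewrite (qpoch_inf_split b3 k) in N3 |- *.
    rewrite (qpoch_inf_split q k) in Nq |- *.
    assert (Hr : forall u v : C, u * v <> 0 -> v <> 0)
      by (intros u v Huv E; apply Huv; rewrite E; ring).
    apply Hr in N1. apply Hr in N2. apply Hr in N3. apply Hr in Nq.
    field. repeat split; assumption.
  - apply (clim_mult eventually); [apply Sg_clim | apply (clim_const eventually)].
Qed.

(** The factor [(q/(ad); q)_oo] of the denominator of [u] is kept apart: it may vanish at the
    parameters of the theorem, whereas [Uden] does not. *)
Definition Uden (a b c d X : C) : C :=
  qinf q * qinf (a * b) * qinf (a * c) * qinf (b * c) * qinf (a * d)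
  * (qinf (q * X / d) * qinf (q / (d * X))).

Lemma u_formula_Phi (nu a b c d z : C) :
  u_regular q a b c d z ->
  u_formula q nu a b c d z
  = PhiU a b c d (qpow q nu) (qpow q z)
    / (Uden a b c d (qpow q z) * qinf (q / (a * d))).
Proof.
  intros [Ha [Hd HF]]. rewrite !List.Forall_cons_iff in HF.
  destruct HF as [R1 [R2 [R3 [R4 [R5 [R6 [R7 [R8 [R9 [R10 [R11 _]]]]]]]]]]].
  assert (HX := qpow_neq0 z). assert (HN := qpow_neq0 nu).
  unfold u_formula.
  rewrite !qpow_1_plus, !qpow_1_minus, !qpow_opp, !qpow_minus_1 in *.
  set (X := qpow q z) in *. set (N := qpow q nu) in *.
  rewrite !phi43_Sg by assumption.
  assert (He : a * d - q <> 0).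
  { intros E. apply (R2 O). simpl. apply Cminus_eq_0 in E. rewrite E. field. exact hq. }
  assert (Z := qpoch_inf_neq0).
  apply Z in R1. apply Z in R3. apply Z in R4. apply Z in R5. apply Z in R7. apply Z in R8.
  apply Z in R9. apply Z in R10. apply Z in R11. clear R2 R6 Z.
  assert (Nq := qinf_q_neq0).
  cbv [qpochs_inf Cprod map fold_right]. unfold PhiU, Phi, Uden.
  replace (q / (q / (a * d))) with (a * d) by (field; auto).
  replace (q / (a * d) * / N) with (q / N / (a * d)) by (field; auto).
  replace (q / (a * d) * (a * b * c * d * N / q)) with (b * c * N) by (field; auto).
  replace (q / (a * d) * (a * X)) with (q * X / d) by (field; auto).
  replace (q / (a * d) * (a / X)) with (q / X / d) by (field; auto).
  replace (q / (a * d) * (a * b)) with (q * b / d) by (field; auto).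
  replace (q / (a * d) * (a * c)) with (q * c / d) by (field; auto).
  replace (q * (q / (a * d))) with (RtoC q ^ 2 / (a * d)) by (simpl; field; auto).
  replace (q / (d * X)) with (q / X / d) by (field; auto).
  replace (a * b * c * d * (N / q)) with (a * b * c * d * N / q) by (field; auto).
  replace (a * / X) with (a / X) by reflexivity.
  assert (S1 : qinf (q / (a * d)) = (1 - q / (a * d)) * qinf (RtoC q ^ 2 / (a * d))).
  { rewrite (qpoch_inf_S (q / (a * d))). do 2 f_equal. simpl. field. auto. }
  assert (S2 : qinf (a * d / q) = (1 - a * d / q) * qinf (a * d)).
  { rewrite (qpoch_inf_S (a * d / q)). do 2 f_equal. field. auto. }
  rewrite S1, S2.
  repeat match goal with |- context [qinf ?w] => generalize dependent (qinf w) end.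
  repeat match goal with |- context [Sg ?s1 ?s2 ?s3 ?s4 ?b1 ?b2 ?b3] =>
    generalize (Sg s1 s2 s3 s4 b1 b2 b3) end.
  intros. field. nz.
Qed.

(** When [q/e = q^(k+1)] the two lattices of summation overlap, the first [k] terms of the
    second series vanish, and the remaining ones cancel against the first series. *)
Lemma Phi_vanish (s1 s2 s3 s4 b1 b2 e : C) (k : nat) :
  e * RtoC q ^ k = 1 -> Phi s1 s2 s3 s4 b1 b2 e = 0.
Proof.
  intros He.
  assert (Hqk : RtoC q ^ k <> 0) by (apply Cpow_nz, hq).
  assert (He0 : e <> 0) by (intros E; apply C1_nz; rewrite <- He, E; ring).
  assert (Hx : forall x, e * x * RtoC q ^ k = x)
    by (intros x; transitivity (e * RtoC q ^ k * x); [ring | rewrite He; ring]).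
  set (p := qpoch q (e * s1) k * qpoch q (e * s2) k * qpoch q (e * s3) k * qpoch q (e * s4) k).
  assert (HS : Sg (e * s1) (e * s2) (e * s3) (e * s4) (e * b1) (e * b2) (q * e)
               = RtoC q ^ k * p * Sg s1 s2 s3 s4 b1 b2 (q / e)).
  { set (f := sg_term (e * s1) (e * s2) (e * s3) (e * s4) (e * b1) (e * b2) (q * e)).
    set (g := sg_term s1 s2 s3 s4 b1 b2 (q / e)).
    assert (Hlow : forall n, (n < k)%nat -> f n = 0).
    { intros n Hn. unfold f, sg_term.
      rewrite (qpoch_inf_eq0 (q * e * RtoC q ^ n) (k - 1 - n)); [ring |].
      transitivity (1 - e * RtoC q ^ k); [| rewrite He; ring].
      replace k with (S (n + (k - 1 - n))) at 2 by lia.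
      rewrite Cpow_S, Cpow_add_r. ring. }
    assert (Hhigh : forall n, f (k + n)%nat = p * g n).
    { intros n. unfold f, g, sg_term, p. rewrite !qpoch_add, !Hx, !Cpow_add_r.
      replace (q * (RtoC q ^ k * RtoC q ^ n)) with (q / e * RtoC q ^ n).
      2:{ transitivity (q / e * (e * RtoC q ^ k) * RtoC q ^ n);
            [rewrite He; ring | field; exact He0]. }
      replace (e * b1 * (RtoC q ^ k * RtoC q ^ n)) with (b1 * RtoC q ^ n)
        by (rewrite <- (Hx b1) at 1; ring).
      replace (e * b2 * (RtoC q ^ k * RtoC q ^ n)) with (b2 * RtoC q ^ n)
        by (rewrite <- (Hx b2) at 1; ring).
      replace (q * e * (RtoC q ^ k * RtoC q ^ n)) with (q * RtoC q ^ n).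
      2:{ transitivity (q * (e * RtoC q ^ k) * RtoC q ^ n); [rewrite He; ring | ring]. }
      ring. }
    apply (clim_unique eventually (fun n => qpsum f (k + n))).
    - apply clim_seq_shift, Sg_clim.
    - apply (clim_ext eventually (fun n => RtoC q ^ k * p * qpsum g n)).
      + intros n. unfold qpsum. rewrite psum_split, <- psum_scal, (psum_zero _ k).
        * rewrite Cplus_0_l. apply psum_ext. intros j _. rewrite Hhigh, Cpow_add_r. ring.
        * intros j Hj. rewrite (Hlow j Hj). ring.
      + apply (clim_mult eventually); [apply (clim_const eventually) | apply Sg_clim]. }
  assert (Hs : forall s, qinf (e * s) = qpoch q (e * s) k * qinf s)
    by (intros s; rewrite (qpoch_inf_split (e * s) k), Hx; reflexivity).
  unfold Phi. rewrite HS, (Hs s1), (Hs s2), (Hs s3), (Hs s4). unfold p.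
  transitivity ((1 - e * RtoC q ^ k) *
    (qpoch q (e * s1) k * qinf s1 * (qpoch q (e * s2) k * qinf s2) * (qpoch q (e * s3) k * qinf s3)
     * (qpoch q (e * s4) k * qinf s4) * Sg s1 s2 s3 s4 b1 b2 (q / e))); [ring |].
  rewrite He. ring.
Qed.

Lemma not_qpoch_inf_neq0 (x : C) : qinf x = 0 -> exists k, 1 - x * RtoC q ^ k = 0.
Proof.
  intros H. apply NNPP. intros Hn. apply (qpoch_inf_neq0 x); [| exact H].
  intros k E. apply Hn. exists k. exact E.
Qed.

Section Limit.
Context {T : Type} (F : (T -> Prop) -> Prop) {HF : ProperFilter F}.
Context (N X : C) (hX : X <> 0).
Context (fa fb fc fd : T -> C) (a b c d : C).
Context (ha : a <> 0) (hd : d <> 0).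
Context (La : clim F fa a) (Lb : clim F fb b) (Lc : clim F fc c) (Ld : clim F fd d).

Let fe := fun t => q / (fa t * fd t).
Let e := q / (a * d).

Let had : a * d <> 0.
Proof. apply Cmult_neq_0; assumption. Qed.

Lemma fe_clim : clim F fe e.
Proof.
  apply (clim_div F); [apply (clim_const F) | apply (clim_mult F); assumption | exact had].
Qed.

Lemma e_neq0 : e <> 0.
Proof.
  intros E. apply hq. replace (RtoC q) with (e * (a * d)) by (unfold e; field; auto).
  rewrite E. ring.
Qed.

Lemma PhiU_clim : clim F (fun t => PhiU (fa t) (fb t) (fc t) (fd t) N X) (PhiU a b c d N X).
Proof.
  assert (Hm := clim_mult F). assert (Hc := clim_const F).
  unfold PhiU. apply (clim_Phi F).
  - apply Hc.
  - repeat apply Hm; auto.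
  - apply Hm; auto.
  - apply Hm; auto.
  - apply Hm; auto.
  - apply Hm; auto.
  - exact fe_clim.
  - exact e_neq0.
Qed.

(** At [e = q^(-k)] the zero of [Phi] cancels the zero of [(e; q)_oo]. *)
Lemma PhiU_quotient_clim (k : nat) :
  e * RtoC q ^ k = 1 -> F (fun t => fe t <> e) -> F (fun t => fa t <> 0 /\ fd t <> 0) ->
  exists l, clim F (fun t => PhiU (fa t) (fb t) (fc t) (fd t) N X / (fe t - e)) l.
Proof.
  intros Hk Hne Hnz.
  set (D := fun t => (Cmod (fa t) <= Cmod a + 1)%R /\ (Cmod (fb t) <= Cmod b + 1)%R
                     /\ (Cmod (fc t) <= Cmod c + 1)%R).
  assert (HD : F D) by (repeat apply filter_and; apply (clim_bounded F); assumption).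
  set (oa := optf fa a). set (ob := optf fb b). set (oc := optf fc c).
  assert (Ka : climK F D oa)
    by (apply (climK_optf F D fa a (Cmod a + 1)); [exact La | lra | intros t Ht; apply Ht]).
  assert (Kb : climK F D ob)
    by (apply (climK_optf F D fb b (Cmod b + 1)); [exact Lb | lra | intros t Ht; apply Ht]).
  assert (Kc : climK F D oc)
    by (apply (climK_optf F D fc c (Cmod c + 1)); [exact Lc | lra | intros t Ht; apply Ht]).
  set (f := fun w : option T * C => Phi (/ N) (ob (fst w) * oc (fst w) * N * / snd w)
    (oa (fst w) * X) (oa (fst w) / X) (oa (fst w) * ob (fst w)) (oa (fst w) * oc (fst w)) (snd w)).
  assert (He := e_neq0). assert (Hep := proj1 (Cmod_gt_0 e) He).
  assert (HKc := climK_calg F D HD).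
  destruct (removable_limit F D HD (Cmod e / 2) (2 * Cmod e) f fe e) as [l Hl].
  - lra.
  - lra.
  - assert (HKL := clLP_calg HKc (fun Y => Cmod e / 2 <= Cmod Y <= 2 * Cmod e)%R
      (Cmod e / 2) (2 * Cmod e) ltac:(lra) (fun Y HY => HY)).
    assert (Co : forall o, climK F D o -> clLP (DP := optD D) (Kc := climK F D)
      (fun Y => Cmod e / 2 <= Cmod Y <= 2 * Cmod e)%R (fun w => o (fst w)))
      by (intros o Ho; apply LP_clLP, LP_coef, Ho).
    assert (Ck := calg_const HKL). assert (Cm := calg_mult HKL).
    assert (Ca := Co oa Ka). assert (Cb := Co ob Kb). assert (Cc := Co oc Kc).
    assert (Ce : clLP (DP := optD D) (Kc := climK F D)
      (fun Y => Cmod e / 2 <= Cmod Y <= 2 * Cmod e)%R (fun w => / snd w))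
      by (apply LP_clLP, LP_inv).
    apply (calg_Phi HKL (fun _ => / N)
      (fun w => ob (fst w) * oc (fst w) * N * / snd w)
      (fun w => oa (fst w) * X) (fun w => oa (fst w) / X)
      (fun w => oa (fst w) * ob (fst w)) (fun w => oa (fst w) * oc (fst w)) (fun w => snd w)).
    + apply Ck.
    + repeat apply (Cm (fun w => _)); auto.
    + apply (Cm (fun w => oa (fst w))); auto.
    + apply (Cm (fun w => oa (fst w))); auto.
    + apply (Cm (fun w => oa (fst w))); auto.
    + apply (Cm (fun w => oa (fst w))); auto.
    + apply LP_clLP, LP_X.
    + exact Ce.
  - intros o _. unfold f. simpl. apply (Phi_vanish _ _ _ _ _ _ _ k Hk).
  - exact fe_clim.
  - exact Hne.
  - exists l. apply (clim_ext_loc F (fun t => f (Some t, fe t) / (fe t - e))); [| exact Hl].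
    generalize Hnz. apply filter_imp. intros t [H1 H2].
    unfold f, PhiU. simpl. fold (fe t).
    do 2 f_equal. unfold fe. field. auto.
Qed.

Lemma Uden_clim :
  clim F (fun t => Uden (fa t) (fb t) (fc t) (fd t) X) (Uden a b c d X).
Proof.
  assert (Hm := clim_mult F). assert (Hc := clim_const F).
  assert (Hp := clim_qpoch_inf F).
  unfold Uden. repeat apply Hm; try apply Hc; try (apply Hp, Hm; assumption).
  - apply Hp, (clim_div F); auto.
  - apply Hp, (clim_div F); auto. apply Cmult_neq_0; assumption.
Qed.

Lemma u_quotient_clim :
  Uden a b c d X <> 0 ->
  F (fun t => fa t <> 0 /\ fd t <> 0 /\ forall k, 1 - fe t * RtoC q ^ k <> 0) ->
  exists l, clim F (fun t => PhiU (fa t) (fb t) (fc t) (fd t) N X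
                / (Uden (fa t) (fb t) (fc t) (fd t) X * qinf (fe t))) l /\
    (qinf e <> 0 -> l = PhiU a b c d N X / (Uden a b c d X * qinf e)).
Proof.
  intros HU Hreg.
  assert (He := clim_qpoch_inf F fe e fe_clim).
  destruct (Ceq_dec (qinf e) 0) as [E | Hn].
  - destruct (not_qpoch_inf_neq0 e E) as [k Hk].
    apply Cminus_eq_0 in Hk. symmetry in Hk.
    destruct (PhiU_quotient_clim k Hk) as [l Hl].
    { generalize Hreg. apply filter_imp. intros t [_ [_ H]] Et. apply (H k).
      rewrite Et, Hk. ring. }
    { generalize Hreg. apply filter_imp. intros t [H1 [H2 _]]. auto. }
    (* the cofactor of (1 - e q^k) in (e; q)_oo *)
    set (m := fun x => - RtoC q ^ k * qpoch q x k * qinf (x * RtoC q ^ S k)).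
    assert (Hm : clim F (fun t => m (fe t)) (m e)).
    { unfold m. repeat apply (clim_mult F); try apply (clim_const F).
      - assert (Hq : forall n, clim F (fun t => qpoch q (fe t) n) (qpoch q e n)).
        { induction n as [|n IH]; simpl; [apply (clim_const F) |].
          apply (clim_mult F); [exact IH |]. apply (clim_minus F); [apply (clim_const F) |].
          apply (clim_mult F); [exact fe_clim | apply (clim_const F)]. }
        apply Hq.
      - apply (clim_qpoch_inf F (fun t => fe t * RtoC q ^ S k)).
        apply (clim_mult F); [exact fe_clim | apply (clim_const F)]. }
    assert (Hme : m e <> 0).
    { assert (Hqk : RtoC q ^ k <> 0) by (apply Cpow_nz, hq).
      unfold m. repeat apply Cmult_neq_0.
      - intros E'. apply Hqk. transitivity (- - RtoC q ^ k); [ring | rewrite E'; ring].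
      - assert (Hj : forall n, (n <= k)%nat -> qpoch q e n <> 0).
        { induction n as [|n IH]; intros Hn; simpl; [apply C1_nz |].
          apply Cmult_neq_0; [apply IH; lia |]. intros E'. apply Cminus_eq_0 in E'.
          assert (H1 : RtoC q ^ (k - n) = 1).
          { transitivity (e * RtoC q ^ n * RtoC q ^ (k - n)); [rewrite <- E'; ring |].
            transitivity (e * RtoC q ^ k); [| exact Hk].
            replace k with (n + (k - n))%nat at 2 by lia. rewrite Cpow_add_r. ring. }
          apply (f_equal Cmod) in H1. rewrite Cmod_qn, Cmod_1 in H1.
          assert (Hle := qn_S_le_q (k - n - 1)).
          replace (S (k - n - 1)) with (k - n)%nat in Hle by lia. lra. }
        apply Hj. lia.
      - replace (e * RtoC q ^ S k) with (RtoC q).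
        + apply qinf_q_neq0.
        + transitivity (q * (e * RtoC q ^ k)); [rewrite Hk; ring | rewrite Cpow_S; ring]. }
    exists (l / (Uden a b c d X * m e)). split; [| intros H; exfalso; exact (H E)].
    apply (clim_ext_loc F (fun t => PhiU (fa t) (fb t) (fc t) (fd t) N X / (fe t - e)
              / (Uden (fa t) (fb t) (fc t) (fd t) X * m (fe t)))).
    + assert (HU' := clim_nonzero F _ _ Uden_clim HU).
      assert (Hm' := clim_nonzero F _ _ Hm Hme).
      generalize (filter_and _ _ Hreg (filter_and _ _ HU' Hm')). apply filter_imp.
      intros t [[_ [_ Ht]] [Hu Hmt]].
      assert (Hd : fe t - e <> 0).
      { intros Et. apply Cminus_eq_0 in Et. apply (Ht k). rewrite Et, Hk. ring. }
      assert (Hsp : qinf (fe t) = (fe t - e) * m (fe t)).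
      { rewrite (qpoch_inf_split (fe t) (S k)). unfold m.
        change (qpoch q (fe t) (S k)) with (qpoch q (fe t) k * (1 - fe t * RtoC q ^ k)).
        replace (1 - fe t * RtoC q ^ k) with (- RtoC q ^ k * (fe t - e)); [ring |].
        transitivity (e * RtoC q ^ k - fe t * RtoC q ^ k); [ring | rewrite Hk; reflexivity]. }
      rewrite Hsp. field. auto.
    + apply (clim_div F); [exact Hl | | apply Cmult_neq_0; assumption].
      apply (clim_mult F); [exact Uden_clim | exact Hm].
  - exists (PhiU a b c d N X / (Uden a b c d X * qinf e)). split; [| auto].
    apply (clim_div F); [exact PhiU_clim | | apply Cmult_neq_0; assumption].
    apply (clim_mult F); [exact Uden_clim | exact He].
Qed.

End Limit.

Definition u_reg_filter (a b c d z : C) : (C * C * C * C -> Prop) -> Prop :=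
  within (fun p : C * C * C * C => let '(a', b', c', d') := p in u_regular q a' b' c' d' z)
    (locally (a, b, c, d)).

Lemma u_fun_limit (nu a b c d z : C) :
  ProperFilter (u_reg_filter a b c d z) ->
  a <> 0 -> d <> 0 -> Uden a b c d (qpow q z) <> 0 ->
  clim (u_reg_filter a b c d z)
    (fun p => let '(a', b', c', d') := p in u_formula q nu a' b' c' d' z)
    (u_fun q nu a b c d z).
Proof.
  intros HP Ha Hd HU. set (F := u_reg_filter a b c d z) in *.
  assert (Hid : filterlim (fun p : C * C * C * C => p) F (locally (a, b, c, d))).
  { intros P HPl. unfold filtermap, F, u_reg_filter, within.
    apply (filter_imp P); [auto | exact HPl]. }
  assert (L4 : clim F (fun p => snd p) d).
  { apply (clim_filterlim F). eapply filterlim_comp; [exact Hid |].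
    apply (continuous_snd (U := prod_UniformSpace (prod_UniformSpace C_UniformSpace C_UniformSpace)
      C_UniformSpace) (V := C_UniformSpace) (a, b, c) d). }
  assert (L3 : clim F (fun p => snd (fst p)) c).
  { apply (clim_filterlim F). eapply filterlim_comp; [| apply (continuous_snd
      (U := prod_UniformSpace C_UniformSpace C_UniformSpace) (V := C_UniformSpace) (a, b) c)].
    eapply filterlim_comp; [exact Hid |].
    apply (continuous_fst (U := prod_UniformSpace (prod_UniformSpace C_UniformSpace C_UniformSpace)
      C_UniformSpace) (V := C_UniformSpace) (a, b, c) d). }
  assert (L12 : filterlim (fun p : C * C * C * C => fst (fst p)) F (locally (a, b))).
  { eapply filterlim_comp; [| apply (continuous_fst
      (U := prod_UniformSpace C_UniformSpace C_UniformSpace) (V := C_UniformSpace) (a, b) c)].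
    eapply filterlim_comp; [exact Hid |].
    apply (continuous_fst (U := prod_UniformSpace (prod_UniformSpace C_UniformSpace C_UniformSpace)
      C_UniformSpace) (V := C_UniformSpace) (a, b, c) d). }
  assert (L2 : clim F (fun p => snd (fst (fst p))) b).
  { apply (clim_filterlim F). eapply filterlim_comp; [exact L12 |].
    apply (continuous_snd (U := C_UniformSpace) (V := C_UniformSpace) a b). }
  assert (L1 : clim F (fun p => fst (fst (fst p))) a).
  { apply (clim_filterlim F). eapply filterlim_comp; [exact L12 |].
    apply (continuous_fst (U := C_UniformSpace) (V := C_UniformSpace) a b). }
  assert (Hreg : F (fun p => let '(a', b', c', d') := p in u_regular q a' b' c' d' z)).
  { unfold F, u_reg_filter, within. apply filter_forall.
    intros [[[a' b'] c'] d'] Hp. exact Hp. }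
  destruct (u_quotient_clim F (qpow q nu) (qpow q z) (qpow_neq0 z)
    (fun p => fst (fst (fst p))) (fun p => snd (fst (fst p))) (fun p => snd (fst p))
    (fun p => snd p) a b c d Ha Hd L1 L2 L3 L4 HU) as [l [Hl Heq]].
  { generalize Hreg. apply filter_imp. intros [[[a' b'] c'] d'] [H1 [H2 HR]]. simpl.
    rewrite !List.Forall_cons_iff in HR. split; [exact H1 |]. split; [exact H2 |]. apply HR. }
  assert (Hlim : clim F
    (fun p => let '(a', b', c', d') := p in u_formula q nu a' b' c' d' z) l).
  { eapply (clim_ext_loc F); [| exact Hl]. generalize Hreg. apply filter_imp.
    intros [[[a' b'] c'] d'] HR. simpl. symmetry. apply u_formula_Phi, HR. }
  replace (u_fun q nu a b c d z) with l; [exact Hlim |].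
  symmetry. unfold u_fun. apply (iota_unique (V := C_CompleteNormedModule)).
  - intros w [[HR Hw] | [HR Hw]].
    + rewrite Hw, (u_formula_Phi _ _ _ _ _ _ HR). symmetry. apply Heq.
      destruct HR as [_ [_ HR]]. rewrite !List.Forall_cons_iff in HR.
      apply qpoch_inf_neq0, HR.
    + apply (clim_unique F _ _ _ (proj2 (clim_filterlim F _ _) Hw) Hlim).
  - destruct (classic (u_regular q a b c d z)) as [HR | HR].
    + left. split; [exact HR |]. rewrite (u_formula_Phi _ _ _ _ _ _ HR). apply Heq.
      destruct HR as [_ [_ HR]]. rewrite !List.Forall_cons_iff in HR.
      apply qpoch_inf_neq0, HR.
    + right. split; [exact HR |]. apply (proj1 (clim_filterlim F _ _) Hlim).
Qed.

(** * The Wronskian at regular points *)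

(** The value of the Wronskian, with [N = q^nu] and [X = q^z]. *)
Definition Wrhs (a b c d N X : C) : C :=
  2 * q * (qinf (c / d) * qinf (q * d / c) * qinf (/ N) * qinf (a * b * c * d * N / q)
           * qinf (a * b * N) * qinf (q / N / (c * d)))
  / ((1 - q) * c * (qinf (a * b) * qinf (a * b) * qinf (a * c) * qinf (a * d)
                    * qinf (b * c) * qinf (b * d)))
  * (qinf (a * X) * qinf (a * (q / X)) * qinf (b * X) * qinf (b * (q / X))
     / (qinf (X / c) * qinf (q / X / c) * (qinf (X / d) * qinf (q / X / d)))).

Lemma xz_diff (z : C) :
  xz q z - xz q (z - 1)
  = (1 - q) * (q - qpow q z * qpow q z) / (2 * q * qpow q z).
Proof.
  unfold xz. rewrite !qpow_opp, qpow_minus_1.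
  assert (HX := qpow_neq0 z). field. auto.
Qed.

Lemma wronskian_regular (nu a b c d z : C) :
  a <> 0 -> b <> 0 -> c <> 0 -> d <> 0 ->
  (Cmod a < 1)%R -> (Cmod b < 1)%R -> (Cmod (q / d) < 1)%R -> q - d * d <> 0 ->
  xz q z <> xz q (z - 1) ->
  u_regular q a b c d z -> u_regular q a b c d (z - 1) ->
  u_regular q a b d c z -> u_regular q a b d c (z - 1) ->
  u_formula q nu a b c d z
    * ((u_formula q nu a b d c z - u_formula q nu a b d c (z - 1)) / (xz q z - xz q (z - 1)))
  - u_formula q nu a b d c z
    * ((u_formula q nu a b c d z - u_formula q nu a b c d (z - 1)) / (xz q z - xz q (z - 1)))
  = Wrhs a b c d (qpow q nu) (qpow q z).
Proof.
  intros Ha Hb Hc Hd Ha1 Hb1 Hqd Hdd Hx R1 R0 S1 S0.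
  rewrite !u_formula_Phi by assumption.
  assert (HX := qpow_neq0 z). assert (HN := qpow_neq0 nu).
  assert (Hdx : xz q z - xz q (z - 1) <> 0) by (intros E; apply Hx, Cminus_eq_0, E).
  rewrite xz_diff in Hdx |- *.
  destruct R1 as [_ [_ R1]]. destruct R0 as [_ [_ R0]].
  destruct S1 as [_ [_ S1]]. destruct S0 as [_ [_ S0]].
  rewrite !List.Forall_cons_iff in R1, R0, S1, S0.
  destruct R1 as [Rbc [Re [Rab [Rac [Rad [_ [RX1 [RX2 _]]]]]]]].
  destruct R0 as [_ [_ [_ [_ [_ [_ [RX3 [RX4 _]]]]]]]].
  destruct S1 as [Rbd [Rf [_ [_ [_ [_ [SX1 [SX2 _]]]]]]]].
  destruct S0 as [_ [_ [_ [_ [_ [_ [SX3 [SX4 _]]]]]]]].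
  rewrite ?qpow_1_plus, ?qpow_1_minus, ?qpow_minus_1 in *.
  set (X := qpow q z) in *. set (N := qpow q nu) in *.
  assert (Z := qpoch_inf_neq0).
  apply Z in Rbc, Re, Rab, Rac, Rad, RX1, RX2, RX3, RX4, Rbd, Rf, SX1, SX2, SX3, SX4. clear Z.
  assert (Nq := qinf_q_neq0).
  replace (q * (X / q) / d) with (X / d) in RX3 by (field; auto).
  replace (q * (X / q) / c) with (X / c) in SX3 by (field; auto).
  replace (q / (X / q) / d) with (q / X / d * q) in RX4 by (field; auto).
  replace (q / (X / q) / c) with (q / X / c * q) in SX4 by (field; auto).
  assert (Ed1 : qinf (X / d) = (1 - X / d) * qinf (q * X / d)).
  { rewrite (qpoch_inf_S (X / d)). do 2 f_equal. field. auto. }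
  assert (Ec1 : qinf (X / c) = (1 - X / c) * qinf (q * X / c)).
  { rewrite (qpoch_inf_S (X / c)). do 2 f_equal. field. auto. }
  assert (Ed2 := qpoch_inf_S (q / X / d)).
  assert (Ec2 := qpoch_inf_S (q / X / c)).
  assert (Fd1 : 1 - X / d <> 0) by (rewrite Ed1 in RX3; apply (Cmult_neq0_l _ _ RX3)).
  assert (Fc1 : 1 - X / c <> 0) by (rewrite Ec1 in SX3; apply (Cmult_neq0_l _ _ SX3)).
  assert (Fd2 : 1 - q / X / d <> 0) by (rewrite Ed2 in RX2; apply (Cmult_neq0_l _ _ RX2)).
  assert (Fc2 : 1 - q / X / c <> 0) by (rewrite Ec2 in SX2; apply (Cmult_neq0_l _ _ SX2)).
  assert (Hqx : q - X * X <> 0).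
  { intros E. apply Hdx. rewrite E. unfold Cdiv. ring. }
  assert (H1q := C1mq_neq0).
  assert (HF := casoratian_closed_form a b c d N X Ha Hb Hc Hd HN HX Ha1 Hb1 Hqd Rad Rbd Hdd).
  set (dx := (1 - q) * (q - X * X) / (2 * q * X)) in *.
  transitivity (casoratian a b c d N X / dx
    / (qinf q * qinf (a * b) * qinf (a * c) * qinf (b * c) * qinf (a * d) * qinf (q / (a * d))
       * (qinf q * qinf (a * b) * qinf (a * d) * qinf (b * d) * qinf (a * c) * qinf (q / (a * c)))
       * (qinf (X / c) * qinf (q / X / c) * (qinf (X / d) * qinf (q / X / d))))).
  - unfold casoratian, Uden.
    replace (q * (X / q) / d) with (X / d) by (field; auto).
    replace (q * (X / q) / c) with (X / c) by (field; auto).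
    replace (q / (d * (X / q))) with (q / X / d * q) by (field; auto).
    replace (q / (c * (X / q))) with (q / X / c * q) by (field; auto).
    replace (q / (d * X)) with (q / X / d) by (field; auto).
    replace (q / (c * X)) with (q / X / c) by (field; auto).
    replace (q / (X * d)) with (q / X / d) by (field; auto).
    replace (q / (X * c)) with (q / X / c) by (field; auto).
    rewrite Ed1, Ec1, Ed2, Ec2.
    replace (q / X / d) with (q / (X * d)) in Fd2 by (field; auto).
    clear HF Ed1 Ec1 Ed2 Ec2 RX2 RX3 SX2 SX3.
    generalize dependent (PhiU a b c d N X). intros Pu1.
    generalize dependent (PhiU a b c d N (X / q)). intros Pu0.
    generalize dependent (PhiU a b d c N X). intros Pv1.
    generalize dependent (PhiU a b d c N (X / q)). intros Pv0.
    set (p1 := 1 - X / d) in *. set (p2 := 1 - X / c) in *.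
    replace (q / (X * d)) with (q / X / d) in Fd2 by (field; auto).
    set (p3 := 1 - q / X / d) in *. set (p4 := 1 - q / X / c) in *.
    clearbody p1 p2 p3 p4 dx.
    field. repeat split; assumption.
  - rewrite HF. unfold cas_shape, cas_zeros, Wrhs, dx.
    replace (a * q / X) with (a * (q / X)) by (unfold Cdiv; ring).
    replace (b * q / X) with (b * (q / X)) by (unfold Cdiv; ring).
    replace (q / (N * c * d)) with (q / N / (c * d)) by (field; auto).
    clear HF Hdx dx.
    repeat match goal with |- context [qinf ?w] => generalize dependent (qinf w) end.
    intros. field. nz.
Qed.

(** * Passing to the limit along regular parameters *)

Section Filters.
Context {T : Type} (F : (T -> Prop) -> Prop) {HF : ProperFilter F}.

Lemma factors_neq0_of_qinf (f : T -> C) (l : C) :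
  clim F f l -> qinf l <> 0 -> F (fun t => forall k : nat, 1 - f t * RtoC q ^ k <> 0).
Proof.
  intros Hf Hl.
  generalize (clim_nonzero F _ _ (clim_qpoch_inf F f l Hf) Hl).
  apply filter_imp. intros t Ht k. apply qpoch_inf_factor, Ht.
Qed.

(** The powers [q^(-k)] form a discrete set, so a function that tends to one of them without
    attaining it avoids all of them eventually. *)
Lemma factors_neq0_of_neq (f : T -> C) (l : C) :
  clim F f l -> F (fun t => f t <> l) -> F (fun t => forall k : nat, 1 - f t * RtoC q ^ k <> 0).
Proof.
  intros Hf Hne.
  assert (Hl := Cmod_ge_0 l).
  destruct (qn_small (1 / (Cmod l + 2))) as [K HK].
  { apply Rdiv_lt_0_compat; lra. }
  assert (Hfin : F (fun t => forall k : nat, (k < K)%nat -> 1 - f t * RtoC q ^ k <> 0)).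
  { clear HK. induction K as [|K IH].
    - apply filter_forall. intros t k Hk. lia.
    - assert (HKc : F (fun t => 1 - f t * RtoC q ^ K <> 0)).
      { destruct (Ceq_dec (1 - l * RtoC q ^ K) 0) as [E | E].
        - generalize Hne. apply filter_imp. intros t Ht Et. apply Ht.
          assert (HqK : RtoC q ^ K <> 0) by (apply Cpow_nz, hq).
          transitivity ((1 - (1 - f t * RtoC q ^ K)) / RtoC q ^ K); [field; exact HqK |].
          rewrite Et, <- E. field. exact HqK.
        - apply (clim_nonzero F (fun t => 1 - f t * RtoC q ^ K) (1 - l * RtoC q ^ K)); [| exact E].
          apply (clim_minus F); [apply (clim_const F) |].
          apply (clim_mult F); [exact Hf | apply (clim_const F)]. }
      generalize (filter_and _ _ IH HKc). apply filter_imp. intros t [H1 H2] k Hk.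
      destruct (Nat.eq_dec k K) as [-> | Hn]; [exact H2 | apply H1; lia]. }
  generalize (filter_and _ _ Hfin (clim_bounded F f l Hf)). apply filter_imp.
  intros t [H1 H2] k. destruct (Nat.lt_ge_cases k K) as [Hk | Hk]; [apply H1, Hk |].
  apply Cmod_lt_neq. rewrite Cmod_1, Cmod_mult, Cmod_qn.
  specialize (HK k Hk). assert (Hqk := qn_pos k).
  apply Rle_lt_trans with ((Cmod l + 1) * q ^ k)%R; [apply Rmult_le_compat_r; lra |].
  assert ((Cmod l + 2) * q ^ k < (Cmod l + 2) * (1 / (Cmod l + 2)))%R
    by (apply Rmult_lt_compat_l; lra).
  replace ((Cmod l + 2) * (1 / (Cmod l + 2)))%R with 1%R in * by (field; lra). lra.
Qed.

Context (fa fb fc fd : T -> C) (a b c d : C).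
Context (ha : a <> 0) (hd : d <> 0).
Context (La : clim F fa a) (Lb : clim F fb b) (Lc : clim F fc c) (Ld : clim F fd d).

Lemma u_regular_eventually (y : C) :
  qinf (b * c) <> 0 -> qinf (a * b) <> 0 -> qinf (a * c) <> 0 -> qinf (a * d) <> 0 ->
  qinf (qpow q (1 + y) / d) <> 0 -> qinf (qpow q (1 - y) / d) <> 0 ->
  F (fun t => fa t * fd t <> a * d) ->
  (qinf (q * b / d) <> 0 \/ F (fun t => q * fb t / fd t <> q * b / d)) ->
  (qinf (q * c / d) <> 0 \/ F (fun t => q * fc t / fd t <> q * c / d)) ->
  F (fun t => u_regular q (fa t) (fb t) (fc t) (fd t) y).
Proof.
  intros Hbc Hab Hac Had Hy1 Hy2 Hne Hqb Hqc.
  assert (Hm := clim_mult F). assert (Hk := clim_const F).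
  assert (had : a * d <> 0) by (apply Cmult_neq_0; assumption).
  assert (Na := clim_nonzero F fa a La ha). assert (Nd := clim_nonzero F fd d Ld hd).
  assert (Hinv : forall k : C, k <> 0 -> F (fun t => k / (fa t * fd t) <> k / (a * d))).
  { intros k Hk0. generalize (filter_and _ _ Hne (filter_and _ _ Na Nd)). apply filter_imp.
    intros t [H1 [H2 H3]] E. apply H1.
    transitivity (k / (k / (fa t * fd t))); [field; auto |]. rewrite E. field. auto. }
  assert (Hq2 : RtoC q ^ 2 <> 0) by (apply Cpow_nz, hq).
  assert (P1 := factors_neq0_of_qinf _ _ (Hm _ _ _ _ Lb Lc) Hbc).
  assert (P2 : F (fun t => forall k : nat, 1 - q / (fa t * fd t) * RtoC q ^ k <> 0)).
  { apply (factors_neq0_of_neq _ (q / (a * d))); [| apply Hinv, hq].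
    apply (clim_div F); auto. }
  assert (P3 := factors_neq0_of_qinf _ _ (Hm _ _ _ _ La Lb) Hab).
  assert (P4 := factors_neq0_of_qinf _ _ (Hm _ _ _ _ La Lc) Hac).
  assert (P5 := factors_neq0_of_qinf _ _ (Hm _ _ _ _ La Ld) Had).
  assert (P6 : F (fun t => forall k : nat, 1 - fa t * fd t / q * RtoC q ^ k <> 0)).
  { apply (factors_neq0_of_neq _ (a * d / q)).
    - apply (clim_div F); auto.
    - generalize Hne. apply filter_imp. intros t H1 E. apply H1.
      transitivity (fa t * fd t / q * q); [field; auto |]. rewrite E. field. auto. }
  assert (P7 : F (fun t => forall k : nat, 1 - qpow q (1 + y) / fd t * RtoC q ^ k <> 0)).
  { apply (factors_neq0_of_qinf _ (qpow q (1 + y) / d)); [| exact Hy1].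
    apply (clim_div F); auto. }
  assert (P8 : F (fun t => forall k : nat, 1 - qpow q (1 - y) / fd t * RtoC q ^ k <> 0)).
  { apply (factors_neq0_of_qinf _ (qpow q (1 - y) / d)); [| exact Hy2].
    apply (clim_div F); auto. }
  assert (P9 : F (fun t => forall k : nat, 1 - q * fb t / fd t * RtoC q ^ k <> 0)).
  { assert (L : clim F (fun t => q * fb t / fd t) (q * b / d)) by (apply (clim_div F); auto).
    destruct Hqb as [H | H];
      [apply (factors_neq0_of_qinf _ _ L H) | apply (factors_neq0_of_neq _ _ L H)]. }
  assert (P10 : F (fun t => forall k : nat, 1 - q * fc t / fd t * RtoC q ^ k <> 0)).
  { assert (L : clim F (fun t => q * fc t / fd t) (q * c / d)) by (apply (clim_div F); auto).
    destruct Hqc as [H | H];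
      [apply (factors_neq0_of_qinf _ _ L H) | apply (factors_neq0_of_neq _ _ L H)]. }
  assert (P11 : F (fun t => forall k : nat,
    1 - RtoC q ^ 2 / (fa t * fd t) * RtoC q ^ k <> 0)).
  { apply (factors_neq0_of_neq _ (RtoC q ^ 2 / (a * d))); [| apply Hinv, Hq2].
    apply (clim_div F); auto. }
  generalize (filter_and _ _ Na (filter_and _ _ Nd (filter_and _ _ P1 (filter_and _ _ P2
    (filter_and _ _ P3 (filter_and _ _ P4 (filter_and _ _ P5 (filter_and _ _ P6
    (filter_and _ _ P7 (filter_and _ _ P8 (filter_and _ _ P9 (filter_and _ _ P10 P11)))))))))))).
  apply filter_imp.
  intros t [Q1 [Q2 [Q3 [Q4 [Q5 [Q6 [Q7 [Q8 [Q9 [Q10 [Q11 [Q12 Q13]]]]]]]]]]]].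
  split; [exact Q1 |]. split; [exact Q2 |].
  repeat (apply List.Forall_cons; [assumption |]). apply List.Forall_nil.
Qed.

Lemma to_u_reg_filter (y : C) :
  F (fun t => u_regular q (fa t) (fb t) (fc t) (fd t) y) ->
  filterlim (fun t => (fa t, fb t, fc t, fd t)) F (u_reg_filter a b c d y).
Proof.
  intros HR P HP. unfold u_reg_filter, within in HP. unfold filtermap.
  destruct HP as [eps Heps].
  assert (He := cond_pos eps).
  generalize (filter_and _ _ HR (filter_and _ _ (La eps He) (filter_and _ _ (Lb eps He)
    (filter_and _ _ (Lc eps He) (Ld eps He))))). apply filter_imp.
  intros t [H [H1 [H2 [H3 H4]]]].
  apply (Heps (fa t, fb t, fc t, fd t)); [| exact H].
  repeat split; apply (norm_compat1 (V := C_NormedModule)); assumption.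
Qed.

(** Regular parameters accumulate at the given ones, so that the value of [u] there is the
    limit of the explicit formula along the family, whether or not they are regular. *)
Lemma u_fun_clim (nu y : C) :
  qinf (b * c) <> 0 -> qinf (a * b) <> 0 -> qinf (a * c) <> 0 -> qinf (a * d) <> 0 ->
  qinf (qpow q (1 + y) / d) <> 0 -> qinf (qpow q (1 - y) / d) <> 0 ->
  F (fun t => u_regular q (fa t) (fb t) (fc t) (fd t) y) ->
  clim F (fun t => u_formula q nu (fa t) (fb t) (fc t) (fd t) y) (u_fun q nu a b c d y).
Proof.
  intros Hbc Hab Hac Had Y1 Y2 HR. assert (Hto := to_u_reg_filter y HR).
  assert (HP : ProperFilter (u_reg_filter a b c d y)).
  { constructor.
    - intros P HPP. destruct (filter_ex (F := F) _ (Hto P HPP)) as [t Ht].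
      exists (fa t, fb t, fc t, fd t). exact Ht.
    - apply within_filter, locally_filter. }
  refine (clim_map F _ _ _ _ Hto (u_fun_limit nu a b c d y HP ha hd _)).
  rewrite qpow_1_plus in Y1. rewrite qpow_1_minus in Y2.
  assert (Hy := qpow_neq0 y). assert (Nq := qinf_q_neq0). unfold Uden.
  replace (q / (d * qpow q y)) with (q / qpow q y / d) by (field; auto).
  repeat apply Cmult_neq_0; assumption.
Qed.

End Filters.

Lemma Wrhs_clim {T : Type} (F : (T -> Prop) -> Prop) {HF : ProperFilter F}
  (fc fd : T -> C) (a b c d N X : C) :
  c <> 0 -> d <> 0 -> N <> 0 -> X <> 0 -> clim F fc c -> clim F fd d ->
  qinf (a * b) <> 0 -> qinf (a * c) <> 0 -> qinf (a * d) <> 0 -> qinf (b * c) <> 0 ->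
  qinf (b * d) <> 0 -> qinf (X / c) <> 0 -> qinf (q / X / c) <> 0 ->
  qinf (X / d) <> 0 -> qinf (q / X / d) <> 0 ->
  clim F (fun t => Wrhs a b (fc t) (fd t) N X) (Wrhs a b c d N X).
Proof.
  intros Hc Hd HN HX Lc Ld H1 H2 H3 H4 H5 H6 H7 H8 H9.
  assert (Hm := clim_mult F). assert (Hk := clim_const F).
  assert (Hp := clim_qpoch_inf F). assert (Hv := clim_div F).
  assert (H1q := C1mq_neq0).
  assert (C1 : clim F (fun t => fc t / fd t) (c / d)) by (apply Hv; assumption).
  assert (C2 : clim F (fun t => q * fd t / fc t) (q * d / c)) by (apply Hv; auto).
  assert (C3 : clim F (fun t => a * b * fc t * fd t * N / q) (a * b * c * d * N / q)).
  { apply Hv; auto. }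
  assert (C4 : clim F (fun t => q / N / (fc t * fd t)) (q / N / (c * d))).
  { apply Hv; auto. apply Cmult_neq_0; assumption. }
  assert (CV : forall k (f : T -> C) (l : C), l <> 0 -> clim F f l ->
    clim F (fun t => qinf (k / f t)) (qinf (k / l))) by (intros; apply Hp, Hv; auto).
  unfold Wrhs. apply Hm; apply Hv.
  - apply Hm; [apply Hk |]. repeat apply Hm; try apply Hk; apply Hp; assumption.
  - apply Hm; [apply Hm; auto |]. repeat apply Hm; try apply Hk; apply Hp; auto.
  - repeat apply Cmult_neq_0; assumption.
  - apply Hk.
  - repeat apply Hm; apply CV; assumption.
  - repeat apply Cmult_neq_0; assumption.
Qed.

End FixedBase.

Theorem mainTheorem3 (q : R) (hq0 : (0 < q)%R) (hq1 : (q < 1)%R)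
  (a b c d : C) (ha0 : a <> 0) (hb0 : b <> 0) (hc0 : c <> 0) (hd0 : d <> 0)
  (ha : (Cmod a < 1)%R) (hb : (Cmod b < 1)%R) (hc : (Cmod c < 1)%R)
  (hqd : (Cmod (q / d) < 1)%R)
  (nu z : C)
  (hx : xz q z <> xz q (z - 1))
  (hden1 : qpochs_inf q [a * b; a * b; a * c; a * d; b * c; b * d] <> 0)
  (hden2 : qpochs_inf q [qpow q z / c; qpow q (1 - z) / c;
                         qpow q z / d; qpow q (1 - z) / d] <> 0) :
  W q (fun y : C => u_fun q nu a b c d y) (fun y : C => u_fun q nu a b d c y) z
  = 2 * q
    * qpochs_inf q [c / d; q * d / c; qpow q (- nu);
                    a * b * c * d * qpow q (nu - 1);
                    a * b * qpow q nu; qpow q (1 - nu) / (c * d)]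
    / ((1 - q) * c
       * qpochs_inf q [a * b; a * b; a * c; a * d; b * c; b * d])
    * (qpochs_inf q [a * qpow q z; a * qpow q (1 - z);
                     b * qpow q z; b * qpow q (1 - z)]
       / qpochs_inf q [qpow q z / c; qpow q (1 - z) / c;
                       qpow q z / d; qpow q (1 - z) / d]).
Proof.
  assert (Hq := Cq_neq0 q hq0).
  assert (HX := qpow_neq0 q z). assert (HN := qpow_neq0 q nu).
  assert (Ml := Cmult_neq0_l). assert (Mr := Cmult_neq0_r).
  assert (D1 := hden1). assert (D2 := hden2).
  cbv [qpochs_inf Cprod map fold_right] in D1, D2.
  assert (Nab := Ml _ _ D1). apply Mr in D1. apply Mr in D1.
  assert (Nac := Ml _ _ D1). apply Mr in D1. assert (Nad := Ml _ _ D1). apply Mr in D1.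
  assert (Nbc := Ml _ _ D1). apply Mr in D1. assert (Nbd := Ml _ _ D1). clear D1.
  assert (NXc := Ml _ _ D2). apply Mr in D2. assert (NYc := Ml _ _ D2). apply Mr in D2.
  assert (NXd := Ml _ _ D2). apply Mr in D2. assert (NYd := Ml _ _ D2). clear D2.
  rewrite (qpow_1_minus q hq0) in NYc, NYd.
  transitivity (Wrhs q a b c d (qpow q nu) (qpow q z)).
  2:{ cbv [qpochs_inf Cprod map fold_right]. unfold Wrhs.
      rewrite !(qpow_1_minus q hq0), (qpow_opp q), (qpow_minus_1 q hq0).
      replace (a * b * c * d * (qpow q nu / q)) with (a * b * c * d * qpow q nu / q)
        by (unfold Cdiv; ring).
      rewrite !Cmult_1_r. f_equal; f_equal; ring. }
  set (X := qpow q z) in *. set (N := qpow q nu) in *.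
  (* along (a, b, c / t, d t), with t = 1 + s and s decreasing to 0, the quantities ad, ac, b/c,
     d/c and d^2, which may be singular at the limit, all move away from it *)
  set (F := at_right 0).
  set (t := fun s : R => RtoC (1 + s)).
  assert (Hm := clim_mult F). assert (Hk := clim_const F). assert (Hv := clim_div F).
  assert (Lt : clim F t 1).
  { intros eps Heps. exists (mkposreal eps Heps). intros s Hs Hs0.
    unfold t. rewrite RtoC_plus. replace (1 + RtoC s - 1) with (RtoC s) by ring.
    rewrite Cmod_R. change (Rabs (s + - 0) < eps)%R in Hs.
    rewrite Ropp_0, Rplus_0_r in Hs. exact Hs. }
  assert (Hpos : F (fun s => (0 < s)%R)).
  { exists (mkposreal 1 Rlt_0_1). intros s _ Hs. exact Hs. }
  assert (Ht : F (fun s => t s <> 0 /\ t s <> 1 /\ t s * t s <> 1)).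
  { generalize Hpos. apply filter_imp. intros s Hs. unfold t.
    assert (H2 : (1 < (1 + s) * (1 + s))%R).
    { replace 1%R with (1 * 1)%R at 1 by ring. apply Rmult_le_0_lt_compat; lra. }
    rewrite <- RtoC_mult. repeat split; intros E; apply RtoC_inj in E; lra. }
  set (fc := fun s => c / t s). set (fd := fun s => d * t s).
  assert (Lc : clim F fc c).
  { replace c with (c / 1) by (field; apply C1_nz). apply Hv; auto using C1_nz. }
  assert (Ld : clim F fd d).
  { replace d with (d * 1) by ring. apply Hm; auto. }
  assert (La := Hk a). assert (Lb := Hk b).
  (* a value that moves with t differs from its limit *)
  assert (Mv1 : forall l : C, l <> 0 -> F (fun s => l * t s <> l)).
  { intros l Hl. generalize Ht. apply filter_imp. intros s [_ [H _]] E. apply H.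
    transitivity (l * t s / l); [field; exact Hl | rewrite E; field; exact Hl]. }
  assert (Mv2 : forall l : C, l <> 0 -> F (fun s => l * (t s * t s) <> l)).
  { intros l Hl. generalize Ht. apply filter_imp. intros s [_ [_ H]] E. apply H.
    transitivity (l * (t s * t s) / l); [field; exact Hl | rewrite E; field; exact Hl]. }
  assert (Mad : F (fun s => a * fd s <> a * d)).
  { generalize (Mv1 (a * d) (Cmult_neq_0 _ _ ha0 hd0)). apply filter_imp. intros s H E.
    apply H. transitivity (a * fd s); [unfold fd; ring | exact E]. }
  assert (Mac : F (fun s => a * fc s <> a * c)).
  { generalize (filter_and _ _ Ht (Mv1 (a * c) (Cmult_neq_0 _ _ ha0 hc0))). apply filter_imp.
    intros s [[H0 _] H] E. apply H.
    transitivity (a * fc s * t s); [rewrite E; ring | unfold fc; field; exact H0]. }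
  assert (Mbc : F (fun s => q * b / fc s <> q * b / c)).
  { assert (Hl : q * b / c <> 0).
    { intros E. apply (Cmult_neq_0 _ _ Hq hb0). transitivity (q * b / c * c);
        [field; exact hc0 | rewrite E; ring]. }
    generalize (filter_and _ _ Ht (Mv1 _ Hl)). apply filter_imp.
    intros s [[H0 _] H] E. apply H.
    transitivity (q * b / fc s); [unfold fc; field; auto | exact E]. }
  assert (Mdc : F (fun s => q * fd s / fc s <> q * d / c)).
  { assert (Hl : q * d / c <> 0).
    { intros E. apply (Cmult_neq_0 _ _ Hq hd0). transitivity (q * d / c * c);
        [field; exact hc0 | rewrite E; ring]. }
    generalize (filter_and _ _ Ht (Mv2 _ Hl)). apply filter_imp.
    intros s [[H0 _] H] E. apply H.
    transitivity (q * fd s / fc s); [unfold fc, fd; field; auto | exact E]. }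
  assert (Mdd : F (fun s => q - fd s * fd s <> 0)).
  { destruct (Ceq_dec (q - d * d) 0) as [E0 | E0].
    - generalize (Mv2 _ (Cmult_neq_0 _ _ hd0 hd0)). apply filter_imp. intros s H E. apply H.
      apply Cminus_eq_0 in E0. apply Cminus_eq_0 in E.
      transitivity (fd s * fd s); [unfold fd; ring |]. rewrite <- E. exact E0.
    - apply (clim_nonzero F _ (q - d * d)); [| exact E0].
      apply (clim_minus F); auto. }
  assert (Mqd : F (fun s => (Cmod (q / fd s) < 1)%R)).
  { assert (L : clim F (fun s => q / fd s) (q / d)) by (apply Hv; auto).
    assert (He : (0 < 1 - Cmod (q / d))%R) by lra.
    generalize (L _ He). apply filter_imp. intros s Hs.
    generalize (Cmod_le_plus (q / fd s) (q / d)). lra. }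
  assert (Hsm : forall k : C, (Cmod k < 1)%R -> qpoch_inf q (q * k / d) <> 0).
  { intros k Hk1. apply (qpoch_inf_small_neq0 q hq0 hq1).
    replace (q * k / d) with (k * (q / d)) by (field; exact hd0). rewrite Cmod_mult.
    apply Rle_lt_trans with (1 * Cmod (q / d))%R; [| lra].
    apply Rmult_le_compat_r; [apply Cmod_ge_0 | lra]. }
  (* the four denominators in X, for both d and c *)
  assert (Hsh : forall k : C, k <> 0 -> qpoch_inf q (X / k) <> 0 -> qpoch_inf q (q / X / k) <> 0 ->
    (qpoch_inf q (qpow q (1 + z) / k) <> 0 /\ qpoch_inf q (qpow q (1 - z) / k) <> 0) /\
    (qpoch_inf q (qpow q (1 + (z - 1)) / k) <> 0 /\ qpoch_inf q (qpow q (1 - (z - 1)) / k) <> 0)).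
  { intros k Hk0 K1 K2.
    rewrite !(qpow_1_plus q hq0), !(qpow_1_minus q hq0), !(qpow_minus_1 q hq0). fold X.
    replace (q * (X / q) / k) with (X / k) by (field; auto).
    replace (q / (X / q) / k) with (q / X / k * q) by (field; auto).
    replace (q * X / k) with (X / k * q) by (field; auto).
    split; split; try assumption.
    - rewrite (qpoch_inf_S q hq0 hq1) in K1. apply (Mr _ _ K1).
    - rewrite (qpoch_inf_S q hq0 hq1) in K2. apply (Mr _ _ K2). }
  destruct (Hsh d hd0 NXd NYd) as [[Ud1 Ud2] [Ud3 Ud4]].
  destruct (Hsh c hc0 NXc NYc) as [[Uc1 Uc2] [Uc3 Uc4]].
  assert (Ru : forall y, qpoch_inf q (qpow q (1 + y) / d) <> 0 ->
    qpoch_inf q (qpow q (1 - y) / d) <> 0 -> F (fun s => u_regular q a b (fc s) (fd s) y)).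
  { intros y Y1 Y2.
    apply (u_regular_eventually q hq0 hq1 F (fun _ => a) (fun _ => b) fc fd a b c d); auto. }
  assert (Rv : forall y, qpoch_inf q (qpow q (1 + y) / c) <> 0 ->
    qpoch_inf q (qpow q (1 - y) / c) <> 0 -> F (fun s => u_regular q a b (fd s) (fc s) y)).
  { intros y Y1 Y2.
    apply (u_regular_eventually q hq0 hq1 F (fun _ => a) (fun _ => b) fd fc a b d c); auto. }
  assert (LU : forall y, qpoch_inf q (qpow q (1 + y) / d) <> 0 ->
    qpoch_inf q (qpow q (1 - y) / d) <> 0 ->
    clim F (fun s => u_formula q nu a b (fc s) (fd s) y) (u_fun q nu a b c d y)).
  { intros y Y1 Y2.
    apply (u_fun_clim q hq0 hq1 F (fun _ => a) (fun _ => b) fc fd a b c d); auto. }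
  assert (LV : forall y, qpoch_inf q (qpow q (1 + y) / c) <> 0 ->
    qpoch_inf q (qpow q (1 - y) / c) <> 0 ->
    clim F (fun s => u_formula q nu a b (fd s) (fc s) y) (u_fun q nu a b d c y)).
  { intros y Y1 Y2.
    apply (u_fun_clim q hq0 hq1 F (fun _ => a) (fun _ => b) fd fc a b d c); auto. }
  assert (Hxd : xz q z - xz q (z - 1) <> 0) by (intros E; apply hx, Cminus_eq_0, E).
  apply (clim_unique F (fun s => Wrhs q a b (fc s) (fd s) N X)).
  2:{ apply (Wrhs_clim q hq0 hq1 F); assumption. }
  apply (clim_ext_loc F (fun s =>
    u_formula q nu a b (fc s) (fd s) z
      * ((u_formula q nu a b (fd s) (fc s) z - u_formula q nu a b (fd s) (fc s) (z - 1))
         / (xz q z - xz q (z - 1)))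
    - u_formula q nu a b (fd s) (fc s) z
      * ((u_formula q nu a b (fc s) (fd s) z - u_formula q nu a b (fc s) (fd s) (z - 1))
         / (xz q z - xz q (z - 1))))).
  - generalize (filter_and _ _ (filter_and _ _ (Ru z Ud1 Ud2) (Ru (z - 1) Ud3 Ud4))
      (filter_and _ _ (filter_and _ _ (Rv z Uc1 Uc2) (Rv (z - 1) Uc3 Uc4))
        (filter_and _ _ Mdd Mqd))).
    apply filter_imp. intros s [[H1 H2] [[H3 H4] [H5 H6]]].
    apply (wronskian_regular q hq0 hq1); try assumption.
    + apply H3.
    + apply H1.
  - unfold W. apply (clim_minus F); apply Hm; auto;
      apply Hv; auto; apply (clim_minus F); auto.
Qed.
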